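(* The ordered Ramsey numbers of all ordered graphs without isolated vertices on at most $4$ vertices, other than the orderings of $K_4^-$ ($K_4$ minus an edge), up to reflection, are as follows, where each ordered graph has vertex set $1<2<\dots<m$ ($m\in\{2,3,4\}$) and is given by its edge set: \begin{itemize} \item $K_2$: $\vec R(\{12\})=2$. \item $P_3$: $\vec R(\{13,23\})=4$, $\vec R(\{12,23\})=5$. \item $C_3$: $\vec R(\{12,13,23\})=6$. \item $2K_2$: $\vec R(\{14,23\})=6$, $\vec R(\{13,24\})=5$, $\vec R(\{12,34\})=6$. \item $P_4$: $\vec R(\{14,23,34\})=9$, $\vec R(\{14,23,24\})=7$, $\vec R(\{13,24,34\})=9$, $\vec R(\{13,23,24\})=7$, $\vec R(\{13,14,24\})=7$, $\vec R(\{12,24,34\})=9$, $\vec R(\{12,23,34\})=10$, $\vec R(\{12,14,34\})=10$. \item $K_{1,3}$: $\vec R(\{14,24,34\})=6$, $\vec R(\{13,23,34\})=9$. \item Paw (triangle with a pendant edge): $\vec R(\{14,23,24,34\})=10$, $\vec R(\{13,23,24,34\})=10$, $\vec R(\{13,14,24,34\})=10$, $\vec R(\{13,14,23,34\})=11$, $\vec R(\{12,23,24,34\})=11$, $\vec R(\{12,14,24,34\})=10$. \item $C_4$: $\vec R(\{13,14,23,24\})=10$, $\vec R(\{12,14,23,34\})=14$, $\vec R(\{12,13,24,34\})=11$. \item $K_4$: $\vec R(\{12,13,14,23,24,34\})=18$. \end{itemize}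
   Context: An ordered graph is a graph with a linear order on its vertices. Here $ij$ denotes the edge between vertices $i$ and $j$. The vertices of $K_n$ are linearly ordered as $1<\dots<n$, and a copy of an ordered graph $\mathcal G$ in $K_n$ is a (not necessarily induced) subgraph isomorphic to $\mathcal G$ via an order-preserving map. The ordered Ramsey number $\vec R(\mathcal G)$ is the smallest integer $n$ such that every $2$-edge-coloring of the ordered complete graph $K_n$ contains a copy of $\mathcal G$ all of whose edges have the same color. Reversing the vertex order of $\mathcal G$ (reflection) does not change $\vec R(\mathcal G)$. *)

(* Defs.v *)
From HB Require Import structures.
From mathcomp Require Import all_boot all_order.

Set Implicit Arguments.
Unset Strict Implicit.
Unset Printing Implicit Defensive.

(* The linear order on the vertices is the natural order of 'I_m; the paper's
   vertex k (1 <= k <= m) is the ordinal of value k.-1. *)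
Record ordGraph (m : nat) := OrdGraph {
  adj :> rel 'I_m;
  adj_sym : symmetric adj;
  adj_irr : irreflexive adj }.

Definition edges := seq (nat * nat).

Section GraphOf.
Variables (m : nat) (E : edges).

(* Edge lists use the paper's 1-based vertex names. *)
Definition edge_rel : rel 'I_m := fun i j =>
  (i != j) && (((i.+1, j.+1) \in E) || ((j.+1, i.+1) \in E)).

Lemma edge_rel_sym : symmetric edge_rel.
Proof. by move=> i j; rewrite /edge_rel eq_sym orbC. Qed.

Lemma edge_rel_irr : irreflexive edge_rel.
Proof. by move=> i; rewrite /edge_rel eqxx. Qed.

Definition graph_of : ordGraph m := OrdGraph edge_rel_sym edge_rel_irr.
End GraphOf.

Section Reflection.
Variables (m : nat) (G : ordGraph m).

Definition refl_rel : rel 'I_m := fun i j => G (rev_ord i) (rev_ord j).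

Lemma refl_rel_sym : symmetric refl_rel.
Proof. by move=> i j; apply: adj_sym. Qed.

Lemma refl_rel_irr : irreflexive refl_rel.
Proof. by move=> i; apply: adj_irr. Qed.

Definition reflection : ordGraph m := OrdGraph refl_rel_sym refl_rel_irr.
End Reflection.

Definition no_isolated m (G : ordGraph m) : Prop := forall v, exists w, G v w.

(* Isomorphism of the underlying unordered graphs: G is an ordering of H. *)
Definition ordering_of m n (G : ordGraph m) (H : ordGraph n) : Prop :=
  exists2 f : 'I_m -> 'I_n, bijective f & forall i j, H (f i) (f j) = G i j.

Definition ord_iso m n (G : ordGraph m) (H : ordGraph n) : Prop :=
  exists f : 'I_m -> 'I_n,
    [/\ bijective f, {mono f : i j / i < j}
      & forall i j, H (f i) (f j) = G i j].

Definition same_up_to_reflection m n (G : ordGraph m) (H : ordGraph n) : Prop :=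
  ord_iso G H \/ ord_iso (reflection G) H.

(* The edge between u and v in K_n is the 2-element set [set u; v]; the values
   of a colouring on sets that are not edges are never used. *)
Definition mono_copy m n (G : ordGraph m) (c : {set 'I_n} -> bool) : Prop :=
  exists (f : 'I_m -> 'I_n) (b : bool),
    {mono f : i j / i < j} /\ forall i j, G i j -> c [set f i; f j] = b.

Definition ramsey_for m (G : ordGraph m) (n : nat) : Prop :=
  forall c : {set 'I_n} -> bool, mono_copy G c.

Definition ordered_ramsey_number m (G : ordGraph m) (r : nat) : Prop :=
  ramsey_for G r /\ forall n, ramsey_for G n -> r <= n.

(* A row says that the ordered graph on 1 < ... < nverts with edge set edgeset
   is an ordering of the graph with edge set shape on the same vertices and has
   ordered Ramsey number value. *)
Record row := Row {
  nverts : nat;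
  shape : edges;
  edgeset : edges;
  value : nat }.

Definition row_tuple (x : row) := (nverts x, shape x, edgeset x, value x).
Definition tuple_row (t : nat * edges * edges * nat) :=
  let: (m, F, E, r) := t in Row m F E r.
Lemma row_tupleK : cancel row_tuple tuple_row. Proof. by case. Qed.
HB.instance Definition _ := Equality.copy row (can_type row_tupleK).

Definition row_graph (x : row) : ordGraph (nverts x) :=
  graph_of (nverts x) (edgeset x).
Definition row_shape (x : row) : ordGraph (nverts x) :=
  graph_of (nverts x) (shape x).

Definition K2_edges : edges := [:: (1,2)].
Definition P3_edges : edges := [:: (1,2); (2,3)].
Definition C3_edges : edges := [:: (1,2); (1,3); (2,3)].
Definition twoK2_edges : edges := [:: (1,2); (3,4)].
Definition P4_edges : edges := [:: (1,2); (2,3); (3,4)].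
Definition K13_edges : edges := [:: (1,2); (1,3); (1,4)].
Definition paw_edges : edges := [:: (1,2); (1,3); (2,3); (3,4)].
Definition C4_edges : edges := [:: (1,2); (2,3); (3,4); (1,4)].
Definition K4_edges : edges := [:: (1,2); (1,3); (1,4); (2,3); (2,4); (3,4)].

Definition K4minus : ordGraph 4 :=
  graph_of 4 [:: (1,2); (1,3); (1,4); (2,3); (2,4)].

Definition table : seq row := [::
  Row 2 K2_edges [:: (1,2)] 2;

  Row 3 P3_edges [:: (1,3); (2,3)] 4;
  Row 3 P3_edges [:: (1,2); (2,3)] 5;

  Row 3 C3_edges [:: (1,2); (1,3); (2,3)] 6;

  Row 4 twoK2_edges [:: (1,4); (2,3)] 6;
  Row 4 twoK2_edges [:: (1,3); (2,4)] 5;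
  Row 4 twoK2_edges [:: (1,2); (3,4)] 6;

  Row 4 P4_edges [:: (1,4); (2,3); (3,4)] 9;
  Row 4 P4_edges [:: (1,4); (2,3); (2,4)] 7;
  Row 4 P4_edges [:: (1,3); (2,4); (3,4)] 9;
  Row 4 P4_edges [:: (1,3); (2,3); (2,4)] 7;
  Row 4 P4_edges [:: (1,3); (1,4); (2,4)] 7;
  Row 4 P4_edges [:: (1,2); (2,4); (3,4)] 9;
  Row 4 P4_edges [:: (1,2); (2,3); (3,4)] 10;
  Row 4 P4_edges [:: (1,2); (1,4); (3,4)] 10;

  Row 4 K13_edges [:: (1,4); (2,4); (3,4)] 6;
  Row 4 K13_edges [:: (1,3); (2,3); (3,4)] 9;

  Row 4 paw_edges [:: (1,4); (2,3); (2,4); (3,4)] 10;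
  Row 4 paw_edges [:: (1,3); (2,3); (2,4); (3,4)] 10;
  Row 4 paw_edges [:: (1,3); (1,4); (2,4); (3,4)] 10;
  Row 4 paw_edges [:: (1,3); (1,4); (2,3); (3,4)] 11;
  Row 4 paw_edges [:: (1,2); (2,3); (2,4); (3,4)] 11;
  Row 4 paw_edges [:: (1,2); (1,4); (2,4); (3,4)] 10;

  Row 4 C4_edges [:: (1,3); (1,4); (2,3); (2,4)] 10;
  Row 4 C4_edges [:: (1,2); (1,4); (2,3); (3,4)] 14;
  Row 4 C4_edges [:: (1,2); (1,3); (2,4); (3,4)] 11;

  Row 4 K4_edges [:: (1,2); (1,3); (1,4); (2,3); (2,4); (3,4)] 18 ].

(* Main.v *)
(* For a fixed n the upper bounds are finite statements about the colours of the
   edges of K_n.  Every row but the last is settled by a splitting tree: branch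
   on the colour of an edge, and whenever all edges but one of a copy have the
   same colour, give the remaining edge the other colour; every branch ends in a
   monochromatic copy.  The trees were found by a lookahead search and are
   replayed by the stack machine [refutes].  For K_4 such a tree is too large;
   there R(4,4) <= 18 follows in the classical way from R(3,4) <= 9.  The lower
   bounds are explicit colourings.  That the table is complete and free of
   repetitions is a finite check, since an order isomorphism between ordered
   graphs on the same vertices is the identity. *)

(* The statement speaks of colourings of sets of ordinals and of functions between ordinals, neither
   of which evaluates. The finite checks therefore run in a second model: a vertex is a natural
   number, a colouring is a function of two naturals queried only at i < j, a copy is an increasing
   list of vertices, and an ordered graph is a relation on naturals. Bridge lemmas tie each notion
   of the statement to a boolean one that [vm_compute] decides.

   The two colours are interchangeable, which lets a refutation fix the colour of its first edge. A
   colouring that avoids a graph still avoids it after vertices are deleted, so a single colouring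
   on r - 1 vertices yields the whole lower bound r.

   For K_4 the recurrence R(k,l) <= R(k-1,l) + R(k,l-1) alone gives R(3,4) <= 4 + 6 = 10 and hence
   only R(4,4) <= 20. A parity argument saves one vertex in R(3,4), and then 9 + 9 = 18 is the exact
   value. *)
From Stdlib Require Import BinNat.
Require Import Defs.
From mathcomp Require Import all_boot all_order.

Set Implicit Arguments.
Unset Strict Implicit.
Unset Printing Implicit Defensive.

(** * Copies and colourings on natural numbers *)

(* Vertices are 0, ..., n.-1 and only the values at i < j matter. *)
Definition colouring := nat -> nat -> bool.

(** The list [s] holds the vertices of a copy in increasing order, so its entry k - 1 plays the
    pattern's vertex k; the shift by one comes from the one-based edge names. *)
Definition place (s : seq nat) (e : nat * nat) : nat * nat :=
  (nth 0 s e.1.-1, nth 0 s e.2.-1).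

(** On booleans, [x (+) ~~ b] is the test x = b. *)
Definition monochromatic (E : edges) (col : colouring) (s : seq nat) (b : bool) :=
  all (fun e => let: (i, j) := place s e in col i j (+) ~~ b) E.

Definition is_copy (m n : nat) (s : seq nat) :=
  [&& size s == m, sorted ltn s & all (ltn^~ n) s].

(** Pascal's rule: an m-subset of the first n vertices either misses the last one or has it as its
    largest element. *)
Fixpoint copies (m n : nat) : seq (seq nat) :=
  match m, n with
  | 0, _ => [:: [::]]
  | _.+1, 0 => [::]
  | m'.+1, n'.+1 => copies m n' ++ [seq rcons s n' | s <- copies m' n']
  end.

(** An increasing list is bounded by its last entry, so the bound [n] has to be tested only there.
    Peeling off the largest vertex in this way matches the recursion of [copies]. *)
Lemma is_copy_rcons m n s i :
  is_copy m.+1 n (rcons s i) = is_copy m i s && (i < n).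
Proof.
rewrite /is_copy size_rcons eqSS all_rcons.
have -> : sorted ltn (rcons s i) = all (ltn^~ i) s && sorted ltn s.
  by rewrite -cats1 sorted_pairwise ?pairwise_cat ?sorted_pairwise //=;
    [rewrite allrel1r andbT | exact: ltn_trans..].
case: (size s == m) => //=; case: (sorted ltn s); rewrite ?andbF ?andbT //=.
case lt_in: (i < n); rewrite ?andbF //= andbT; apply/andb_idr.
by apply: sub_all => j /ltn_trans; apply.
Qed.

Lemma mem_copies m n s : (s \in copies m n) = is_copy m n s.
Proof.
elim: n m s => [|n IHn] [|m] s.
- by case: s.
- by case: s => [|i s] //; rewrite /is_copy /= !andbF.
- by case: s.
case/lastP: s => [|s i].
  rewrite mem_cat IHn /is_copy /=; apply/mapP => -[t _] /(congr1 size).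
  by rewrite size_rcons.
rewrite /= mem_cat IHn !is_copy_rcons.
have -> : (rcons s i \in [seq rcons t n | t <- copies m n])
          = is_copy m i s && (i == n).
  apply/mapP/andP => [[t cp_t /rcons_inj[-> ->]] | [cp_s /eqP eq_in]].
    by rewrite -IHn.
  by exists s; rewrite ?IHn -?eq_in.
(* The largest vertex is below n or equal to n; these are the two halves of [copies]. *)
by rewrite -andb_orr ltnS [i <= n]leq_eqVlt orbC.
Qed.

Definition avoids (m : nat) (E : edges) (n : nat) (col : colouring) :=
  forall s b, is_copy m n s -> ~~ monochromatic E col s b.

(** Listing the smaller end first guarantees that a colouring is queried only at i < j. *)
Definition well_formed (m : nat) (E : edges) :=
  all (fun e => [&& 0 < e.1, e.1 < e.2 & e.2 <= m]) E.

(** Increasing positions of an increasing list hold increasing vertices, and well-formedness keeps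
    both positions inside the list, away from the default 0 of [nth]. *)
Lemma place_ltn m n E s e : well_formed m E -> is_copy m n s -> e \in E ->
  (place s e).1 < (place s e).2 < n.
Proof.
move=> /allP wfE /and3P[/eqP sz_s srt /allP lt_s] /wfE /and3P[].
rewrite /place; case: e => [[|i] [|j]] //= _ ij jm.
have -> : nth 0 s j < n by apply: lt_s; rewrite mem_nth ?sz_s.
rewrite andbT.
apply: (sorted_ltn_nth ltn_trans) => //;
  by rewrite inE sz_s ?(leq_trans (ltnW ij)).
Qed.

(** The colour b is universally quantified in [avoids], so the instance at [~~ b] serves the
    exchanged colouring. *)
Lemma avoids_neg m E n col :
  avoids m E n col -> avoids m E n (fun i j => ~~ col i j).
Proof.
move=> av s b /(av s (~~ b)); apply: contra => mono; apply: sub_all mono => e.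
by case: (place s e) => i j; case: (col i j) b => [] [].
Qed.

Lemma avoids_leq m E n n' col : n' <= n -> avoids m E n col -> avoids m E n' col.
Proof.
move=> le_n av s b /and3P[sz srt lt_s]; apply: av; rewrite /is_copy sz srt /=.
by apply: sub_all lt_s => i /leq_trans; apply.
Qed.

(** An order embedding of ['I_m] into ['I_n] is the same thing as the increasing list of its values.
    The two colourings need to agree only on u < v, because [place] puts every well-formed edge on
    an increasing pair. *)
Lemma mono_copyP m n (E : edges) (c : {set 'I_n} -> bool) (col : colouring) :
    well_formed m E ->
    (forall u v : 'I_n, u < v -> c [set u; v] = col u v) ->
  mono_copy (graph_of m E) c <->
  exists s b, is_copy m n s /\ monochromatic E col s b.
Proof.
move=> wfE c_col; split=> [[f [b [f_mono f_col]]] | [s [b [cp_s mono_s]]]].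
  exists [seq val (f i) | i <- enum 'I_m], b; split.
    apply/and3P; split; first by rewrite size_map size_enum_ord.
      apply: (homo_sorted (e := relpre val ltn)) => [i j /=|].
        by rewrite f_mono.
      by rewrite -sorted_map val_enum_ord iota_ltn_sorted.
    by apply/allP => _ /mapP[i _ ->]; exact: ltn_ord.
  (* Well-formedness excludes vertices named 0, so an edge reads (i + 1, j + 1) and its ends sit at
     the positions i and j. *)
  apply/allP => -[[|i] [|j]] e_E; have /= := allP wfE _ e_E => // /andP[ij jm].
  have im : i < m by exact: leq_trans (ltnW ij) jm.
  have nthE k (km : k < m) :
      nth 0 [seq val (f i) | i <- enum 'I_m] k = f (Ordinal km).
    by rewrite (nth_map (Ordinal km)) ?size_enum_ord // (nth_ord_enum _ (Ordinal km)).
  rewrite /place /= !nthE -c_col ?f_mono // f_col; first by case: (b).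
  by rewrite /= /edge_rel -val_eqE /= e_E ltn_eqF.
have [/eqP sz_s srt lt_s] := and3P cp_s.
have lt_nth (i : 'I_m) : nth 0 s i < n by apply: (allP lt_s); rewrite mem_nth ?sz_s.
exists (fun i => Ordinal (lt_nth i)), b; split=> [i j /=|].
  (* The increasing list gives one implication; the converse follows by trichotomy, since equal or
     reversed indices have equal or reversed images. *)
  have f_homo : {homo (nth 0 s) : x y / x < y < m >-> x < y}.
    move=> x y /andP[xy ym]; apply: (sorted_ltn_nth ltn_trans) => //;
      by rewrite inE sz_s // (ltn_trans xy).
  case: (ltngtP i j) => [ij|ji|/val_inj->]; last by rewrite ltnn.
  - by rewrite f_homo ?ij /=.
  - by apply/negbTE; rewrite -leqNgt ltnW // f_homo ?ji /=.
(* [graph_of] is the symmetric closure of the edge list, whereas [mono_s] speaks only of the listed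
   orientation. The other orientation reduces to it because an edge of K_n is an unordered set. *)
have half (i j : 'I_m) : (i.+1, j.+1) \in E ->
    c [set Ordinal (lt_nth i); Ordinal (lt_nth j)] = b.
  move=> e_E; have := place_ltn wfE cp_s e_E => /= /andP[lt_ij _].
  rewrite c_col //; have := allP mono_s _ e_E => /=.
  by case: (col _ _) (b) => [] [].
by move=> i j /andP[_ /orP[]] /half //; rewrite setUC.
Qed.

(** Each direction manufactures a colouring of one kind from one of the other kind, agreeing with it
    on increasing pairs. *)
Lemma ramsey_forP m n E : well_formed m E ->
  ramsey_for (graph_of m E) n <-> forall col, ~ avoids m E n col.
Proof.
move=> wfE; split=> [ram col av | noav c].
  (* The set {u, v} with u < v contains a single increasing pair, so [c] returns [col u v] on it
     even if [col] is not symmetric. *)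
  pose c (A : {set 'I_n}) := [exists u in A, exists v in A, (u < v) && col u v].
  have c_col (u v : 'I_n) : u < v -> c [set u; v] = col u v.
    move=> uv; apply/exists_inP/idP => [[x] | col_uv].
      move=> /set2P[] -> /exists_inP[y] /set2P[] -> /andP[] //.
      - by rewrite ltnn.
      - by rewrite ltnNge ltnW.
      - by rewrite ltnn.
    exists u; rewrite ?set21 //; apply/exists_inP.
    by exists v; rewrite ?set22 ?uv.
  have [s [b [cp_s mono]]] := (mono_copyP wfE c_col).1 (ram c).
  by have := av s b cp_s; rewrite mono.
(* A comprehension lets i and j be arbitrary naturals, without proofs that they are below n. *)
pose col i j := c [set x : 'I_n | (x == i :> nat) || (x == j :> nat)].
have c_col (u v : 'I_n) : u < v -> c [set u; v] = col u v.
  by move=> _; congr c; apply/setP=> x; rewrite !inE.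
apply/(mono_copyP wfE c_col).
(* [noav] is only a negation; searching the finite list [copies m n] turns it into an actual
   copy. *)
pose mono s := monochromatic E col s true || monochromatic E col s false.
have [/hasP[s] | /hasPn no_mono] := boolP (has mono (copies m n)).
  by rewrite mem_copies => cp_s /orP[]; [exists s, true | exists s, false].
case: (noav col) => s b; rewrite -mem_copies => /no_mono.
by rewrite negb_or => /andP[]; case: b.
Qed.

(** * Refutations by splitting and unit propagation *)

(* A refutation is a binary tree listed in preorder.  [Copy s] names the vertices
   of a copy all of whose coloured edges agree: it closes the branch if no edge
   of the copy is uncoloured, and forces the colour of a single uncoloured edge. *)
Inductive token := Split of nat & nat | Copy of seq nat.

Definition partial_colouring := seq (seq (option bool)).

(* The pair i < j is stored at index i of row j. *)
Definition colour_of (a : partial_colouring) (i j : nat) : option bool :=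
  nth None (nth [::] a j) i.

(** [set_nth] pads with defaults that mean uncoloured, so rows grow on demand and [[::]] is the
    partial colouring that colours nothing. *)
Definition assign (a : partial_colouring) (i j : nat) (b : bool) :=
  set_nth [::] a j (set_nth None (nth [::] a j) i (Some b)).

Definition extends (col : colouring) (a : partial_colouring) :=
  forall i j b, colour_of a i j = Some b -> col i j = b.

Lemma colour_of_assign a i j b i' j' :
  colour_of (assign a i j b) i' j' =
  if (i' == i) && (j' == j) then Some b else colour_of a i' j'.
Proof.
rewrite /colour_of /assign nth_set_nth /=.
by have [->|] := eqVneq j' j; rewrite ?andbF ?andbT // nth_set_nth /=; case: eqP.
Qed.

Lemma extends_assign col a i j b :
  extends col a -> col i j = b -> extends col (assign a i j b).
Proof.
move=> ext colij i' j' b'; rewrite colour_of_assign.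
by case: andP => [[/eqP-> /eqP->] [<-] | _ /ext].
Qed.

Section Refutation.
Variables (m : nat) (E : edges) (n : nat).

Definition has_colour (a : partial_colouring) (b : bool) (p : nat * nat) :=
  if colour_of a p.1 p.2 is Some b' then b' (+) ~~ b else false.

Definition uncoloured (a : partial_colouring) (p : nat * nat) :=
  if colour_of a p.1 p.2 is Some _ then false else true.

(** [pending] is the stack of postponed branches, each the [true] side of an earlier split. The
    colour b is [true] as soon as one edge of the copy is coloured [true]; excluding [~~ b] then
    rejects copies that already show both colours. Every token is verified before use, so a
    certificate need not be trusted. *)
Fixpoint refutes (ts : seq token) (a : partial_colouring)
    (pending : seq partial_colouring) : bool :=
  if ts is t :: ts' then
    match t with
    | Split i j => refutes ts' (assign a i j false) (assign a i j true :: pending)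
    | Copy s =>
      let ps := map (place s) E in
      let b := has (has_colour a true) ps in
      if is_copy m n s && ~~ has (has_colour a (~~ b)) ps then
        match filter (uncoloured a) ps with
        | [::] => if pending is a' :: pending' then refutes ts' a' pending' else true
        | [:: p] => refutes ts' (assign a p.1 p.2 (~~ b)) pending
        | _ => false
        end
      else false
    end
  else false.

(** Soundness is an invariant of the stack: acceptance means that an avoiding colouring extends none
    of the open branches, neither the current one nor a pending one. At a split the colouring itself
    tells which of the two children it extends. *)
Lemma refutesP col ts a pending : avoids m E n col -> refutes ts a pending ->
  forall a', a' \in a :: pending -> ~ extends col a'.
Proof.
move=> av; elim: ts a pending => //= -[i j|s] ts IHts a pending.
  move=> /IHts {}IHts a'; rewrite in_cons => /predU1P[-> | a'_pending]; last first.
    by apply: IHts; rewrite 2!in_cons a'_pending !orbT.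
  case colij: (col i j) => ext.
    apply: (IHts (assign a i j true)); last exact: extends_assign.
    by rewrite 2!in_cons eqxx orbT.
  apply: (IHts (assign a i j false)); last exact: extends_assign.
  exact: mem_head.
case: ifP => // /andP[cp_s].
set ps := map _ E; set b := has (has_colour a true) ps => /hasPn no_other.
(* Since [col] avoids the pattern, some edge of this copy has colour [~~ b]. No coloured edge of the
   copy has it, so it is an uncoloured one: with none left the branch is contradictory, with one
   left that edge is forced. *)
have forced : extends col a ->
    exists2 p, p \in filter (uncoloured a) ps & col p.1 p.2 = ~~ b.
  move=> ext; have /allPn[e e_E] := av s b cp_s.
  case def_p: (place s e) => [i j] colij; exists (i, j); last first.
    by case: (col i j) (b) colij => [] [].
  have p_ps : (i, j) \in ps by apply/mapP; exists e.
  rewrite mem_filter p_ps andbT /uncoloured /=.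
  have := no_other _ p_ps; rewrite /has_colour /=.
  case colour: (colour_of a i j) => [b'|] //.
  by move/ext: colour colij => ->; case: b' (b) => [] [].
(* Two or more uncoloured edges force nothing, and the machine rejects such a token. *)
case def_f: (filter _ _) => [|p [|//]].
  have not_ext : ~ extends col a by move=> /forced[]; rewrite def_f.
  case: pending => [_|a1 pending /IHts {}IHts] a'; rewrite in_cons => /predU1P[-> //|].
    by [].
  exact: IHts.
move=> /IHts {}IHts a'; rewrite in_cons => /predU1P[-> ext|a'_pending]; last first.
  by apply: IHts; rewrite in_cons a'_pending orbT.
have [q] := forced ext; rewrite def_f mem_seq1 => /eqP-> colp.
by apply: IHts (extends_assign ext colp); rewrite in_cons eqxx.
Qed.

End Refutation.

(* Exchanging the two colours lets the refutation start from an edge whose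
   colour is false. *)
Definition refutation (m : nat) (E : edges) (n : nat) (ts : seq token) :=
  if ts is Split i j :: ts' then refutes m E n ts' (assign [::] i j false) [::]
  else false.

Lemma refutation_ramsey m E n ts : well_formed m E -> refutation m E n ts ->
  ramsey_for (graph_of m E) n.
Proof.
move=> wfE; case: ts => // -[] // i j ts ref; apply/ramsey_forP => // col av.
have ext0 col' : extends col' [::] by move=> i' j' b; rewrite /colour_of !nth_nil.
case colij: (col i j); last first.
  by apply: (refutesP av ref (mem_head _ _)); apply: extends_assign.
apply: (refutesP (avoids_neg av) ref (mem_head _ _)).
by apply: extends_assign; rewrite ?colij.
Qed.

(** * Lower bounds from explicit colourings *)

Definition avoidsb (m : nat) (E : edges) (n : nat) (col : colouring) :=
  all (fun s => ~~ monochromatic E col s true && ~~ monochromatic E col s false)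
      (copies m n).

Lemma avoidsP m E n col : avoidsb m E n col -> avoids m E n col.
Proof.
by move=> /allP av s b; rewrite -mem_copies => /av /andP[]; case: b.
Qed.

(** A colouring of n vertices restricts to the first k of them for every k <= n, so no such k has
    the Ramsey property. *)
Lemma avoids_ramsey m E n col : well_formed m E -> avoids m E n col ->
  forall k, ramsey_for (graph_of m E) k -> n < k.
Proof.
move=> wfE av k /(ramsey_forP _ wfE) ram; rewrite ltnNge; apply/negP => le_kn.
exact: ram (avoids_leq le_kn av).
Qed.

(* Certificates are written as strings of words of hexadecimal digits: "ji" with
   i < j is [Split i j], an increasing word is the [Copy] on those vertices. *)
Inductive certificate := Certificate of seq token.

(* In ASCII the digits 0-9 have bit 4 set, the digits a-f have bit 6 set, and
   blanks and newlines have neither. *)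
Definition digit_or_blank (c : Byte.byte) : option nat :=
  let: (b0, (b1, (b2, (b3, (b4, (_, (b6, _))))))) := Byte.to_bits c in
  if b4 || b6 then Some (b0 + b1.*2 + b2.*2.*2 + b3.*2.*2.*2 + (if b6 then 9 else 0))
  else None.

Definition token_of_digits (ds : seq nat) : seq token :=
  match ds with
  | [::] => [::]
  | [:: j; i] => [:: if i < j then Split i j else Copy ds]
  | _ => [:: Copy ds]
  end.

Fixpoint tokens_of_bytes (ds : seq nat) (cs : list Byte.byte) : seq token :=
  if cs is c :: cs' then
    if digit_or_blank c is Some d then tokens_of_bytes (rcons ds d) cs'
    else token_of_digits ds ++ tokens_of_bytes [::] cs'
  else token_of_digits ds.

Definition certificate_of_bytes (cs : list Byte.byte) : certificate :=
  Certificate (tokens_of_bytes [::] cs).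

(** The printer that [String Notation] asks for; [None] means that certificates are never printed
    back as strings. *)
Definition bytes_of_certificate (_ : certificate) : option (list Byte.byte) :=
  None.

Declare Scope certificate_scope.
Delimit Scope certificate_scope with cert.
String Notation certificate certificate_of_bytes bytes_of_certificate
  : certificate_scope.

(** * The bound R(4,4) <= 18 *)

Section Cliques.
Variables (n : nat) (c : {set 'I_n} -> bool).
Implicit Types (A B : {set 'I_n}) (b : bool) (k l : nat).

(** Cliques are taken relative to a vertex set [A], so that the recurrence can pass to
    neighbourhoods without relabelling. R(k,l) <= p then reads: every [A] with at least p elements
    has a clique of colour b and size k or one of colour [~~ b] and size l. *)
Definition clique b k A :=
  exists2 S : {set 'I_n}, S \subset A /\ k <= #|S|
    & {in S &, forall x y, x != y -> c [set x; y] = b}.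

Definition nbrs b x A := [set y in A | (y != x) && (c [set x; y] == b)].

Lemma cliqueS b k A B : A \subset B -> clique b k A -> clique b k B.
Proof. by move=> sAB [S [sSA ?] ?]; exists S; rewrite ?(subset_trans sSA). Qed.

Lemma nbrs_sub b x A : nbrs b x A \subset A.
Proof. by apply/subsetP => y; rewrite inE => /andP[]. Qed.

Lemma clique_nbrs b k x A : x \in A -> clique b k (nbrs b x A) -> clique b k.+1 A.
Proof.
move=> xA [S [sSN leS] S_mono].
have nbr y : y \in S -> y != x /\ c [set x; y] = b.
  by move/(subsetP sSN); rewrite inE => /and3P[_ ? /eqP].
exists (x |: S).
  rewrite subUset sub1set xA (subset_trans sSN (nbrs_sub b x A)) cardsU1.
  (* A vertex is not its own neighbour, so adding x raises the cardinality by one. *)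
  by case: (boolP (x \in S)) => [/nbr[]|//]; rewrite eqxx.
move=> y z /setU1P[->|yS] /setU1P[->|zS]; rewrite ?eqxx //.
- by move=> _; case: (nbr z zS).
- by move=> _; rewrite setUC; case: (nbr y yS).
- exact: S_mono.
Qed.

Lemma card_nbrs b x A : x \in A ->
  #|A| = (#|nbrs b x A| + #|nbrs (~~ b) x A|).+1.
Proof.
move=> xA; rewrite (cardsD1 x) xA add1n; congr _.+1.
rewrite -(cardsID [set y | c [set x; y] == b] (A :\ x)); congr (_ + _);
  apply: eq_card => y; rewrite !inE; first by rewrite andbCA andbA.
by case: (c _) b => [] []; rewrite /= ?andbT ?andbF // andbC.
Qed.

(** The base case R(2,k) <= k: if no pair in [A] has colour b, then [A] itself is a clique of the
    other colour. *)
Lemma clique_2 b k A : k <= #|A| -> clique b 2 A \/ clique (~~ b) k A.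
Proof.
move=> leA; have [/exists_inP[x xA /exists_inP[y yA /andP[xy /eqP cxy]]]|] :=
  boolP [exists x in A, exists y in A, (x != y) && (c [set x; y] == b)].
  left; exists [set x; y]; first by rewrite subUset !sub1set xA yA cards2 xy.
  move=> u v /set2P[]-> /set2P[]->; rewrite ?eqxx // => _ //.
  by rewrite setUC.
rewrite negb_exists_in => /forall_inP no_edge; right; exists A => // x y xA yA xy.
have := no_edge x xA; rewrite negb_exists_in => /forall_inP /(_ y yA).
by rewrite xy /=; case: (c _) (b) => [] [].
Qed.

(** A large neighbourhood of x contains a clique by hypothesis. If its colour is the one joining the
    neighbourhood to x, it grows by x; otherwise it already has the required size. *)
Lemma clique_vertex b k l p q A x :
    (forall B, p <= #|B| -> clique b k B \/ clique (~~ b) l.+1 B) ->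
    (forall B, q <= #|B| -> clique b k.+1 B \/ clique (~~ b) l B) ->
    x \in A -> (p <= #|nbrs b x A|) || (q <= #|nbrs (~~ b) x A|) ->
  clique b k.+1 A \/ clique (~~ b) l.+1 A.
Proof.
move=> Rp Rq xA /orP[/Rp[cl|cl]|/Rq[cl|cl]].
- by left; apply: clique_nbrs cl.
- by right; apply: cliqueS (nbrs_sub _ _ _) cl.
- by left; apply: cliqueS (nbrs_sub _ _ _) cl.
- by right; apply: clique_nbrs cl.
Qed.

(** The recurrence R(k+1,l+1) <= R(k,l+1) + R(k+1,l), with p + 1 and q + 1 bounding the terms on the
    right. If both neighbourhoods of x were too small, [A] would have at most p + q + 1 elements. *)
Lemma clique_step b k l p q A :
    (forall B, p.+1 <= #|B| -> clique b k B \/ clique (~~ b) l.+1 B) ->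
    (forall B, q.+1 <= #|B| -> clique b k.+1 B \/ clique (~~ b) l B) ->
    p + q.+1 < #|A| ->
  clique b k.+1 A \/ clique (~~ b) l.+1 A.
Proof.
move=> Rp Rq leA.
have [x xA] : exists x, x \in A.
  by apply/set0Pn; rewrite -card_gt0 (leq_trans _ leA).
apply: (clique_vertex Rp Rq xA).
move: leA; rewrite (card_nbrs b xA) addnS !ltnS.
by apply: contraLR; rewrite negb_or -!ltnNge !ltnS => /andP[? ?]; rewrite leq_add.
Qed.

Lemma clique_33 b A : 6 <= #|A| -> clique b 3 A \/ clique (~~ b) 3 A.
Proof.
move=> leA; apply: (clique_step (p := 2) (q := 2)) leA => B leB.
  exact: clique_2.
(* R(3,2) is R(2,3) with the colours exchanged: writing b as [~~ ~~ b] makes [clique_2] apply with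
   [~~ b] in the place of b. *)
by rewrite -{1}[b]negbK; apply/or_comm/clique_2.
Qed.

(** * Parity of the degree sum, R(3,4) <= 9 and R(4,4) <= 18 *)

Lemma even_degree_sum (r : rel 'I_n) A : symmetric r -> irreflexive r ->
  ~~ odd (\sum_(x in A) #|[set y in A | r x y]|).
Proof.
move=> r_sym r_irr.
have -> : \sum_(x in A) #|[set y in A | r x y]| =
    (\sum_(x in A) \sum_(y in A | r x y && (x < y)) 1).*2.
  (* One copy of the sum counts every edge at its smaller end; exchanging the summations in the
     other copy makes it count the same edges at their larger end. *)
  rewrite -addnn {2}(exchange_big_dep (mem A)) /=; last by move=> ? ? _ /andP[].
  rewrite -big_split /=; apply: eq_bigr => x xA.
  rewrite -sum1_card (bigID (fun y : 'I_n => x < y)) /=; congr (_ + _);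
    apply: eq_bigl => y; rewrite !inE ?xA.
    by rewrite andbA.
  (* The complement of x < y is y <= x; the case y = x drops out by irreflexivity. *)
  rewrite r_sym -leqNgt leq_eqVlt.
  have [/val_inj->|_] := eqVneq (y : nat) x; last by rewrite -andbA ?andbT.
  by rewrite r_irr !andbF.
by rewrite odd_double.
Qed.

(* Without such cliques there are exactly nine vertices, all of degree three in
   colour b, which the handshake lemma forbids. *)
Lemma clique_34 b A : 9 <= #|A| -> clique b 3 A \/ clique (~~ b) 4 A.
Proof.
move=> leA.
have R24 B : 4 <= #|B| -> clique b 2 B \/ clique (~~ b) 4 B by exact: clique_2.
(* 4 and 6 are the bounds for R(2,4) and R(3,3), the two terms that the recurrence adds up for
   R(3,4). *)
have [/exists_inP[x xA]|] := boolP [exists x in A,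
    (4 <= #|nbrs b x A|) || (6 <= #|nbrs (~~ b) x A|)].
  exact: clique_vertex R24 (@clique_33 b) xA.
rewrite negb_exists_in => /forall_inP small.
(* Degrees at most 3 and 5 together with |A| >= 9 force equality in |A| = 1 + 3 + 5. *)
have deg x : x \in A -> #|nbrs b x A| = 3 /\ #|A| = 9.
  move=> xA; have := small x xA; move: leA; rewrite (card_nbrs b xA) ltnS.
  rewrite negb_or -!ltnNge !ltnS; case: #|_| => [|[|[|[|?]]]] //;
    by case: #|_| => [|[|[|[|[|[|?]]]]]].
have [x xA] : exists x, x \in A.
  by apply/set0Pn; rewrite -card_gt0 (leq_trans _ leA).
pose r := [rel u v : 'I_n | (v != u) && (c [set u; v] == b)].
have r_sym : symmetric r by move=> u v /=; rewrite eq_sym setUC.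
have r_irr : irreflexive r by move=> u /=; rewrite eqxx.
have := even_degree_sum A r_sym r_irr.
rewrite (eq_bigr (fun=> 3)) => [|u uA]; last by case: (deg u uA) => <-.
by rewrite sum_nat_const; case: (deg x xA) => _ ->.
Qed.

(** The recurrence with p = q = 8, that is 9 + 9; the term R(4,3) is R(3,4) with the colours
    exchanged. *)
Lemma clique_44 b A : 18 <= #|A| -> clique b 4 A \/ clique (~~ b) 4 A.
Proof.
move=> leA; apply: (clique_step (p := 8) (q := 8)) leA => B leB.
  exact: clique_34.
by rewrite -{1}[b]negbK; apply/or_comm/clique_34.
Qed.

(** All pairs inside a monochromatic clique have the same colour, so its m smallest vertices carry
    any ordered graph on m vertices, whatever the edges. *)
Lemma clique_mono_copy b m E A :
  well_formed m E -> clique b m A -> mono_copy (graph_of m E) c.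
Proof.
move=> wfE [S [_ leS] S_mono].
pose col i j := c [set x : 'I_n | (x == i :> nat) || (x == j :> nat)].
have c_col (u v : 'I_n) : u < v -> c [set u; v] = col u v.
  by move=> _; congr c; apply/setP=> x; rewrite !inE.
apply/(mono_copyP wfE c_col).
pose s := take m [seq val x | x <- enum S].
have sz_s : size s = m by rewrite size_takel // size_map -cardE.
have s_S i : i \in s -> exists2 x, x \in S & i = val x.
  by move=> /mem_take /mapP[x]; rewrite mem_enum; exists x.
have cp_s : is_copy m n s.
  apply/and3P; split; first by rewrite sz_s.
    (* [enum S] filters the increasing enumeration of the ordinals, hence is increasing itself. *)
    apply: take_sorted; rewrite sorted_map; apply: sorted_filter.
      by move=> ? ? ?; apply: ltn_trans.
    by rewrite -sorted_map -enumT val_enum_ord iota_ltn_sorted.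
  by apply/allP => i /s_S[x _ ->]; exact: ltn_ord.
exists s, b; split=> //; apply/allP => e e_E.
have /andP[] := place_ltn wfE cp_s e_E; rewrite /place /=.
have /and3P[e1 e12 e2] := allP wfE _ e_E.
have mem_s k : 0 < k <= m -> nth 0 s k.-1 \in s.
  by case: k => // k km; rewrite mem_nth // sz_s.
have [x xS ->] : exists2 x, x \in S & nth 0 s e.1.-1 = val x.
  by apply/s_S/mem_s; rewrite e1 (leq_trans (ltnW e12)).
have [y yS ->] : exists2 y, y \in S & nth 0 s e.2.-1 = val y.
  by apply/s_S/mem_s; rewrite e2 (leq_trans _ e12).
move=> /= xy _; rewrite -c_col // S_mono // ?addbN ?addbb //.
by rewrite -val_eqE neq_ltn xy.
Qed.

End Cliques.

Lemma ramsey_K4 : ramsey_for (graph_of 4 K4_edges) 18.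
Proof.
move=> c; have [|cl|cl] := @clique_44 _ c true setT; first by rewrite cardsT card_ord.
  exact: clique_mono_copy cl.
exact: clique_mono_copy cl.
Qed.

(** * Ordered graphs on at most four vertices *)

(** The expression of [edge_rel], on naturals so that it can be evaluated; on ordinals the two are
    convertible. *)
Definition adjacent (E : edges) : rel nat := fun i j =>
  (i != j) && (((i.+1, j.+1) \in E) || ((j.+1, i.+1) \in E)).

Definition forall2_below (m : nat) (p : rel nat) :=
  all (fun i => all (p i) (iota 0 m)) (iota 0 m).

Definition equal_below (m : nat) (g h : rel nat) :=
  forall2_below m (fun i j => g i j == h i j).

(** A permutation of [iota 0 m] lists the images of the vertices, so the search runs through all
    bijections. *)
Definition isomorphic_below (m : nat) (g h : rel nat) :=
  has (fun s => equal_below m g (fun i j => h (nth 0 s i) (nth 0 s j)))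
      (permutations (iota 0 m)).

(** [m - i.+1] is the value of [rev_ord i]. *)
Definition mirror (m : nat) (g : rel nat) : rel nat :=
  fun i j => g (m - i.+1) (m - j.+1).

Definition spanning_below (m : nat) (g : rel nat) :=
  all (fun v => has (g v) (iota 0 m)) (iota 0 m).

Lemma forall2_belowP m (p : rel nat) :
  reflect (forall i j : 'I_m, p i j) (forall2_below m p).
Proof.
apply: (iffP allP) => [p_all i j | p_all i].
  by apply: (allP (p_all i _)); rewrite mem_iota /= add0n.
rewrite mem_iota add0n => /= im; apply/allP => j.
by rewrite mem_iota add0n => /= jm; exact: (p_all (Ordinal im) (Ordinal jm)).
Qed.

Lemma equal_belowP m (g h : rel nat) :
  reflect (forall i j : 'I_m, g i j = h i j) (equal_below m g h).
Proof.
by apply: (iffP (forall2_belowP _ _)) => gh i j; apply/eqP/gh.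
Qed.

(** Only the values on vertices below m are constrained, so a computable relation on all naturals
    can stand for a graph on ordinals. *)
Definition represents m (G : ordGraph m) (g : rel nat) :=
  forall i j : 'I_m, G i j = g i j.

Lemma represents_graph_of m E : represents (graph_of m E) (adjacent E).
Proof. by []. Qed.

Section Represented.
Variables (m : nat) (G H : ordGraph m) (g h : rel nat).
Hypotheses (Gg : represents G g) (Hh : represents H h).

Lemma represents_reflection : represents (reflection G) (mirror m g).
Proof. by move=> i j; rewrite /= /refl_rel Gg. Qed.

Lemma no_isolatedP : no_isolated G <-> spanning_below m g.
Proof.
split=> [iso | /allP span v].
  apply/allP => i; rewrite mem_iota add0n => /= im.
  have [w vw] := iso (Ordinal im); apply/hasP; exists (val w).
    by rewrite mem_iota add0n /=.
  by rewrite Gg in vw.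
have /hasP[j] : has (g v) (iota 0 m).
  by apply: span; rewrite mem_iota add0n /=.
rewrite mem_iota add0n => /= jm adj_vj.
by exists (Ordinal jm); rewrite Gg.
Qed.

Lemma ordering_ofP : ordering_of G H <-> isomorphic_below m g h.
Proof.
split=> [[f f_bij f_iso] | /hasP[s]].
  pose s := map val [seq f i | i <- enum 'I_m].
  have nth_s (i : 'I_m) : nth 0 s i = f i.
    by rewrite /s -map_comp (nth_map i) ?size_enum_ord // nth_ord_enum.
  apply/hasP; exists s; last first.
    by apply/equal_belowP => i j; rewrite !nth_s -Gg -Hh f_iso.
  rewrite mem_permutations -val_enum_ord; apply: perm_map; apply: uniq_perm.
  - by rewrite map_inj_uniq ?enum_uniq //; exact: bij_inj.
  - exact: enum_uniq.
  - case: f_bij => k _ kK i; rewrite mem_enum inE; apply/mapP.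
    by exists (k i); rewrite ?mem_enum ?kK.
rewrite mem_permutations => perm_s /equal_belowP s_iso.
have sz_s : size s = m by rewrite (perm_size perm_s) size_iota.
have lt_s (i : 'I_m) : nth 0 s i < m.
  have : nth 0 s i \in iota 0 m by rewrite -(perm_mem perm_s) mem_nth ?sz_s.
  by rewrite mem_iota add0n.
exists (fun i => Ordinal (lt_s i)) => [|i j]; last by rewrite Gg Hh s_iso.
(* A map of a finite set into itself is bijective once it is injective, and injectivity is the
   absence of repetitions in [s]. *)
apply: injF_bij => i j [] /eqP.
rewrite nth_uniq ?sz_s ?(perm_uniq perm_s) ?iota_uniq //.
by move/eqP/val_inj.
Qed.

Lemma ord_isoP : ord_iso G H <-> equal_below m g h.
Proof.
split=> [[f [[k fK kK] f_mono f_iso]] | /equal_belowP gh]; last first.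
  exists id; split=> // [|i j]; first by exists id.
  by rewrite Gg Hh gh.
(* A strictly increasing map never falls below the identity; by induction each value exceeds the
   previous one by at least one. *)
have homo_ge (u : 'I_m -> 'I_m) : {mono u : i j / i < j} -> forall i : 'I_m, i <= u i.
  move=> u_mono [i im]; elim: i im => // i IHi im.
  apply: leq_ltn_trans (IHi (ltnW im)) _; rewrite u_mono.
  exact: ltnSn.
have k_mono : {mono k : i j / i < j} by move=> i j; rewrite -f_mono !kK.
have f_id i : f i = i.
  apply/val_inj/eqP; rewrite eqn_leq; apply/andP; split; last exact: homo_ge.
  (* The same bound for the inverse [k], taken at f i, gives f i <= i. *)
  by have := homo_ge k k_mono (f i); rewrite fK.
by apply/equal_belowP => i j; rewrite -Gg -Hh -f_iso !f_id.
Qed.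

End Represented.

Lemma same_up_to_reflectionP m (G H : ordGraph m) g h :
    represents G g -> represents H h ->
  same_up_to_reflection G H <->
  equal_below m g h || equal_below m (mirror m g) h.
Proof.
move=> Gg Hh; have G'g := represents_reflection Gg.
split=> [[/(ord_isoP Gg Hh)->|/(ord_isoP G'g Hh)->] | /orP[]]; rewrite ?orbT //.
  by move/(ord_isoP Gg Hh); left.
by move/(ord_isoP G'g Hh); right.
Qed.

Lemma bij_ord_eq m n (f : 'I_m -> 'I_n) : bijective f -> m = n.
Proof. by move=> /bij_eq_card; rewrite !card_ord. Qed.

(** Isomorphic graphs have equally many vertices, so this number is compared first; relations on
    naturals can then be compared although the type of [row_graph x] depends on x. *)
Definition matches (m : nat) (g : rel nat) (x : row) :=
  (nverts x == m) && (equal_below m g (adjacent (edgeset x))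
                      || equal_below m (mirror m g) (adjacent (edgeset x))).

Lemma matchesP m (G : ordGraph m) g x : represents G g ->
  same_up_to_reflection G (row_graph x) <-> matches m g x.
Proof.
move=> Gg; rewrite /matches; have [|neq_m] := eqVneq; last first.
  by split=> // -[] [f [/bij_ord_eq eq_m _ _]]; rewrite eq_m eqxx in neq_m.
(* Taking the row apart turns its number of vertices into a variable, which can be substituted in
   the dependent types. *)
case: x => k F E r /= eq_k; subst m.
exact: (same_up_to_reflectionP Gg (@represents_graph_of _ E)).
Qed.

(** [exists!] compares values while [count] counts positions; the two agree because the list has no
    duplicates. The count is what [vm_compute] can evaluate. *)
Lemma exists_unique_count (T : eqType) (s : seq T) (p : pred T) (P : T -> Prop) :
    uniq s -> (forall x, P x <-> p x) ->
  (exists! x, x \in s /\ P x) <-> count p s == 1.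
Proof.
move=> uniq_s Pp; rewrite -size_filter.
have mem_p x : x \in filter p s <-> x \in s /\ P x.
  by rewrite mem_filter; split=> [/andP[/Pp px xs] | [-> /Pp->]].
split=> [[x [/mem_p x_in x_uniq]] | ].
  suff /perm_size-> : perm_eq (filter p s) [:: x] by [].
  apply: uniq_perm => [||y]; rewrite ?filter_uniq // inE.
  by apply/idP/eqP => [/mem_p /x_uniq-> | -> //].
case def_f: (filter p s) => [|x [|]] // _.
exists x; split=> [|y /mem_p]; last by rewrite def_f inE => /eqP.
by apply/mem_p; rewrite def_f inE.
Qed.

(** * Exhaustive classification of the ordered graphs on at most four vertices *)

Fixpoint bitseqs (n : nat) : seq bitseq :=
  if n is n'.+1 then
    [seq true :: s | s <- bitseqs n'] ++ [seq false :: s | s <- bitseqs n']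
  else [:: [::]].

Lemma mem_bitseqs s : s \in bitseqs (size s).
Proof.
by elim: s => //= -[] s IHs; rewrite mem_cat map_f // orbT.
Qed.

Definition pairs (m : nat) : edges :=
  [seq (i.+1, j.+1) | j <- iota 0 m, i <- iota 0 j].

(** Adjacency read off from one-based names, with no proof required that the names are in range. *)
Definition joins m (G : ordGraph m) (e : nat * nat) : bool :=
  [exists i : 'I_m, exists j : 'I_m, [&& G i j, i.+1 == e.1 & j.+1 == e.2]].

Definition edges_of m (G : ordGraph m) : edges := filter (joins G) (pairs m).

Lemma represents_edges_of m (G : ordGraph m) : represents G (adjacent (edges_of G)).
Proof.
have mem_edges (i j : 'I_m) : i < j -> ((i.+1, j.+1) \in edges_of G) = G i j.
  move=> ij; rewrite mem_filter; have -> /= : (i.+1, j.+1) \in pairs m.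
    apply/allpairsPdep; exists (val j), (val i).
    by split; rewrite ?mem_iota ?add0n /=.
  rewrite andbT; apply/existsP/idP => [[i' /existsP[j']] | Gij].
    by case/and3P=> Gij; rewrite !eqSS !val_eqE => /eqP<- /eqP<-.
  by exists i; apply/existsP; exists j; rewrite Gij !eqxx.
(* Pairs are listed with the smaller vertex first, so at most one of the two memberships in
   [adjacent] can hold. *)
have not_mem (i j : 'I_m) : j <= i -> (i.+1, j.+1) \in edges_of G = false.
  move=> ji; apply/negbTE; rewrite mem_filter negb_and; apply/orP; right.
  apply/allpairsPdep => -[j' [i' [_]]]; rewrite mem_iota /= add0n => lt_ij.
  by case=> eq_i eq_j; rewrite eq_i eq_j leqNgt lt_ij in ji.
move=> i j; rewrite /adjacent; case: (ltngtP i j) => [ij|ji|/val_inj->].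
- by rewrite mem_edges // not_mem ?orbF // ltnW.
- by rewrite (not_mem i j) 1?ltnW //= mem_edges // adj_sym.
- by rewrite adj_irr.
Qed.

(** An edge list is a sublist of [pairs m], hence given by a bit sequence. A quantifier over all
    graphs thus becomes a finite search, through 64 masks when m = 4. *)
Lemma edges_of_mask m (G : ordGraph m) :
  exists2 s, s \in bitseqs (size (pairs m)) & edges_of G = mask s (pairs m).
Proof.
rewrite /edges_of filter_mask; eexists; last by [].
by rewrite -(size_map (joins G)) mem_bitseqs.
Qed.

Definition K4minus_edges : edges := [:: (1,2); (1,3); (1,4); (2,3); (2,4)].

(** Equality of the two booleans is the computed form of an equivalence: an admissible graph must
    match exactly one row, and any other graph must not. *)
Definition classified (m : nat) (E : edges) :=
  (spanning_below m (adjacent E) &&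
     ~~ ((m == 4) && isomorphic_below m (adjacent E) (adjacent K4minus_edges)))
  == (count (matches m (adjacent E)) table == 1).

(** There are 1 + 2 + 8 + 64 = 75 edge sets to test. A single vertex is isolated, so m = 1
    contributes no row. *)
Lemma all_classified :
  all (fun m => all (fun s => classified m (mask s (pairs m)))
                    (bitseqs (size (pairs m)))) [:: 1; 2; 3; 4].
Proof. by vm_compute. Qed.

Lemma uniq_table : uniq table. Proof. by vm_compute. Qed.

Lemma table_complete m (G : ordGraph m) : 0 < m <= 4 ->
  (no_isolated G /\ ~ ordering_of G K4minus) <->
  exists! x : row, x \in table /\ same_up_to_reflection G (row_graph x).
Proof.
move=> m_le4; have Gg := represents_edges_of G.
have [s s_bits def_E] := edges_of_mask G; rewrite {}def_E in Gg.
have m_in : m \in [:: 1; 2; 3; 4] by case: m m_le4 {G Gg s_bits} => [|[|[|[|[|m]]]]].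
have /eqP := allP (allP all_classified m m_in) s s_bits.
move=> count1; apply: iff_trans (iff_sym (exists_unique_count uniq_table
  (fun x => matchesP x Gg))); rewrite -{}count1.
(* A bijection onto the vertices of K_4^- forces m = 4; only then do both graphs have the same
   vertices and can be compared by permutations. *)
suff ordK4 : ordering_of G K4minus <-> (m == 4) && isomorphic_below m
    (adjacent (mask s (pairs m))) (adjacent K4minus_edges).
  split=> [[/(no_isolatedP Gg)-> no_K4] | /andP[/(no_isolatedP Gg) iso no_K4]].
    by apply/negP => /ordK4.
  by split=> // /ordK4; apply/negP.
have [eq_m|neq_m] /= := eqVneq; last first.
  by split=> // -[f /bij_ord_eq eq_m _]; rewrite eq_m eqxx in neq_m.
subst m.
exact: (ordering_ofP Gg (@represents_graph_of _ _)).
Qed.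

(** * Certificates for the table *)

(* Bit i of the number in position j is the colour of the edge between i and j. *)
Definition colouring_of_rows (rows : seq N) : colouring :=
  fun i j => N.testbit_nat (nth 0%num rows j) i.

(** Positivity makes [value x] the successor of its predecessor, so that a colouring on one vertex
    fewer proves the bound [value x]. *)
Definition lower_certified (x : row) (rows : seq N) :=
  (0 < value x) &&
  avoidsb (nverts x) (edgeset x) (value x).-1 (colouring_of_rows rows).

Definition tokens (c : certificate) := let: Certificate ts := c in ts.

Definition upper_certified (x : row) (cs : seq certificate) :=
  refutation (nverts x) (edgeset x) (value x) (flatten (map tokens cs)).

(* The last colouring is the Paley graph of order 17. *)
Definition critical_colourings : seq (seq N) := [::
  [:: 0];
  [:: 0; 0; 2];
  [:: 0; 0; 3; 2];
  [:: 0; 1; 0; 5; 6];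
  [:: 0; 0; 0; 1; 3];
  [:: 0; 0; 0; 2];
  [:: 0; 1; 3; 0; 0];
  [:: 0; 0; 0; 1; 3; 30; 7; 92];
  [:: 0; 0; 2; 6; 4; 9];
  [:: 0; 0; 0; 4; 7; 15; 12; 70];
  [:: 0; 0; 1; 1; 4; 14];
  [:: 0; 0; 0; 3; 2; 9];
  [:: 0; 0; 0; 7; 15; 6; 6; 38];
  [:: 0; 1; 0; 0; 12; 8; 63; 60; 40];
  [:: 0; 0; 0; 4; 12; 19; 51; 15; 15];
  [:: 0; 0; 0; 4; 6];
  [:: 0; 0; 2; 0; 11; 15; 8; 72];
  [:: 0; 0; 2; 0; 8; 11; 56; 37; 147];
  [:: 0; 0; 2; 4; 8; 27; 31; 6; 146];
  [:: 0; 0; 0; 4; 12; 3; 21; 15; 90];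
  [:: 0; 0; 2; 5; 1; 23; 16; 112; 206; 87];
  [:: 0; 1; 0; 0; 4; 8; 63; 28; 168; 52];
  [:: 0; 1; 3; 4; 5; 3; 48; 104; 202];
  [:: 0; 0; 1; 4; 3; 26; 21; 102; 41];
  [:: 0; 0; 3; 2; 15; 10; 60; 41; 3; 496; 421; 271; 4032];
  [:: 0; 0; 0; 4; 11; 31; 39; 28; 31; 134];
  [:: 0; 1; 3; 6; 13; 26; 52; 104; 209; 419; 838; 1676; 3352; 6705; 13410;
      26821; 53643]]%num.

(* The pieces of a refutation are concatenated; they only keep literals short. *)
Definition refutations : seq (seq certificate) := [::
[:: "10 01"];
[:: "30 013 023 123"];
[:: "10 012 013 123 134 234"];
[:: "10 40 014 50 015 045 145 30 013 034 134 035 20 012 024 124 023 025 235 30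
013 50 015 035 135 045 20 012 023 123 024 025 245 034 50 015 20 012 025
125 023 024 234 035 045 345"];
[:: "32 0235 1234 0145"];
[:: "20 0123 0124 1234 0134 0234"];
[:: "10 0123 0145 2345"];
[:: "80 87 0178 0478 0578 1347 1257 1457 2345 83 0138 0238 84 0148 0348 1234
4678 65 0567 3567 0137 4568 0168 0368 1236 3478 3678 4567 3568 0168 0468
1256 1456 1346 2345"];
[:: "43 63 0346 1346 2346 0146 0236 0246 1234 53 0345 1345 2345 0145 0235 0245
1234 0356 1356 2356 0146 0236 0246 1234"];
[:: "85 87 1578 2578 3578 4578 0127 1247 2347 0124 86 1568 2568 3568 4568 0126
1246 2346 0124 1678 2678 3678 4678 0127 1247 2347 0124"];
[:: "32 52 0235 1235 0134 0135 1245 0145 1256 0246 42 0234 1234 0134 0135 0136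
1246 0156 0256 0245 1245 0145 1256 0236 1236 0135"];
[:: "40 60 0146 0246 0346 1236 1246 2346 1234 50 0145 0245 0345 1235 1245 2345
1234 0156 0256 0356 1236 1246 2346 1234"];
[:: "86 87 1678 2678 3678 4678 0126 1346 2346 0123 53 3568 1578 4578 0135 1345
2345 0123 3578 1568 4568 0135 1345 2345 0123"];
[:: "64 86 1468 2468 3468 4689 54 4568 76 4678 2789 3789 5789 10 0127 0137 1234
1356 2357 0124 0134 1237 1357 2356 2567 3567 10 0125 0135 1234 1367 2368
0124 0134 1235 1368 2367 0145 1245 2345 0123 32 2346 53 1235 2356 5689 10
0135 1347 1368 4789 2367 5678 0124 0127 2467 2789 5678 3568 76 1467 2467
4567 0145 1245 0123 63 1236 10 0136 1345 1357 1358 4578 4589 6789 0124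
0125 2456 3457 3458 2578 2589 6789 3678 3689 4789 5789 3457 1456 2456 0147
1247 0123 2368 43 1346 3467 65 3456 21 1246 2457 2458 10 0126 2678 2689
5789 0135 3578 3589 6789 0123 1235 0146 1457 1458 3578 3589 6789 2567 5678
5689 3789 0137 1237 0125 1234 2345 2347 10 0125 0126 2568 2689 4567 4789
2678 0134 1367 53 1356 5678 5689 4789 2357 2358 4578 4589 6789"];
[:: "30 90 0349 0369 0389 4569 4789 6789 4567 10 0123 50 0125 0145 2345 0569
0589 6789 0567 2367 0127 0129 0149 0169 2349 2569 4569 2345"];
[:: "50 54 0145 0245 0345 1235 51 0125 0135 2345 1245 1345 0235"];
[:: "43 54 0345 1345 0146 0147 32 0234 1234 0135 0136 0137 3457 3467 3478 5678
53 3457 63 3467 5678 3478 0237 1237 0134 0236 1236 0134 0235 1235 0134 64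
0346 1346 0145 74 0347 1347 0145 87 73 3578 3678 0457 1457 4567 0156 30
0134 0234 1237 0137 0237 1234 4578 4678 65 3567 30 0134 0234 1236 0136
0236 1234 0456 1456 0157"];
[:: "90 96 95 0569 98 0589 0689 0568 1568 2568 3568 0189 0289 0238 0389 1239 97
0579 0679 0567 1567 2567 3567 0179 0279 0237 0379 1239 94 0459 0469 0456
1456 2456 3456 0169 0269 0236 0369 1239 4789 93 0359 0369 1356 2356 0169
0269 1479 1489 1289 2478 3479 3489 0478 1478 2478 3478 0128 1389 2389 0129
94 0469 98 0489 0689 0468 1468 2468 3468 0189 0289 0238 0389 1239 97 0479
0679 0467 1467 2467 3467 0179 0279 0237 0379 1239 5789 92 0249 0269 1246
0169 1579 1589 0578 2578 4578 0248 2579 2589 0578 1578 2578 3578 1289 0138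
2389 0139 54 97 0679 98 0689 0789 0678 4678 5678 0458 4589 93 0369 0379
1367 2367 0179 0279 1489 1289 2458 3489 0458 1458 2458 3458 0128 1389 2389
0129 4579 74 0457 1457 2457 3457 0127 0137 0237 91 0129 0139 2379 1279
1379 0239 1479 2479 3479 0169 0269 0239 0369 1236 1459 2459 3459 0169 0269
0239 0369 1236 95 94 0459 98 0489 0589 0458 1458 2458 3458 0189 0289 0238
0389 1239 97 0479 0579 0457 1457 2457 3457 0179 0279 0237 0379 1239 6789
92 0249 0259 1245 0159 1679 1689 0678 2678 4678 0248 2679 2689 0678 4678
5678 0458 97 0579 98 0589 0789 0578 1578 2578 3578 0189 0289 0238 0389
1239 4689 93 0359 0379 1357 2357 0179 0279 1469 1489 1289 2468 3469 3489
0468 1468 2468 3468 0128 1389 2389 0129 4679 93 0359 98 0389 0589 1358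
2358 0189 0289 1469 1479 1279 2467 4689 4789 0678 3678 5678 0358 3469 3479
0467 1467 2467 3467 0127 1379 2379 0129 65 97 98 0789 94 0479 0489 0478
1478 2478 3478 0189 0289 0238 0389 1239 93 0379 0389 1378 2378 0189 0289
1459 1469 1269 2456 3459 3469 0456 1456 2456 3456 0126 1369 2369 0129 5689
85 0568 1568 2568 3568 4568 0238 0148 0248 0348 1234 1589 2589 3589 0179
0279 0239 0379 1237 5679 75 0567 1567 2567 3567 4567 0237 0147 0247 0347
1234 1579 2579 3579 4579 0239 0149 0249 0349 1234 1569 2569 3569 4569 0239
0149 0249 0349 1234"];
[:: "75 76 87 5678 85 0578 1578 2578 3578 97 5679 5789 1689 2689 3689 30 0138
0238 1237 0137 0237 1238 0179 0279 0379 30 0139 0239 1237 0137 0237 1239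
65 0567 1567 2567 3567 0168 0268 0368 30 0138 0238 1236 0136 0236 1238
0568 1568 2568 3568 0167 0267 0367 30 0136 0236 1237 0137 0237 1236 65
0567 1567 2567 3567 4567 96 5679 84 83 40 0348 1346 0148 0168 1789 3689
0146 0346 1348 0368 3789 4689 0468 4789 1689 2689 3689 5689 52 72 0257
1257 0158 2378 2478 2357 2457 3458 0258 1258 2358 0157 0357 1378 0169 0269
0369 30 0139 0239 1236 0136 0236 1239 97 5679 95 0579 1579 2579 3579 0178
0278 0378 30 0138 0238 1237 0137 0237 1238 0569 1569 2569 3569 0167 0267
0367 30 0136 0236 1237 0137 0237 1236 98 74 54 0457 1457 2457 3457 0156
0256 0356 1467 1267 1367 2378 2379 1368 1369 4568 4569 3589 64 0467 1467
2467 3467 86 96 2689 4689 5689 0458 1458 2458 0157 0257 1278 0169 0269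
0369 30 0139 0239 1236 0136 0236 1239 0168 0268 0368 30 0138 0238 1236
0136 0236 1238 0456 1456 2456 3456 0157 0257 0357 1278 1378 1379 2389 73
53 0357 1357 2357 0156 0256 1367 1267 2478 2479 1489 0158 4589 0259 3569
1269 63 0367 1367 2367 52 72 0257 1257 0156 2478 2479 1489 0168 3468 4689
3456 0569 2459 0256 1256 0157 1478 1479 1489 3489 0168 2358 3468 0458 2456
0356 1356 2356 0157 0257 1478 1479 1278 2489 3478 3479 1489 2489 3489 1378
2378 85 4589 60 0167 0267 1569 1268 4689 0569 4689 0168 0268 1267 50 0157
0257 1258 0158 0258 1257 1789 2789 3789 4789 5789 6789 52 0258 1258 2358
0156 0356 1368 62 2368 2468 2356 2456 3458 0256 1256 0158 74 54 0457 1457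
2457 3457 85 4578 65 73 72 30 0237 1235 0137 1678 0568 1568 0167 0135 0235
1237 2678 0568 2568 0267 3678 0568 3568 0367 0156 0256 0356 30 0136 0236
1235 0135 0235 1236 0158 0258 0358 30 0138 0238 1235 0135 0235 1238 97
4579 72 2479 0459 2459 0257 73 3479 0459 3459 0357 71 1479 0459 1459 0157
87 4578 98 4789 1458 2458 3458 30 0135 0235 1237 0137 0237 1235 1589 2589
3589 30 0138 0238 1237 0137 0237 1238 1278 1378 1678 60 0268 0368 2367
0167 0267 1268 96 87 4578 73 3478 0458 3458 0357 72 2478 0458 2458 0257
2379 60 0369 2367 0269 0279 1279 0478 0458 1458 0157 0267 0367 2369 98 86
2689 4689 5689 0458 1458 2458 0157 0257 1278 1678 2678 3678 42 0247 1247
2347 0145 0345 1357 52 1257 2357 2345 0347 1347 0145 0245 1245 0147 1789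
2789 3789 4789 5789 42 0248 1248 2348 0145 0345 1358 52 1258 2358 2345
0348 1348 0145 0245 1245 0148 1679 2679 3679 42 0247 1247 2347 0145 0345
1357 52 1257 2357 2345 0347 1347 0145 0245 1245 0147 64 97 87 98 1789 2789
3789 4789 6789 42 62 0246 1246 0148 1268 2368 2346 0348 1348 0146 0248
1248 2348 0146 0346 1368 72 2578 2579 1589 2589 3589 4589 1278 2378 40
0148 0348 1347 0147 0347 1348 73 3578 3579 1589 2589 3589 4589 1378 40
0148 0248 1247 0147 0247 1248 43 42 2346 2367 0246 1246 0147 1578 1579
3589 4589 2348 0247 1247 0346 0146 1367 0347 1347 2347 0146 0246 1267 4678
73 3579 72 2379 50 0257 0357 2359 0359 2357 0259 0279 1279 0478 0468 1468
0167 2478 0468 2468 0267 3478 0468 3468 0367 4679 73 71 72 85 1578 4678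
5689 4789 1468 2468 3468 30 0137 0237 1236 0136 0236 1237 83 1378 4678
5789 3689 82 1278 3789 4678 2689 50 0157 0257 1258 0258 0358 2357 2479
0469 2469 0267 1479 0469 1469 0167 3479 0469 3469 0367 0467 1467 2467 3467
86 0168 0268 0368 30 0136 0236 1238 0138 0238 1236 4678 85 1578 2578 3578
30 0136 0236 1237 0137 0237 1236 96 0169 0269 0369 30 0136 0236 1239 0139
0239 1236 4679 5689 1789 2789 3789 30 0136 0236 1238 0138 0238 1236"];
[:: "91 92 98 1289 82 2389 2489 2589 2689 2789 3459 3479 4579 5679 3457 90 0129
0189 0128 93 1239 1238 3489 3589 3689 3789 0459 0479 4579 5679 0457 94
1249 1248 4589 4689 4789 0359 0379 3579 5679 0357 0349 97 96 1269 6789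
1268 0369 3469 0346 4569 1259 5789 1258 0379 3479 0347 4579 4679 1259 5689
1258 97 1279 72 2379 2479 2579 2679 3489 3459 4589 5689 3458 90 0129 0179
0127 93 1239 1237 3479 3579 3679 0489 0459 4589 5689 0458 0389 94 1249
1247 4579 4679 0359 3589 5689 0358 0349 3489 0348 4589 4689 1259 5679 1257
90 0129 96 0169 1269 0126 2369 2469 2569 3789 4789 3459 5789 3458 6789 95
0159 1259 0125 2359 2459 3689 3469 4689 3468 5689 94 0149 1249 0124 2349
3569 3589 3568 4569 4589 4568 0789 96 1269 93 1239 2369 1236 3469 3569
4789 0459 5789 0458 3789 94 1249 2469 1246 4569 0359 5789 0358 0349 4789
0348 6789 60 0168 0268 0368 1238 3689 1239 0369 0469 0569 1239 1259 2359
3459 1235 98 93 1389 83 3489 3589 3689 3789 2459 2479 4579 5679 2457 90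
0139 0189 0138 94 1349 1348 4589 4689 4789 0259 0279 2579 5679 0257 0249
97 96 1369 6789 1368 0269 2469 0246 4569 1359 5789 1358 0279 2479 0247
4579 4679 1359 5689 1358 81 1489 1589 1689 2349 2369 3469 4569 2346 90
0189 94 0149 0148 4589 4689 4789 2359 2379 3579 5679 2357 2349 97 96 0169
6789 0168 2369 3469 2346 4569 0159 5789 0158 2379 3479 2347 4579 4679 0159
5689 0158 0239 97 96 6789 95 1569 5689 1568 0259 2359 0235 3459 1469 4689
1468 0269 2369 0236 3469 3569 4789 1459 5789 1458 0279 2379 0237 3479 3579
3679 1459 4589 5689 1458 93 82 90 0139 97 0179 1379 0137 3479 3579 3679
2459 4589 5689 2458 96 0169 1369 0136 3469 3569 4789 2459 5789 2458 6789
95 0159 1359 0135 3459 2469 4689 2468 2569 5689 2568 0289 94 1349 97 1379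
3479 1347 4579 4679 0259 5689 0258 96 1369 3469 1346 4569 0259 5789 0258
0269 6789 0268 0249 0248 4589 4689 4789 1359 1379 3579 5679 1357 2489 2589
2689 1349 1369 3469 4569 1346 2389 83 90 94 0149 97 0179 1479 0147 4579
4679 2359 5689 2358 96 0169 1469 0146 4569 2359 5789 2358 2369 6789 2368
2349 2348 4589 4689 4789 0159 0179 1579 5679 0157 0239 0289 0238 3489 3589
3689 3789 1459 1479 4579 5679 1457"];
[:: "84 86 98 4689 a9 90 0489 089a 81 1489 61 1268 1468 1568 4569 0169 689a
026a 96 6789 689a 078a 016a 148a 0269 126a 1469 1569 4568 018a 468a 87
6789 678a 65 4568 046a 63 3568 30 0136 0236 1238 0138 0238 1236 1469 146a
189a 3469 346a 389a 056a 4569 40 0146 0246 1249 124a 189a 014a 024a 1246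
1569 156a 189a 74 40 70 0147 0247 1249 124a 189a 0178 0278 43 1347 2347
1249 124a 189a 41 1247 2349 234a 289a 1349 134a 189a 014a 024a 034a 1247
2347 1278 0478 1478 0179 4579 51 0157 1257 0258 025a 568a 52 0257 0158
015a 568a 1258 5689 568a 1259 125a 189a 87 6789 64 4568 0569 0468 62 2468
40 0146 0246 1249 1489 189a 124a 128a 468a 0249 0349 2346 2569 2489 289a
256a 046a 678a 028a 0469 4569 0568 61 1568 63 3568 30 0136 0236 1238 0138
0238 1236 3469 389a 346a 016a 678a 018a 1469 1489 189a 146a 056a 678a 018a
40 80 0148 0248 1249 1489 189a 124a 178a 468a a4 468a 078a 014a 024a 1249
1489 189a 178a 70 81 1489 41 1248 1348 2349 234a 289a 1249 1349 0247 2348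
75 52 0257 2345 0458 0459 5689 85 5689 0259 1259 0157 0258 2358 0357 4579
457a 789a 74 0147 0247 1249 124a 189a 1478 75 51 0157 1257 0258 0259 5689
50 0257 1258 5689 1259 189a 125a 178a 568a 0158 0159 5689 4579 457a 789a
0178 0278 0478 43 1347 2347 1249 124a 189a 41 1247 2349 234a 289a 1349
134a 189a 0149 0249 0349 1248 2348 74 1247 2347 1278 1478 75 52 1257 2345
1458 5689 0159 0257 0258 0478 51 1245 2458 5689 0259 0157 0158 0478 1258
5689 1259 189a 125a 128a 568a 4579 789a 457a 124a 468a 128a 80 0489 049a
048a 43 0348 0149 0249 1348 2348 128a 124a 459a 469a 5689 6789 258a 578a
51 1245 125a 2458 1258 1358 235a 0349 0148 0248 1349 2349 1489 2489 128a
64 0468 4568 0569 1469 6789 52 50 0258 025a 578a 0156 1259 125a 579a 71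
1257 1279 2578 1247 1278 2479 0256 1256 0158 015a 578a 1246 2346 0168 1269
0469 a4 468a 83 3489 349a a0 64 3468 4568 3569 6789 a1 32 023a 123a 0136
0139 0469 30 013a 1236 1239 1469 0236 0239 0469 139a 178a 1389 96 6789 a1
40 014a 024a 034a 1246 1249 2346 1269 41 124a 134a 0246 0249 2346 0269
0146 0149 0169 1246 1346 2348 234a 278a 139a 178a 1389 3469 4569 3568 018a
028a 1389 2389 41 1248 1348 2349 1249 1349 2348 038a 91 1489 138a 30 a3
013a 023a 1238 349a 378a 6789 90 0139 0239 1238 64 4568 0569 046a 356a
0136 0236 1238 0469 4569 056a 346a 0136 0236 1238 0138 0238 1239 123a 349a
149a 30 41 014a 124a 134a 0249 93 0139 0239 1238 64 1468 4568 1236 1569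
3469 0246 2346 0269 1268 1469 349a 013a 023a 1239 1249 1349 2348 234a 238a
0138 0238 123a 378a 6789 64 4568 1569 1236 146a 356a 1469 4569 1236 156a
346a 459a 469a 479a 5689 6789 70 90 0579 0679 5678 049a a7 057a 067a 5678
74 40 0147 0247 0347 1249 2349 1479 1489 2479 1278 0149 0249 0349 1247
1248 2347 1278 457a 467a 5679 0578 0678 5679 a8 468a a1 148a 87 678a 83
348a 63 3468 3568 456a 346a 356a 4568 1389 a0 048a 0189 019a 32 30 0239
023a 389a 0138 1239 123a 389a 0238 1238 0139 013a 389a 82 248a 62 2468
2568 456a 246a 256a 4568 2389 129a 089a 689a 60 0469 0569 456a 016a 026a
1269 1789 92 129a 71 a7 127a 137a 147a 157a 167a 2378 3478 5678 52 2358
2458 3457 2357 2457 3458 789a 1479 1579 457a 1278 1378 1478 1578 1678 2379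
789a 237a 347a 567a 52 2357 2457 345a 235a 245a 3457 2789 248a 289a 139a
159a 3789 5789 52 2358 2458 3459 2359 2459 3458 87 678a 64 4568 156a 1468
83 3468 348a 356a 1389 1469 689a a0 019a 048a 0189 056a 40 0146 0246 124a
014a 024a 1246 146a 456a 1568 a0 048a 0189 82 248a 2568 246a 1289 019a
1569 689a 046a 0168 50 0156 0256 1258 125a 568a 51 1256 0258 025a 568a
0158 015a 568a 41 80 0148 048a 024a 034a 1248 2348 1789 54 1245 2345 1258
125a 568a 85 568a 045a 145a 0158 1458 2458 5789 1259 0789 85 568a 51 70 81
1248 1258 1348 1458 2345 1789 94 0149 1249 024a 019a 589a 0159 1459 0245
489a 019a 74 0147 024a 034a 1247 2347 1278 1478 0179 4579 0157 1257 025a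
0178 0478 0578 1247 1347 1257 1457 2345 125a 135a 145a 2358 2789 2359 589a
029a 015a 0145 024a 034a 2345 5789 54 0459 0158 0258 1245 1345 2459 234a
2589 248a 0458 0159 0259 1458 1248 1348 2345 124a 134a 2348 2789 2349 489a
80 0248 048a 014a 0289 029a 014a 54 0245 2345 0258 025a 568a 72 2347 0478
0279 4579 85 568a 045a 145a 0157 0458 2458 0257 0278 2478 0247 80 65 0568
4568 40 0148 0248 0348 1246 2346 1568 2568 1289 128a 1269 126a 0469 046a
689a 019a 0146 0246 0346 1248 2348 1289 128a 1249 124a 489a 129a 139a 169a
2389 3469 3568 87 70 0178 0278 0378 0478 0678 1567 2567 3567 4567 1268
2368 3468 1289 128a 2389 1269 126a 129a 689a 76 4678 40 0148 0248 0348
1247 2347 1678 2678 1289 128a 1279 127a 0479 047a 789a 019a 0147 0247 0347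
1248 2348 1289 128a 1249 124a 489a 129a 169a 2569 4569 2346 0567 0168 0268
0368 0468 1567 2567 3567 4567 1278 2378 3478 1289 128a 2389 1279 127a 129a
789a 60 0168 0268 0468 43 0348 41 1348 1789 178a 1349 134a 4569 489a 169a
1246 2348 2789 278a 2349 234a 0149 014a 489a 029a 1346 2346 0148 1248 1789
178a 1249 124a 0349 034a 489a 019a 50 85 0158 0258 0358 0458 1256 2356
3456 1268 2368 1789 178a 2789 1269 126a 129a 689a 5789 578a 90 0159 0259
0359 1256 1258 2356 1268 0569 569a 089a 015a 025a 035a 1256 1258 2356 1268
0156 0256 0356 85 1258 2358 1789 178a 2789 1259 125a 129a 589a 5789 578a
1259 2359 125a 1589 129a 569a 1569 2569 1268 90 a0 70 a9 019a 029a 039a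
069a 64 4568 1569 2569 1468 2468 1289 1469 2469 3469 1268 2368 1289 71
0179 017a 789a 76 0679 067a 789a 72 0279 027a 789a 73 0379 037a 789a 64
4568 1567 2567 1468 2468 1289 128a 1269 126a 689a 1467 2467 3467 1268 2368
1289 128a 1269 126a 689a a9 019a 029a 039a 069a 64 4568 1569 2569 1468
2468 1289 1469 2469 3469 1268 2368 1289 87 76 4678 40 94 0149 0249 0349
1247 2347 1678 2678 1289 128a 1279 127a 789a 489a 014a 024a 034a 1247 1249
2347 1678 1679 2678 789a 128a 127a 0147 0247 0347 1248 2348 1289 128a 1249
124a 489a 60 96 0169 0269 0369 0469 1267 2367 3467 1278 2378 1289 128a
1279 127a 789a 689a 016a 026a 036a 046a 1267 1269 2367 3467 1278 1279 2378
789a 128a 127a 0467 0567 4568 0178 0278 0378 0478 0578 a7 127a 237a 457a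
41 1247 1347 234a 124a 134a 2347 789a 1279 2379 4579 41 1247 1347 2349
1249 1349 2347 018a 028a 038a 078a 76 1678 2678 4678 41 1248 1348 2347
1247 1347 2348 63 1368 2368 3468 1267 2467 1278 73 1378 2378 1367 2367
1268 3467 3567 4568 0189 0289 0389 0789 76 1678 2678 4678 41 1248 1348
2347 1247 1347 2348 63 1368 2368 3468 1267 2467 1278 73 1378 2378 1367
2367 1268 3467 3567 4568 80 98 0489 94 4589 4789 a0 048a 568a 678a 83 3489
81 1389 30 0138 0238 1239 0139 0239 1238 158a 64 046a 146a 0169 1568 4569
1468 016a 126a 2468 40 0248 0348 2346 0246 0346 2348 358a 65 056a 356a
0369 3468 4569 3568 036a 50 035a 045a 3458 0356 0456 345a a9 489a 41 0148
024a 034a 1248 2348 64 1246 2346 1268 1468 2468 74 1247 2347 1278 1478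
1267 4567 51 1245 1256 2458 1258 1358 2356 014a 0248 0348 124a 234a 149a
64 a6 146a 246a 689a 1269 678a 148a 248a 76 61 1467 1247 1278 4567 2467
2568 1268 1368 2467 3467 2378 1678 2678 5678 51 1257 1357 2358 1245 1258
2457 1246 2346 126a 456a 678a 148a 248a 51 1256 1356 2358 1245 1258 2456
019a 029a 059a 1489 2489 51 1259 1359 2358 1258 1358 2359 40 0148 0248
0348 1249 2349 1489 2489 a2 289a 049a 048a 128a 54 85 0458 61 87 5789 0159
1456 145a 2568 569a 1269 678a 126a 136a 2368 1246 1268 1568 246a 2456 678a
0259 5789 568a 145a 245a 1258 1245 2345 1259 125a 0459 568a 0158 234a 268a
458a 478a 75 52 72 2357 2457 1358 3458 1259 3489 3459 1278 2378 1257 1245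
1358 3457 1258 2345 2358 1457 3457 1378 1578 2578 5678 61 1267 1367 2368
1246 1268 2467 0149 0249 0349 1248 2348 64 1246 2346 1268 1468 2468 a0
048a 128a 124a 126a 456a 678a 52 1256 2345 1458 0258 5789 0159 85 5789
0259 459a 0158 189a 1259 1258 2358 1356 049a 74 1247 2347 1278 0478 0179
017a 789a 76 1267 1478 0678 0179 017a 789a 4567 4679 789a 467a 124a 128a
458a 51 1245 1256 2458 1258 1358 2356 87 70 0178 0278 0378 0478 0578 0678
52 62 65 2356 2456 3457 1567 4567 41 1246 1346 2347 1247 1347 2346 1267
2367 2567 1256 1357 1457 3456 1257 2357 2457 43 1345 1247 65 1356 3456
1367 2567 4567 2346 1347 2347 1245 74 4578 4678 73 3478 3689 3479 0579
5679 54 0459 3459 0357 0457 0159 0259 1457 2457 41 1247 1347 2345 1245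
1345 2347 71 1478 1689 1479 0379 5679 50 0359 0459 3457 0157 0257 1259 54
60 65 0456 0157 0257 1456 2456 1267 1567 3567 30 0136 0236 1237 0137 0237
1236 0167 0267 0567 1456 2456 1257 0457 1457 3457 30 0135 0235 1237 0137
0237 1235 41 0148 0247 0347 1248 2348 1689 2689 1249 85 a1 124a 129a 489a
128a 048a 578a 50 0158 0258 125a 015a 045a 1245 5689 51 1245 1259 2458
1258 1358 2359 0147 0248 0348 1247 2347 1278 1689 1279 0479 a1 127a 047a
789a 019a 124a 168a 478a 6789 a9 a8 048a 85 458a 43 0348 014a 024a 1348
2348 1689 2689 61 1246 1269 2468 1268 1368 2369 034a 0148 134a 148a 169a
1689 5689 569a a1 148a 159a 1589 a3 348a 359a 3589 a2 248a 259a 2589 52 92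
2359 2459 345a 2589 43 0348 2348 024a 459a 0249 0259 015a 0245 1259 1345
1249 42 0248 034a 459a 0349 0259 015a 0345 1259 1245 1349 2349 234a 459a";
"025a 125a 235a 245a 0159 1359 3459 30 0135 0235 1239 0139 0239 1235 81 85
82 83 54 0458 1458 3458 30 0138 0238 1235 0135 0235 1238 41 0148 1248 1348
0245 2345 0258 51 0158 1258 0145 0248 0348 2345 1245 1345 2348 3689 368a
369a 2689 268a 269a 5689 568a 569a 1689 168a 169a a0 048a 678a 60 016a
026a 036a 046a 1268 2368 41 1248 1348 2346 1246 1346 2348 65 62 2569 256a
289a 64 4569 456a 489a 2468 40 0248 0348 2346 0246 0346 2348 50 a5 015a
025a 035a 1256 2356 1269 126a 189a 568a 0158 0258 0358 1256 125a 2356 126a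
0156 0256 0356 81 1258 5689 568a 1259 2359 125a 129a 1689 168a 1259 125a
589a 089a 60 0169 0269 0369 0469 1268 2368 41 1248 1348 2346 1246 1346
2348 a6 65 62 2569 256a 289a 64 4569 456a 489a 2468 40 0248 0348 2346 0246
0346 2348 50 95 0159 0259 0359 1256 2356 1269 126a 189a 5689 0158 0258
0358 1256 1259 2356 1269 0156 0256 0356 85 1258 2358 1568 1689 2568 1269
5689 1259 1589 189a 125a 148a 568a 016a 026a 678a 1269 1689 189a 148a a8
85 458a 98 4589 a9 60 87 5789 578a 76 4678 5678 4579 457a 789a 74 4578
5679 567a 789a 4679 467a 789a 70 76 0467 0567 4569 456a 689a 74 40 0147
0247 1249 124a 189a 43 41 1347 1348 1678 0149 014a 089a 0349 034a 089a
4679 467a 789a 0178 0278 0478 43 1347 2347 1249 124a 189a 41 1247 2349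
234a 289a 1349 134a 189a 0168 0268 0468 43 1346 2346 1249 124a 189a 41
1246 2349 234a 289a 1349 134a 189a 459a 479a 5789 83 3489 348a 349a 81
1489 148a 149a 70 73 30 0137 0237 1238 0138 0238 1237 1578 1678 5679 3578
3678 5679 0578 0678 5679 0689 a1 148a 1689 a9 129a 139a 159a 2689 3689 52
2358 2458 3459 2359 2459 3458 489a 64 96 0469 1469 0168 689a 146a 0168
1268 046a 246a 40 0246 0346 234a 014a 024a 1249 0468 1468 0169 689a 016a
126a 40 0249 0349 2346 014a 024a 1249 41 60 96 0169 0269 0469 1268 1248
1348 2346 6789 578a a9 a0 019a 029a 049a 1689 1248 1348 2349 64 0146 024a
034a 1246 1248 2346 1268 94 0149 024a 1248 1249 1689 4569 50 0156 0256
125a 015a 025a 1256 1258 1468 169a 469a 689a 0149 1249 1349 024a 026a 046a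
2346 0168 0268 0368 0468 0568 1246 1346 234a 248a 2689 2369 6789 578a 51
1256 1456 2345 125a 135a 2356 124a 134a 2348 2689 2349 489a 029a 014a 62
2346 0468 0269 4569 6789 578a 50 0156 0245 145a 025a 035a 2356 0268 2468
0246 98 60 65 50 0156 0256 0356 1258 2358 1489 148a 2489 1259 125a 129a
589a 0158 0258 0358 0458 1256 2356 3456 1268 2368 1489 148a 2489 1269 126a
129a 689a 62 63 61 32 0236 1236 0138 3489 348a 0139 013a 0169 089a 369a 83
3489 348a 30 0136 1239 123a 1269 189a 369a 0239 023a 0169 089a 369a 0238
0136 1238 1489 148a 1239 123a 389a 129a 169a 2369 1568 1489 148a 1569 156a
0269 026a 689a 019a 3568 3489 348a 3569 356a 0269 026a 689a 039a 2568 2489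
248a 2569 256a 689a 239a 3489 3568 0369 036a 029a 0168 0268 0368 0568 54
1456 2456 3456 1258 2358 1489 148a 2489 1259 125a 129a 589a 51 1256 1356
2458 3458 2489 248a 3489 2359 235a 239a 589a 1458 1489 148a 1459 145a 589a
129a 169a 2369 0589 5689 54 0459 0158 0258 1459 2459 1589 2589 148a 248a
129a 43 1345 2345 1249 124a 459a 41 1245 2349 234a 459a 1349 134a 459a
0458 0159 0259 1458 2458 41 1248 1348 2345 1245 1345 2348 068a 60 90 a6
016a 026a 036a 046a 1268 2368 41 1248 1348 2346 1246 1346 2348 678a 96
0169 0269 0369 0469 1268 2368 41 1248 1348 2346 1246 1346 2348 98 089a
4789 469a a5 a1 a3 a2 54 045a 145a 345a 30 013a 023a 1235 0135 0235 123a
41 014a 124a 134a 0245 2345 025a 51 015a 125a 0145 024a 034a 2345 1245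
1345 234a 249a 268a 2489 349a 368a 3489 149a 168a 1489 568a 569a 5789 689a
019a 029a 049a 1689 2689 41 1248 1348 2349 1249 1349 2348 0689 85 4589 65
056a 678a 5789 54 0456 0159 0259 1456 1458 2456 1268 0459 0156 0356 1459
3459 3489 368a 30 013a 023a 1235 0138 0238 1239 40 41 0146 014a 456a 016a
026a 1468 1248 1348 2346 43 0346 034a 456a 016a 026a 1246 2468 2348 1349
1489 1568 168a 016a 189a 678a 5789 459a 024a 2349 2489 2568 1269 569a 50
015a 045a 1245 0159 0259 125a 0149 0249 1248 1568 168a 016a 1246 124a 456a
568a 54 045a 0158 0258 145a 245a 158a 258a 1489 2489 129a a6 016a 026a
689a 1269 678a 4789 41 1245 1345 2349 1249 1349 2345 0458 015a 025a 1458
2458 41 1248 1348 2345 1245 1345 2348 0168 0268 0368 0468 0568 a6 126a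
236a 456a 41 1246 1346 234a 124a 134a 2346 678a 94 4569 4789 0689 689a
049a 41 1246 1346 2349 2369 98 2489 268a 289a 469a 679a 014a 0249 74 0479
2479 4578 52 1256 0157 0259 025a 569a 2345 2357 3456 0247 2347 0279 0689
689a 029a 91 1269 98 1489 168a 189a 469a a5 a3 51 015a 1256 1456 0145 024a
034a 2345 54 045a 3456 30 013a 023a 1235 0135 0235 1236 1245 1345 2346
349a 368a 3489 568a 569a 5789 0689 689a 019a 1249 1349 2346"];
[:: "a8 87 98 789a 76 6789 678a 179a 279a 379a 479a 579a 43 1347 2347 3457 3467
3478 10 0147 1456 1468 5678 0123 1247 2456 2468 5678 42 2457 2467 2478
3456 3468 5678 10 0127 0137 1234 2357 2367 1345 1356 4567 41 1457 1467
1478 2456 2468 5678 0124 0134 1237 1357 1367 2345 2356 4567 75 5789 578a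
679a 73 3789 378a 579a 71 1789 178a 379a 72 2789 278a 179a 74 4789 478a
179a 65 43 42 41 10 0124 0134 1237 1357 1367 2356 0127 0137 1234 2357 2367
1356 1457 1467 2456 2457 2467 3456 1347 2347 3457 3467 1456 2456 0147 1247
0123 1567 2567 3567 4567 10 0125 0135 1237 1347 2345 0127 0137 1235 1345
2347 a7 178a 278a 378a 478a 578a 678a 65 43 42 41 10 0124 0134 1237 1357
1367 2356 0127 0137 1234 2357 2367 1356 1457 1467 2456 2457 2467 3456 1347
2347 3457 3467 1456 2456 0147 1247 0123 1567 2567 3567 4567 10 0125 0135
1237 1347 2345 0127 0137 1235 1345 2347 86 65 5678 568a 167a 267a 367a
467a 85 1568 2568 3568 4568 10 0126 0136 1235 1345 2346 0125 0135 1236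
1346 2345 43 1346 2346 3456 3468 1458 2458 0146 1246 0123 42 2456 2468
3458 41 1456 1468 2458 10 0126 0136 1234 2356 2368 1358 0124 0134 1236
1356 1368 2358 64 4678 468a 567a 61 1678 168a 467a 63 3678 368a 167a 62
2678 268a 167a 54 32 31 85 4578 458a 157a 257a 357a 0135 1235 0126 95 42
2459 43 1234 0126 0134 1489 2478 248a 147a 3489 2478 248a 347a 1246 0123
0146 1459 2489 1478 148a 247a 1589 2589 3589 0135 1235 0126 1346 1356 2345
1236 2346 2356 1345 0136 85 3578 358a 157a 257a 0125 95 3459 84 3478 348a
147a 247a 0124 1489 2489 0124 1589 2589 0125 1456 2456 3456 53 85 3578
358a 457a 4589 10 0124 0134 1236 2359 1389 2378 238a 137a 0126 0136 1234
1359 2389 1378 138a 237a 1356 2356 0134 1234 0126 85 54 4578 458a 157a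
257a 357a 96 43 1345 2345 3458 10 0145 1468 1489 3469 0123 1245 2468 2489
3469 42 2458 3468 3489 2469 41 1458 2468 2489 1469 10 0125 0135 1234 2358
1368 1389 2369 0124 0134 1235 1358 2368 2389 1369 1689 2689 3689 5689 0156
1256 1356 2356 0123 53 3578 358a 457a 52 2578 258a 357a 51 1578 158a 257a
31 96 32 21 0123 0145 84 1478 148a 247a 347a 1234 42 1234 3468 3489 1469
2468 2489 1469 0125 1245 84 2478 248a 147a 347a 0134 41 0134 3468 3489
1469 1468 1489 2469 83 1378 138a 237a 2368 2389 1369 1689 2689 3689 4689
0136 1346 0125 2345 1236 0135 1345 21 96 84 3478 348a 147a 247a 0124 41
0124 2468 2489 1469 1468 1489 3469 1689 2689 0126 1235 83 2378 238a 137a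
1368 1389 2346 2369 4689 96 53 54 52 42 1245 43 1345 2345 0123 51 0145 84
2478 248a 147a 1468 1489 2469 1568 1589 2569 84 2478 248a 347a 3468 3489
2469 84 43 3478 348a 247a 51 41 1478 148a 247a 21 0125 1235 0134 83 1378
138a 237a 2368 2389 1369 0124 1234 0135 83 2378 238a 137a 1368 1389 2369
1568 1589 2569 2468 2489 1469 3469 51 10 0125 0135 1234 1348 2378 238a
137a 0124 0134 1235 2348 1378 138a 237a 1568 1589 2569 2568 2589 3569 4568
4589 3569 3568 3589 1569 2569 4569 43 42 41 10 0124 0134 1235 1358 2378
238a 137a 0125 0135 1234 2358 1378 138a 237a 1458 2478 248a 147a 2458 3478
348a 247a 1345 2345 3458 10 0123 1245 2478 248a 347a 0145 1478 148a 347a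
1689 2689 3689 4689 5689 21 0126 1236 1246 43 3456 2458 3478 348a 247a 31
1356 2358 1378 138a 237a 0134 1456 2458 1478 148a 247a 43 1346 2346 3456
0123 0146 1458 3478 348a 147a 42 2456 3458 2478 248a 347a 1234 2356 10
0136 1358 2378 238a 137a 0124 1456 2458 1478 148a 247a 98 a9 189a 289a
389a 489a 589a 689a 43 42 10 41 0124 0134 1238 1358 1368 2345 2356 4568
1458 1468 1478 2456 2467 5678 0128 0138 1234 2358 2368 1345 1356 4568 2458
2468 2478 3456 3467 5678 1348 2348 3458 3468 3478 10 0123 1248 2456 2467
5678 0148 1456 1467 5678 86 65 5689 568a 169a 269a 369a 469a 85 1568 2568
3568 4568 10 0126 0136 1235 1345 2346 0125 0135 1236 1346 2345 43 1346
2346 3456 3468 1458 2458 0146 1246 0123 42 2456 2468 3458 41 1456 1468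
2458 10 0126 0136 1234 2356 2368 1358 0124 0134 1236 1356 1368 2358 61
1689 168a 569a 64 4689 468a 169a 63 3689 368a 169a 62 2689 268a 169a 32 54
31 85 4589 458a 159a 259a 359a 0135 1235 0126 75 42 2457 43 1234 0126 0134
1478 2489 248a 149a 3478 2489 248a 349a 1246 0123 0146 1457 2478 1489 148a
249a 1578 2578 3578 0135 1235 0126 1346 1356 2345 1456 2456 3456 0234 1234
0256 0126 0134 1356 73 2357 4578 2589 258a 459a 1378 2389 238a 139a 1236
2346 2356 85 3589 358a 159a 259a 459a 0125 1345 0136 54 1345 0136 75 3457
84 3489 348a 149a 249a 0124 1478 2478 0124 1578 2578 0125 1456 2456 4578
0124 0136 1357 2378 1389 138a 239a 85 52 2589 258a 159a 359a 459a 43 1345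
2345 3458 10 0145 1468 1478 3456 3467 5678 0123 1245 2468 2478 3456 3467
5678 76 42 2458 3468 3478 2467 41 1458 2468 2478 1467 10 0125 0135 1234
2358 1368 1378 2367 0124 0134 1235 1358 2368 2378 1367 1678 3678 4678 5678
0156 1356 1456 0134 53 3589 358a 259a 54 4589 458a 259a 51 1589 158a 259a
76 31 21 32 0123 0145 84 1489 148a 249a 349a 1234 42 1234 3468 3478 1467
2468 2478 1467 83 1389 138a 239a 2368 2378 1367 0125 1245 84 2489 248a
149a 349a 0134 41 0134 3468 3478 1467 1468 1478 2467 0135 1345 21 84 3489
348a 149a 249a 0124 41 0124 2468 2478 1467 1468 1478 3467 1235 83 2389
238a 139a 1368 1378 2367 1678 2678 3678 4678 10 0126 0136 1235 1345 2346
0125 0135 1236 1346 2345 76 53 54 52 51 31 0135 1345 21 1235 83 1389 138a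
239a 2368 2378 1367 84 41 1489 148a 349a 0124 2489 248a 149a 3468 3478
1467 2467 0124 21 0125 1245 84 41 1489 148a 249a 0134 3489 348a 149a 2468
2478 1467 3467 0134 32 83 2389 238a 139a 1368 1378 2367 0123 0145 84 42
2489 248a 149a 1234 3489 348a 149a 1468 1478 2467 3467 1234 1568 1578 2567
2568 2578 3567 4568 4578 3567 3568 3578 1567 2567 4567 43 42 41 10 0124
0134 1235 1358 2389 238a 139a 0125 0135 1234 2358 1389 138a 239a 1458 2489
248a 149a 2458 3489 348a 249a 1345 2345 3458 10 0123 1245 2489 248a 349a
0145 1489 148a 349a 1678 2678 3678 4678 5678 21 0126 1236 1246 43 3456
2458 3489 348a 249a 31 1356 2358 1389 138a 239a 0134 1456 2458 1489 148a
249a 43 1346 2346 3456 0123 0146 1458 3489 348a 149a 42 2456 3458 2489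
248a 349a 1234 2356 10 0136 1358 2389 238a 139a 0124 1456 2458 1489 148a
249a 97 86 85 a6 168a 268a 368a 468a 568a 32 31 42 43 1234 0126 0134 1456
2458 1478 1489 2479 3456 2458 3478 3489 2479 1246 2456 0123 0146 1458 2478
2489 1479 1356 2358 1378 1389 2379 1236 2346 2356 31 1358 2378 2389 1379
0136 41 0124 2456 1458 2478 2489 1479 1456 3458 1478 1489 3479 51 1568
158a 256a 356a 456a 43 1345 2345 3458 10 0145 1478 1489 3479 0123 1245
2478 2489 3479 42 2458 3478 3489 2479 41 1458 2478 2489 1479 10 0125 0135
1234 2358 1378 1389 2379 0124 0134 1235 1358 2378 2389 1379 54 4568 458a
156a 53 3568 358a 156a 31 52 2568 258a 156a 32 42 84 2468 248a 146a 346a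
0134 1234 0125 43 1234 0125 0134 1478 1489 2479 3478 3489 2479 1245 0123
0145 84 1468 148a 246a 2478 2489 1479 83 1368 138a 236a 2378 2389 1379
0135 1345 52 2568 258a 156a 21 84 3468 348a 146a 246a 0124 41 0124 2478
2489 1479 1478 1489 3479 1235 83 2368 238a 136a 1378 1389 2379 52 54 53 51
31 0135 1345 21 1235 83 1368 138a 2346 236a 468a 2378 2389 1379 a6 168a
268a 0126 84 41 1468 148a 346a 0124 2468 248a 146a 3478 3489 1479 2479
0124 32 2345 83 2368 238a 1346 136a 468a 1378 1389 2379 41 0145 0123 1245
84 1468 148a 246a 168a 368a 0136 2478 2489 1479 a6 168a 268a 368a 0136
1236 0125 84 43 3468 348a 146a 0134 0125 1234 2468 248a 146a 1478 1489
2479 3479 0134 1234 0125 1578 1589 2579 3578 3589 2579 4578 4589 2579 2578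
2589 1579 3579 4579 43 a6 168a 368a 468a 568a 0156 1356 1456 0134 42 41 10
0124 0134 1235 1358 2368 238a 136a 0125 0135 1234 2358 1368 138a 236a 1458
2468 248a 146a 2458 3468 348a 246a 1345 2345 3458 10 0123 1245 2468 248a
3456 346a 568a 0145 1468 148a 3456 346a 568a 65 64 63 62 61 32 1236 2346
2356 85 54 1456 2456 458a 0124 0136 135a 238a 1378 1389 2379 1345 0136 a5
158a 258a 0125 345a 84 148a 248a 0124 3478 3489 1479 2479 0124 3578 3589
1579 2579 4579 0125 1345 0136 54 1456 2456 3456 0234 1234 0256 0126 0134
1356 83 138a 235a 458a 2578 2589 4579 2378 2389 1379 31 1346 1356 2345 85
a5 158a 258a 358a 0135 1235 0126 42 1246 0123 0146 145a 248a 1478 1489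
2479 245a 43 348a 2478 2489 3479 1234 0126 0134 148a 2478 2489 1479 4578
4589 1579 2579 3579 0135 1235 0126 1678 1689 2679 2678 2689 3679 3678 3689
4679 4678 4689 5679 5678 5689 1679 2679 3679 4679 85 43 42 41 10 0124 0134
1236 1356 1368 2358 0126 0136 1234 2356 2368 1358 1456 1468 2458 2456 2468
3458 1346 2346 3456 3468 1458 2458 0146 1246 0123 1568 2568 3568 4568 10
0125 0135 1236 1346 2345 0126 0136 1235 1345 2346 1789 2789 3789 4789 5789
6789 65 1567 2567 3567 4567 10 0127 0137 1235 1345 2347 0125 0135 1237
1347 2345 43 1347 2347 3457 3467 1456 2456 0147 1247 0123 42 2457 2467
3456 41 1457 1467 2456 10 0127 0137 1234 2357 2367 1356 0124 0134 1237
1357 1367 2356"];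
[:: "98 97 91 1789 93 1379 3789 1347 1357 1367 4789 5789 4567 6789 4569 92 1279
2789 1237 1247 1257 4789 3457 5789 3459 90 0179 0789 0127 0137 0147 2347
4789 2349 0239 94 1479 4789 1457 1467 5789 6789 0569 2569 3569 0235 95
1579 5789 1567 6789 0469 2469 3469 0234 0459 2459 3459 0234 90 0789 93
0379 3789 0347 0357 0367 4789 5789 4567 6789 4569 92 0279 2789 0237 0247
0257 4789 3457 5789 3459 1239 94 0479 4789 0457 0467 5789 6789 1569 2569
3569 1235 95 0579 5789 0567 6789 1469 2469 3469 1234 1459 2459 3459 1234
94 4789 93 3479 3789 3457 3467 5789 6789 0159 0569 1569 0125 0135 0145
2569 2345 2349 0139 95 4579 5789 4567 6789 0369 1369 0123 2369 2459 2789
2457 0359 1359 0123 2359 2479 2789 2347 2457 2467 3567 6789 3569 0149 76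
6789 0469 1469 0124 0134 2469 3469 2789 2379 3789 2347 2357 4567 5789 4569
95 5789 93 3579 3789 3567 0349 1349 0123 2349 2579 2789 2567 0459 1459
0124 0134 2459 3459 2789 2379 3789 2367 91 96 1689 92 1269 2689 1236 1246
1256 3689 4689 3456 3479 90 0169 0689 0126 0136 0146 3689 2346 2379 0279
95 5689 94 1459 4689 1456 0479 2479 0234 3479 1359 3689 1356 0579 2579
0235 0245 3579 4579 1369 3689 4689 1346 90 0189 95 0589 1589 0125 0135
0145 2589 3589 2345 2369 5679 94 0489 1489 0124 0134 2489 3489 2679 2359
3679 2356 4679 93 0389 1389 0123 2389 2459 2679 2456 3459 3679 3456 0679
92 1289 95 1589 2589 1235 1245 3589 4589 0369 3679 4679 0346 5679 94 1489
2489 1234 3489 0359 3679 0356 0459 4679 0456 0269 2679 0236 0246 0256 3679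
4679 3456 3489 96 90 0689 92 0269 2689 0236 0246 0256 3689 4689 3456 3479
1279 95 5689 94 0459 4689 0456 1479 2479 1234 3479 0359 3689 0356 1579
2579 1235 1245 3579 4579 0369 3689 4689 0346 0179 95 5689 94 4689 93 3459
3689 3456 0379 1379 0123 2379 2459 2689 2456 0479 1479 0124 0134 2479 3479
2689 2359 3689 2356 0579 1579 0125 0135 0145 2579 3579 2345 2369 1679 92
90 0289 95 0589 2589 0235 0245 3589 4589 1369 3679 4679 1346 5679 94 0489
2489 0234 3489 1359 3679 1356 1459 4679 1456 0169 0679 0126 0136 0146 3679
2346 2389 1269 2679 1236 1246 1256 3679 4679 3456 3489"];
[:: "50 60 80 82 0258 0268 83 0358 0368 2356 81 0158 0168 1256 54 0456 0458
1468 3468 0156 0356 1358 2456 0468 1458 3458 0156 0356 1368 62 0256 63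
0356 0368 2358 61 0156 0168 1258 54 0456 0458 1468 3468 0158 0358 1356
2458 0468 1456 3456 0158 0358 1368 51 0156 0158 1268 53 0356 0358 2368 64
0456 0468 1458 3458 0168 0368 1356 2468 0458 1456 3456 0168 0368 1358 90
92 0259 0269 93 0359 0369 2356 91 0159 0169 1256 54 0456 0459 1469 3469
0156 0356 1359 2456 0469 1459 3459 0156 0356 1369 91 0159 0169 93 0359
0369 1356 54 0456 0459 2469 3469 0256 0356 2359 1456 0469 2459 3459 0256
0356 2369 63 0356 0369 1359 2359 0156 0256 1269 93 0359 54 0456 0459 1469
2469 0156 0256 1259 3456 0469 1459 2459 0156 0256 1269 1369 2369 0156 0256
1259 70 72 0257 0267 73 0357 0367 2356 71 0157 0167 1256 54 0456 0457 1467
3467 0156 0356 1357 2456 0467 1457 3457 0156 0356 1367 62 0256 63 0356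
0367 2357 61 0156 0167 1257 54 0456 0457 1467 3467 0157 0357 1356 2457
0467 1456 3456 0157 0357 1367 51 0156 0157 1267 53 0356 0357 2367 64 0456
0467 1457 3457 0167 0367 1356 2467 0457 1456 3456 0167 0367 1357 71 91 82
83 74 1479 0489 2478 3478 0279 0379 2389 0478 0479 2489 3489 0279 0379
2378 0378 0389 1379 0278 0289 1279 0189 93 92 74 1478 0489 2479 3479 0278
0378 2389 0478 0479 2489 3489 0278 0378 2379 0279 0289 1278 0379 0389 1378
0178 0179 73 72 84 1489 0479 2478 3478 0289 0389 2379 0478 0489 2479 3479
0289 0389 2378 0278 0279 1289 0378 0379 1389 90 80 91 0159 0189 93 0359
0389 1358 92 0259 0289 1258 54 0458 0459 2489 3489 0258 0358 2359 1458
0489 2459 3459 0258 0358 2389 81 0158 83 0358 0389 1359 82 0258 0289 1259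
54 0458 0459 2489 3489 0259 0359 2358 1459 0489 2458 3458 0259 0359 2389
52 0258 0259 1289 53 0358 0359 1389 84 0458 0489 2459 3459 0289 0389 2358
1489 0459 2458 3458 0289 0389 2359 70 71 0157 0179 73 0357 0379 1359 72
0257 0279 1259 54 0457 0459 2479 3479 0259 0359 2357 1459 0479 2457 3457
0259 0359 2379 91 0159 93 0359 0379 1357 92 0259 0279 1257 54 0457 0459
2479 3479 0257 0357 2359 1457 0479 2459 3459 0257 0357 2379 52 0257 0259
1279 53 0357 0359 1379 74 0457 0479 2459 3459 0279 0379 2357 1479 0459
2457 3457 0279 0379 2359 81 71 62 63 74 1478 0468 2467 3467 0278 0378 2368
0467 0478 2468 3468 0278 0378 2367 0367 0368 1378 0267 0268 1278 0167 73
72 64 1468 0478 2467 3467 0268 0368 2378 0467 0468 2478 3478 0268 0368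
2367 0267 0278 1268 0367 0378 1368 0168 0178 83 82 64 1467 0478 2468 3468
0267 0367 2378 0467 0468 2478 3478 0267 0367 2368 0268 0278 1267 0368 0378
1367 80 70 81 0158 0178 83 0358 0378 1357 82 0258 0278 1257 54 0457 0458
2478 3478 0257 0357 2358 1457 0478 2458 3458 0257 0357 2378 71 0157 73
0357 0378 1358 72 0257 0278 1258 54 0457 0458 2478 3478 0258 0358 2357
1458 0478 2457 3457 0258 0358 2378 52 0257 0258 1278 53 0357 0358 1378 74
0457 0478 2458 3458 0278 0378 2357 1478 0458 2457 3457 0278 0378 2358 92
72 61 63 74 2479 0469 1467 3467 0179 0379 1369 0467 0479 1469 3469 0179
0379 1367 0367 0369 2379 0167 0169 1279 0267 73 71 64 2469 0479 1467 3467
0169 0369 1379 0467 0469 1479 3479 0169 0369 1367 0167 0179 1269 0367 0379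
2369 0269 0279 93 91 64 2467 0479 1469 3469 0167 0367 1379 0467 0469 1479
3479 0167 0367 1369 0169 0179 1267 0369 0379 2367 91 81 62 63 84 1489 0469
2468 3468 0289 0389 2369 0468 0489 2469 3469 0289 0389 2368 0368 0369 1389
0268 0269 1289 0168 83 82 64 1469 0489 2468 3468 0269 0369 2389 0468 0469
2489 3489 0269 0369 2368 0268 0289 1269 0368 0389 1369 0169 0189 93 92 64
1468 0489 2469 3469 0268 0368 2389 0468 0469 2489 3489 0268 0368 2369 0269
0289 1268 0369 0389 1368"];
[:: "10 d0 21 012d dc 01cd 32 0123 43 1234 ca 0acd a1 01ad 123a 1acd 13ad 14ad
134a 54 2345 65 3456 036a 456a ba 56ab 25bd 01bd 51 1235 1345 135b 15bc
0bcd abcd 025b 24ad 0234 74 0247 4567 0367 047a 147c 7abc 14ab 1abc 01bd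
1bcd 1abd 256d 016d 6acd 156a 1235 1345 1356 145a 145c 5acd 05cd 145d 245d
0124 124d a6 56ac 6acd 456d 036a 046a 056a 2346 026a 0236 76 3467 567a
037a 067a 267d 7acd 14ac 234a c2 012c 02cd 02ac a1 123a 134a 13ac a9 a8 ba
34ab 84 2348 489a 48ab 289c 14bc 9abc 148c 8abc 03bc 14bc 018c 49ab 18bc
149c 89ab 019c 1489 1abc 2abd 0bcd 02ab 03ab 0234 348a 349a 148c 049b 09bd
89bc 0489 148a 28ac 2348 149a 29ac 2349 31 013d b0 013b 0bcd 03bc 013c
34bc ba a9 09ab 49ab 0349 91 019b 1239 39bc 19ac 19bc 0acd 039a 0139 50
0135 059b 0359 0345 059a 459b 1abc 3abc 123a 034b 64 70 0137 07cd 037b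
037c 467b 013c 167c 367c 1236 0347 54 75 457b 037b 1237 17bc 87 4578 478b
0348 038b 0138 078b 458b 8bcd 278d 358d 2357 0357 0135 057b 467b 0367 0567
1236 2356 456b 267d 16bc 7bcd 0345 0135 05cd 035c 345c 013c 0346 0136 06cd
036c 346c 013c 134c 51 015d 1235 135c 135d 15cd 1345 a1 01ad 123a 13ac
13ad 1acd 134a b1 01bd 123b 13bc 13bd 1bcd 134b 65 456a 456b 136a 1236
16ab 16bc 4abc 156a 156b 156c 06cd 0346 46ab 46bc 1abc c2 012c 02cd 023c
40 0124 04cd 024c 0234 a0 012a 0acd 02ac 023a b0 012b 0bcd 02bc 023b 54
345a 345b 025a 0125 05ab 05bc 3abc 045a 045b 045c 05cd 0235 35ab 35bc 0abc
cb 0bcd ba abcd 23ad d3 3abd 3bcd 23bd 43 53 a9 349a 359a 9abc 159c 249c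
0124 1245 049b 049c 0459 09bc 39ad a6 346a 356a 6abc 156c 246c 0124 1245
046b 046c 0456 06bc 26ad d6 016d 126d 16ad 69ad 1269 3469 19ad 246d 46ad
124d 235c 35ad 5abc 234c 34ad 4abc 43 a3 a9 349a 42 0124 049b 9bcd 95 359a
59bc 235c 259d 0125 05ab 345a 0459 09bc 09cd 049c 249c 249d 09cd 9bcd 0249
249b 029d 02bd 29bd 09ab 0129 29ab 29ac 29ad 0acd 029a 02ad 02bd 2abd 23ab
23ac 23ad 0acd 023a 02ad 02bd 2abd 234c 234d 04cd 4bcd 0234 234b 024d 02bd
24bd 23bc 43 54 345b 15bc 25bc 1245 1345 0125 05bc 015c ba 34ab 24ac 01ac
0acd 63 3456 36ab 056a 136a 236d 6acd 1abc 5abc 125a 42 0124 ca 0acd 045a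
5acd 235d 35ab 0abc 1abc 01ac a4 124a 34ab 1abc 04ac 14ac 014c 45ac 45bc
4abc 35ab 235c 015c 65 56ab 16ac 46ac 1246 0456 156c 06cd 245c 245d 05cd
0245 025d 75 57cd 237c 247c 347b 27bc 0127 07bc c6 026c 56cd 2456 246c
67bc 3467 2457 257d 027d 234c 234d 04cd 0234 024d 54 45cd 235c 64 46cd
236c a4 4acd 23ac 65 356a 16ac 6abc 1256 35ab 25ac 256c 56ac 36ab 1abc
5abc 125a 234a 24ad 02ad 2346 246d 026d 2345 245d 025d 32 0123 43 1234 d1
123d 52 125d 2345 245d 124d 45cd 65 76 2567 567c 27cd 71 017d 1257 457d
1457 1467 2346 82 128d 2468 268d 2678 28cd 578c 1456 456d 016d 25cd ca 92
129d 2349 259d 249d 59ac 124d 149a 49ad 01ad 29cd cb b9 59bc 259d 019d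
1459 65 3456 569c 56bc 0369 36bd 09bd 2569 256d 69bc 126d 26cd 29bd 12bd
259b 59ac 29ab 0abd 1abd 5abc 039a 145a 3459 2bcd 12bd 234b 24bd 4bcd 124d
2acd 12ad 234a 24ad 4acd 124d 14cd b1 01bd 123b 14bd 13bd 134b 1bcd 61
016d 1236 146d 136d 1346 16cd 91 019d 1239 149d 139d 1349 19cd a6 6abc
14ab 19ab 234a 2acd 46ac 69ac 1469 16ab 16ad 9abc 01ad 146a 169a 469c d3
013d 123d 134d 13cd 014d 14cd b1 01bd 123b 13bd 1bcd 54 45bc 135b 1235
15bd 65 2356 356c 26cd 156b 06bd 46bc 0346 1345 145d 015d 34cd cb 54 45bc
65 456c 26cd 36cd 2356 2456 1236 035b 35bd 012b 01bd 74 4567 47bc 167b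
0347 247b 07bd db 01bd b6 06bd 46bc 0346 156b 1235 035b 135b 356b 013b
25bd 35bd 1235 15bd 125d 56bd 56cd 46bc 0346 0126 76 67bc 27bd 57bd 2357
1567 267d 017d 0345 345d 0125 015d 25cd 1345 0135 65 056d 56bc b5 05bd
36bd 75 57bc 27bd 67bd 2367 0357 3457 0137 035b 345b 013b 0356 3456 0136
2bcd 3bcd 012b 123b 034b 1bcd 12bd ba 23ab b9 239b b5 235b 54 459b 45ab
0359 359a 35ad 09ad 0345 3459 345a 59ab 05ad 39ad 25bd 5bcd 125d 29bd 9bcd
129d 2abd abcd 12ad 23cd cb 43 34bc ba 3abc 23ad 01ad a2 012a 02ad 023a
2acd 93 39ac 83 38ac 38bc 84 3489 189a 018d 1248 89cd 249a 349c 148a 248a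
014d 0124 48bd 048a 0abd 238a 238d 08ad 8abc 0238 28cd 028d 239a 239d 09ad
9abc 0239 29cd 029d db 01bd b2 012b 02bd 12bd 024b 0124 04ab 124a 34ac
1acd 23ab a9 349a a5 345a 95 359a 235d 59bd 239b 249b 39ac 2acd 96 269a
569a 2356 169b 469b 1246 459b 09bd 39bc 0459 0239 239d 0124 029d 2459 15ab
45ab 015d 1245 5acd 24ab 34ac 19ab 49ab 019d 1249 9acd 24ab 34ac 24bd 2abd
d4 014d 124d 14bd 4abd 124a 1abd 12ad a9 249a 49bd 39bc 239d 129d 54 245a
25ad 5abd 125d 45bd 45cd 35bc 59bc 2359 29ad 9abd 129d 234d 42 0124 024d
0234 24cd 54 45bc a4 4abc 64 46bc 76 467a 467d 247d 7acd 4567 46ac 56ab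
67ab 74 47ac 47bc 567b 456a 456d 6acd 2347 247d 0127 027d 0247 2346 246d
0126 026d 0246 234a 24ad 012a 02ad 024a 2345 245d 0125 025d 0245 2bcd db
01bd 12bd 1bcd 23bd ba b9 b4 b5 b6 a9 29ab 49ab 59ab 69ab 2349 2359 345b
356b 4569 43 345b 346b 34ab 459a 469a 359b 269b 569b 2356 54 456b 45ab
569a 269b 469b 2346 2345 256b 25ab 3456 569a 369b 26bd 6bcd 016d 126d 16bd
25bd 5bcd 015d 125d 15bd 24bd 4bcd 014d 124d 14bd 29bd 9bcd 019d 129d 19bd
2abd abcd 01ad 12ad 1abd db 01bd 32 ba 0abd b8 08bd a9 89ab 9abd b9 09bd
82 d7 017d 78bd 79bd 1789 179d 19bd 789d 2378 d3 013d 38bd 137d 1389 19bd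
379d 79ab 137b 43 0134 2348 0489 347d 2478 478b 124b 1289 289d 19bd 29bd
129d 089b 189b 018b 089a 92 2389 86 2689 68bd 126b 126d 68ab 1abd 038a
128a 138a 013d 38ad 03ad 43 0134 2348 048a 346d 349a 4689 81 018d 18bd
138d 013d 368d 0136 2369 069a 1268 63 2369 069a 0136 43 2346 2349 0468
1468 469a 014d 04ad 49ad 1348 134b 2489 48bd 48ab 124d 138a 1abd 0368 1368
013d 368d 8abd 368a 38ad 03ad 029a 129a 023d 01ad 1abd 29ad 39ad 129d 239d
128b 86 2368 31 013d 76 43 0134 2348 048a 048b 68ab 08ab 126b 2678 0478
178b 1347 64 2468 124b 46ab 036a 03bd 348b 4678 48ab 378b 078a 0137 346d
6abd 036a 346a 36ad 03ad 367d 017d 7abd 178b 367a 2378 037a 37ad 03ad 136b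
06bd 68ab a1 01ad 1abd 136d 016d 6abd 16ad 136a 6abd 136d 16bd 43 2348
048a 148a 0234 014d 52 2345 2568 456d 0256 125b 56ab 1346 134b 46ab 168b
016d 60 06bd 31 0136 368b 013b 03bd 036b 136b 138b 0236 98 2389 029a 129b
9abd 289b 129d 1abd 87 2378 789a 137a 278b 678b 2367 689d 069d 9abd 689a
69ad 06ad 068a 068b 016b cb 0bcd 8abc 68cd 06bc 68bc 016c 12ab b9 09bd a9
239a 98 289a 89bd 128b 128d 18bd 18ab a7 237a 789a 1378 378d 013d 17ab
017d 17bd 127b 278a cb 89bc 128c 78cd 01cd 7abc 7bcd 17cd 91 019b 019d
19bd 139d 013d 389d 0138 238a 08ab 1289 87 2378 84 2348 74 2478 124b 479b
1279 1379 278a 18ab 75 1578 4578 1245 0579 3579 0135 3479 279a 79bd 127b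
127d 347d 17bd 013d 1347 0489 3489 04bd 0134 48ab 1389 238a 0789 3789 07bd
0137 78ab 1389 238a 09ab 19ab 019b 129b 98 2389 a9 239a 139b 013d b3 013b
03bd 039b a7 237a 789a 379b 378d 279a 018d 1278 17ab 37ab 017d 0137 07ab
017b cb 0bcd 38cd 7acd 89ac 07bc 39bc 013c 19ab 94 2349 97 2379 76 1679
4679 169b 1246 6789 2479 3478 3467 96 2369 2469 3678 1789 4789 1247 169b
69ab 016b 06bd 069b 179b 79ab 017b 07bd 079b 149b 49ab 014b 04bd 049b 189b
018d b8 018b 08bd 089b 89ab 239a 139b 013d b3 013b 03bd 039b 389b 0138
238a 089b 87 1378 379b cb 0bcd 37cd 8acd 79ac 08bc 39bc 013c 178b 789b
017b 123b 31 013d 13bd 123d 43 53 a3 63 73 83 ba 34ab 35ab 36ab 37ab 38ab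
3abd 123d 1abd 124a 125a 126a 127a 128a 54 2456 2457 567a 578a 2678 456a
457a 2567 2578 678a 65 3456 3567 3568 356b 67ab 68ab 357a 348a 378a 4578
a7 347a 367a 4567 3458 345b 5678 58ab 378a 17ab 75 3457 3578 357b 78ab
348a 368a 4568 57ab 35bd 123d 15bd 17bd 157b 1238 138b 018d 18bd 138d 1237
137b 017d 17bd 137d 1236 136b 016d 16bd 136d 123a 13ab 01ad 1abd 13ad 1235
135b 015d 15bd 135d 1234 134b 014d 14bd 134d dc 01cd cb d5 015d 5bcd 15bd
1bcd 125b 025d 53 035d 135d 54 045d ca 0acd 5acd 15ab 32 2345 034a 134c
4abc 023a 123c 3abc 12ac 13ac 15ac 235a 345a 0234 145b 45bd 014d 135b 35bd
013d d1 1bcd ba abcd 32 92 42 95 2359 2459 31 013d 345d 35bd 134d 2349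
59ab 49ad 135c 15cd 5abc 135a 15ac 1acd 59ad 59bd 9abc 29bc 9bcd 259c c4
14cd 49bc 149c 459c 2345 134c 013d 349d 34bd 49ab 124c 14cd 4abc 124a 14ac
1acd 129c 19cd 9abc 129a 19ac 1acd 123c 13cd 3abc 123a 13ac 1acd 12ab 5abd
a9 95 259a 125b 125c 15cd 59bc 32 239a 139b 39bd 013d 1235 123c 35bc 59bd
9bcd 32 235a 239a 359d 013d 1359 139c 19cd 123c 13cd 39bc 1239 139c 19cd
19ab 9abd 019d 125d 12bd da 01ad abcd 1abd 12ad d3 013d 3bcd 13bd 123d 43
2345 234a 145d 014d 45ad 4abd 25ab 345d 34ad 34bd 4bcd 124d 245a 24ab 5abd
12bc ba 32 23ab 31 013d b4 234b a9 29ab 49ab 129c 349d 09cd 019d 9acd 0349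
1249 03cd 24ab 34ac a5 25ab 45ab 125c 345d 05cd 015d 5acd 0345 1245 03cd
24ab 34ac 345a 95 459b 19bc 39bd 1359 0139 35ad 35bd 09bc 01ad 245b 013c
125a 129a 124c 35ac 65 2569 456c 69bc 356a 356d 6acd 359a 0135 235b 059a
05bc 15bc 0acd 015c 59ac 14bc 34bd 0134 04bc 014c 124c a9 29ab 129c 09cd
54 1345 245b 15bc 0459 45bc 59ab 94 1349 249b 19bc 049a 49ac 0acd 13ac a1
01ad 1acd 13ad d4 014d 4acd 14bc 134a 234b d5 015d 5acd 15bc 135a 235b 82
28ab 138a 238b 48bd 58bd 2348 2358 134a 134c 134d 135a 135c 24ab 45ac 15cd";
"1245 128a 128c 8acd 128d 18cd 18bc 52 258b 458d 2345 1348 134c 48ac 1258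
125c 58ac 123c 31 013d 13cd 123d 13bc 43 34ab 93 39ab 53 35ab 65 3569 356c
136c 69bc 3456 359b 459a 569a 63 369b 36ab 456a 3459 345c 59bc 1236 136c
016d 16cd 136d 1235 135c 015d 15cd 135d 1239 139c 019d 19cd 139d 1234 134c
014d 14cd 134d 1abc ca 01ac 0acd 0abc 12ac a9 a8 a3 a4 a5 98 189a 389a
489a 589a 1238 1248 234a 245a 3458 32 234a 235a 239a 3489 3589 248a 158a
458a 1245 43 345a 349a 4589 158a 358a 1235 1234 145a 149a 2345 4589 258a
15ac 5abd 015d 14ac 4abd 014d 13ac 3abd 013d 18ac 8abd 018d 19ac 9abd 019d
41 014d 54 0145 d1 145d da 01ad 14ad 124a 4abd 95 1459 2459 129a 09ad 59ab
5bcd 9abc 49cd 65 2456 4569 1269 0569 56bd 69ab 59bd 59cd 65 1456 2456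
126a 56ab 5bcd 6abc 9abc 46cd 129a 169a 2469 56bd a7 07ad 67ab 0567 127a
2457 057a 157a 015a 567a 679b 0579 579a 09ad 84 148d cb 86 4568 56ad 56cd
68bc 6abc 58bd 4abd 8abd 458a 468d 146d 68ad 68bd 68cd 148b 48bc 148c 8abc
124c 12ab 248a 4bcd 8bcd abcd 458b 48ab 58ad 48ad 48bd 48cd a9 98 89ab
4abd abcd 459a 89bc 59bd 489d 019d 149d 1289 1249 2458 0589 1589 0159 1259
65 1456 2568 1689 5689 56bd 56cd 68ab 68bc abcd 49ad 59ad 149d 9abd 8abc
4bcd 9bcd 459b 124d 12bd 12cd 245b 15bd 015d 125d 5bcd 24bc 43 1345 2345
13cd 63 3456 36bc 56bd 1236 136d 016d 134d 34bd 013d 45bd 45cd 65 cb 56bc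
46bd 95 59bc 49bd d6 016d 146d 16bd 69bd 1469 19bd 149d a9 469a 59ab 4abd
9abd 5abc 45ad 01ad 125a 129a 2569 459d 019d 1259 25bc 12cd 146d 149d 1249
49bd 75 579b 57bc 1279 67bd 2467 4579 457d 79bc 147d 47cd 4bcd ba 56ab b8
568b b7 567b 87 578b 457d 98 789b 789d 9bcd 689a 49ab 79ab 4579 678a 48ab
58ab 4578 4678 458d 57ab 0146 018d 0678 1678 08ad 016d 67ad 47bd 7bcd 017d
147d 17bd 48bd 8bcd 018d 148d 18bd 4abd abcd 01ad 14ad 1abd 456d 64 0146
046d 0456 46bd 46cd 76 86 96 87 6789 678b 678d 89bd 8bcd 69bc b8 68bc ba
67ab 69ab 789a 689b 689d 9bcd 4abd abcd 01ad 14ad 1abd 48bd 78bd 067d 0456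
047d 048d 478d 4569 469d 0149 049d 0469 4568 468d 0148 048d 0468 4567 467d
0147 047d 0467 da 01ad 31 013d a3 13ad 123d 12bd 1abd 23ab 123a 3abd 3acd
a7 07ad 71 017d 17ad 127d 12bd 27ab 76 67ab 67ad 6bcd 7abc 17cd 37cd 37ac
43 134d 3467 46bd 347c 34bd 47ab 1267 1467 2346 34bd 47ab 0347 1247 347d
037d 54 2456 0567 3567 0135 1457 345d 57ad 127a 147a 2347 34bd 34cd b6 cb
46bc 4abc 146a 467a 6abc 2367 36cd 3bcd b8 478b 84 48ab 128a 178a 378a
017d 0137 78cd 7bcd 237b 12bc 2bcd 138c 98 289d 489b 9bcd 0789 389a 09ad
148a 348d 08ad 38ab 68ab 018d 3468 1248 2467 0678 3678 0136 38bd 8bcd 018d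
138d 18bd 36bd 2367 167a 016d 67bd 6bcd 47bc 32 d1 a9 09ad 19ad a5 05ad
15ad 65 569a 1269 1469 2356 2346 1359 1345 134a 459a 0569 156a 16ad 1256
1456 2345 1346 134a 469a 125a 135a 145a 2345 1349 134a 49ad 459a 64 469a
1269 2356 1569 015d 59cd 5abd 49ab 9abc 4bcd 1346 146a 16ad 129a 139a 149a
2349 134a 54 a6 16ad 456a 1346 169a 1356 46ad 2359 159a 015d 56cd 59bd
469b 69bc 4bcd 126a 136a 2369 169a 016d 69cd 6abd 6acd 239c 65 2356 2456
135a 45ab 45ac 124b 24bc 34bd 01bc 023d 024c 156a 569a 15ad 1345 145a 15ad
12bd 12cd 13bd 14bd 1abd 23bc 234b 1bcd 134a 24ab 53 235b 15bd 5bcd 015d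
135a 15ab 45ab 1245 1234 123a 53 93 63 d3 35ad 36ad 39ad 145a 146a 3456
3469 569a 123d 84 3489 348a 128a 138a 61 016d 16ad 146a 6abd 3468 3469
689a 69cd 39ab 9abc 3bcd 168a 3468 3568 1246 1456 2458 345a 589a 19ad 369a
1469 148a 18ad 358a 368a 1238 1458 1468 3456 3459 345a 3469 5689 569a 389a
1236 136a 016d 16ad 136d 1239 139a 019d 19ad 139d 1235 135a 015d 15ad 135d
d7 017d d1 31 013d 137d 1237 37ad 37bd 37cd 87 a9 789a 97 79ab abcd 78bc
79bc 38bd 89bd 138d 379d 019d 1279 1479 2347 34ad 34bd 34cd 478a 47ab 478c
47bc 8abc 39ad 139d 9abd 78ab 7abc 38ad 3bcd 9bcd 138d 389b 89ad 378d 018d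
1278 1478 2347 34bd 34cd 47ab 47bc abcd 54 75 157d 457d 32 65 74 4567 1267
1367 2456 3456 a7 457a 124a 34ad 4abd 023d 01ab 47ab 024b 67ad 236d 24ad
24bd 24cd 456b 457b 456c 67ab 67bc 4abc 47ad 47bd 47cd 457a 457b 4abd 4bcd
7abc 1567 167d 1256 1356 2345 257d 2357 357d 27ad 34ad 457a 1234 1237 3457
1257 1357 63 65 3456 1234 1347 2356 4567 1267 76 167d 367d 43 2345 1237
3467 1246 d2 245d 56bd 57ad 367a 67ab 3abd 23ad 23bd 23cd 367a 345b 367b
345c 57ab 57bc 3abc 1234 1346 34ad 2367 467a 27ad 37ad 237d 1567 015d 56ad
56cd 57bd 57cd 85 158d b8 158b 358b 458b 123b 134b 2345 8bcd 6abc 8abd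
158a 358a 458a 123a 134a 2345 5678 58ad 58bd 78ab 78bc abcd 1367 167d 1236
2345 1346 1347 467d 4567 b7 467b 134b 4bcd 01bc 47bc 67bc 034c 56cd 035d
57bd 015d 235d 157b 27bd 2467 24ad 24bd 24cd 467a 467c a8 468a 1368 18ab
57ab 7abc 45bc 48ad 4678 578a 78ab 45ab 1457 157d 1245 1345 76 167d 1456
567d 32 d2 234d 247d 45ad 47ad 567a 72 2347 2367 2567 25ad 25bd 25cd 567a
567b 567c 147a 47ad 147b 147c 034d a9 569a 0369 1369 19ab 7abc 19bc 81
0189 018d 89bd 1258 1478 5678 59ad 5679 479a 79ab 1abc 24ab 2bcd 27ad 27bd
27cd 567a 567b 5abd 5bcd 7abc 1235 1237 3567 1267 1467 2346 1235 1237 357d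
a7 357a 23ad 3abd 246d 37ab 67cd 3bcd 7abc 67ad 246d 23ad 23bd 23cd 346b
357b 346c 67ab 67bc 3abc 12bd 12cd 14ad 14bd 14cd 17ad 17bd 42 24ab 24bc
abcd 1247 47ab 47bc abcd 31 013d d1 43 134d b9 cb 97 79bc 37cd 47cd 3479
39ad 39cd 379a 9abc 3abd 79ad 79cd 9abc 3abd 7abd 347a 1479 479d 019d 3bcd
7bcd abcd 349b 347b 49ad 79ab 1479 479d 019d 39bd 49bd 79bd 139d 3479 9bcd
47ad 47cd 7abc 3abd 9abd 349a 1234 347d 34ad 34bd 34cd b9 479b 79ad 94
49ab 49bc abcd 349d 019d 139d 1249 1279 53 135d 2357 57ad 57bd 47ab 47bc
abcd 3579 35bd 35cd 2457 1459 59ab 59bc abcd 39bd 79bd 139d 479a 9bcd 9abd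
4abc 123d 127d 12ad 12bd 12cd 73 237a 237b 7abd 7bcd 2abc 37ad 37bd 27ab
27bc abcd 51 015d d1 65 0156 156d a9 ba c9 9abc 5bcd 6bcd 7bcd 59ab 156b
69ab 567b 79ab 679d 019d 1269 1359 2356 356b 123b 59cd 79cd 5679 79ab 67bd
5abd 6abd 7abd abcd 569a 156a 567a 69bd 67cd 79bc 0679 679d 0159 019d 1269
1359 2356 356a 123a 59ad 69ad 79ad 159d 5679 9abd 67ad 67cd 7abc 5bcd 9bcd
569b 567d 56ad 56bd 56cd b9 679b 79ad 96 69ab 69bc abcd 569d 019d 1279
1369 1379 1469 2367 3467 1234 59bd 79bd 159d 679a 9bcd 9abd 6abc 127d 12ad
135d 137d 13ad 145d 147d 32 2357 237a 57ad 1234 3457 347a 57ad d8 018d 87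
d1 178d 32 76 65 5678 1258 1458 2345 4567 1347 1568 168d 1256 1456 2345
1346 1348 4678 1267 1467 1567 2346 2356 1345 1348 1357 4578 1234 1235 1238
3578 1457 63 3456 3678 1567 1236 1368 168d 127d 12ad 18ad 278a 1278 1378
1478 1578 78ad 78bd 78cd 32 2347 2357 1345 1358 2457 458a 458b 458c 458d
124a 124c 4abd 4bcd 1abc 1234 1235 3457 1458 358a 358b 358c 358d 123a 123c
3abd 3bcd 1abc d9 019d 98 d1 189d 97 179d 43 32 76 87 6789 1269 1469 2346
1278 1478 2347 1267 1467 2346 1237 1239 3479 3789 1478 1345 1347 1349 4579
4789 1578 79ad 79bd 79cd ba 89ab 9abc 8bcd 7abd abcd 789a 89bc 78cd 128d
12ad 19ad 289a 1289 1389 1489 1589 89ad 89bd 89cd 32 2348 2358 1345 1359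
2458 459a 459b 459c 459d 124a 124c 4abd 4bcd 1abc 1234 1235 3458 1459 359a
359b 359c 359d 123a 123c 3abd 3bcd 1abc cb 87 98 a9 789a 7abd 7acd 9abc
79cd 79ac 74 4789 149c 19ac 1abc 1349 127a 3479 2347 1239 147a 147c 1abc
79ad 9abd 9acd d6 016d c1 1abc 129a 139a 149a 2789 3789 4789 127a 17ac
1237 1347 2349 c9 789c 127c 137c 147c 379c 479c 123c 134c 2347 129c 139c
149c 159c 169c 32 2349 2359 1345 1356 4569 1234 1235 3459 3569 1456 69ad
6789 67ad 67cd 7abc 89ad 89bd 89cd 9abc 7abd 8abd c1 19bc 1289 1389 1489
1589 75 3578 4578 1235 1345 2348 1579 179c 1357 1457 2358 3458 1234 ca
78ac 127c 137c 147c 37ac 47ac 123c 134c 2347 12ac 13ac 14ac 15ac 278a 478a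
578a 127c 79bc 43 345a 349a 4579 1234 3479 239a 789d 78ad 78bd 78cd 89bc
8abc 79bd 9abd 89ac 81 18bc 12ac 13ac 14ac 289a 379a 389a 479a 2378 3478
234a 1278 1378 1478 279a 379a 479a 12ab 3abd 4abd 01bc 02ac 03ac 023d 034d
1234 7bcd 8bcd 9bcd abcd 87 789b 78ab 89ad 8acd 79ab 91 19ac 12bc 13bc
14bc 29ab 378b 39ab 478b 2379 3479 234b 1289 1379 1389 1479 2378 3478 1234
789d 78ad 89ab 79ad 9acd 76 679b 6bcd 016d 16bc 18ac 1278 1378 1478 1578
32 2347 2357 1345 1356 4567 1234 1235 3457 3567 1456 678d 016d 1678 18ac
12bc 13bc 16bc 289b 379b 389b 2378 3678 236b a9 98 ca 89ac 87 789a dc 9acd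
20 60 d8 89ad 8acd 08ad 0178 0278 0678 17ad 27ad 1acd 2acd 127a 267a 0126
70 0789 75 0157 0257 5789 059d 159d 259d 2acd 91 19ac 19cd 159c 1259 0126
267a 0567 6789 1569 52 0256 76 0167 0267 6789 0569 169d 269d 0125 1acd
25cd 126a 568c 689a 567a 5acd 567d 579d 57ad 79ad 257a 2acd 257d 258d 259d
589a 25ad 59ad 79ad 579d 079d 07ad 79ac 79ad ba 79ab abcd 07bc 01ac 02ac
06ac 32 0236 023c 367c 36bc 37bc 679b 3789 39bc 236a 237a 3789 379a 039d
123a 036c 012c 67bc 238c 3678 07ab 7abc 75 5789 579a 51 0156 015b 567a
56ab 679a 159d 15ab 1bcd 57ab 015b 157a 157d 1acd 069d 6789 067a 067d 70
0789 079a 0679 079d 07ad 79ad 029d 2789 027a 027d 70 0789 079a 0279 079d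
07ad 79ad 08cd 0178 089a c7 789c 79ac 09cd 0789 09ac 079c 07cd 17cd 0789
09cd 089c cb 9abc 0abd 60 0678 67ab 16bd 167c 62 26bc 26bd 02cd 27cd 0278
1267 267a 12ac 068c 06cd 689c 09bc 0bcd 089b dc 9acd d8 89ad 8acd 08ad";
"089a 078a a5 589a 5acd 58ad 05ad 578a 0157 15ad 1acd a6 689a 6acd 68ad
156a 678a 0567 078d 76 0167 65 0567 058d 059d 589a 5689 068d 168c 168d
1acd 168a 18ac 21 0126 12cd 268c 125a 1278 2567 d1 1acd 51 0157 15cd 578c
156a 689a 1568 168a 168c 18ac 168d 169d 689a 16ad 69ad 056d 21 0125 256a
256d 2acd 126d 129d 2689 678c 678d 69ac 6acd 069d 678a 68ac 65 0156 56cd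
61 16cd 158d 21 0126 2678 268c 28ac 125d 129d 2589 1678 168c 18ac 5678
568c 58ac 08cd c0 089c 09ac 09cd 078c 30 60 40 50 43 0134 0345 0346 0348
4578 4678 0357 0167 0567 1356 75 0157 0457 1345 0136 0138 3456 3678 0567
578c 51 0156 0158 5678 0167 0467 1346 0135 0138 3578 1578 0189 09cd 189c
589c 158c 058c 05cd 589c 59ac 059c 048c 04cd 489c 49ac 049c 068c 06cd 689c
69ac 069c 038c 03cd 389c 39ac 039c dc 87 789a 76 6789 70 0167 0789 50 0567
a6 678a 689a 168a 568a 189a 589a 1568 58ac 015a 015c 068a 08ac 0678 56ac
64 0467 4678 048d 89ad 04ad 06ad 0678 08ad 078a 478a 047a 46ac d1 14cd
1456 1469 45cd 19ad 46ad 169d 16ad 89ad 168d 689d 146d 0145 4569 456d 49ad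
0569 5678 058d 89ad 05ad 75 578a 578d 58ad 0579 057a 079a 07ac 07ad 89ad
a6 678a 689a 68ac 016c 168a 168d 189a 62 026c 2678 028d 1268 268a 12ad c4
014c 64 4678 467c 048d 148d 19ad 21 0124 012c 247c 248c 478c 1269 2678
028d 024c 1248 189a 18ad 128a 1469 146a 19ad 189a 146d 1468 1689 689d 169d
46ac 47ac 4678 048d 48ac 478a 54 045c 4567 56ac 457a 45ac 578a 67ac c0
016c 167a 71 1789 179a 1679 17ac 62 026c 63 036c 36cd 023d 236c 27ac 2789
029d 789d 037d 2378 028d 28ac 89ad 278a 02ad 1367 013c 367c 37ac 137c 1267
012c 267c 27ac 127c 07ac a0 078a 089a 08ac 067a 20 30 50 40 32 0123 0234
0235 0237 3467 3567 0246 0156 0456 1245 64 0146 0346 1234 0125 0127 2345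
2567 0456 467a 42 0124 0245 0247 4567 0156 0356 1235 2467 0278 08ac 278a
478a 247a 047a 04ac 478a 489a 048a 057a 05ac 578a 589a 058a 037a 03ac 378a
389a 038a 027a 02ac 278a 289a 028a d8 89ad 89cd b8 89ab 8bcd a0 089a 08ad
018a 86 068a 689a 06ad 85 058a 589a 05ad 82 028a 289a 02ad 84 048a 489a
04ad 76 21 012a 02ad 2abc 012c 32 0123 023a 03ac 2348 2378 3467 0468 2468
0124 1248 1258 1278 2467 2567 1468 0568 4568 0145 0678 2678 4678 5678 0126
0146 1248 1458 2456 0abc 0abd 89bd a4 489a a3 389a 43 349a 49bc 34cd 20
024c 249c 012c 234c 1248 123d 18bd 023d 02ad 234a 3478 479a 79bc 47cd 034d
037c 379c 013c 1348 134d 18bd 03ad 3abc 013c 13ad 18bd 1348 1378 034c 037c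
49bc 79bc 479a 478c 47bc 038c 037b 32 023c 2349 029b 1238 23ab 12bd 04ad
4abc 014c 14ad 18bd 1478 047c 79bc 7abc 43 034c 347a 03ad 34ab 34ac 34ad
13bd 38bd 1348 1378 048b 048c 32 023c 2379 029b 1234 238c 012c 86 689a
06ad 80 0168 089a 16ac 16ad 62 0268 02ad 268a 289a 028a 26ac 26ad 12cd
126a 189a 1278 27cd 78bc 1abc 1bcd 16ab 08ad 08bd 89bd 8abd 62 0126 2689
268a 129b 02ad 12ad 1bcd 08bc 6abc 026c 26ab 26ac 26ad 2bcd 08bc 78bc 012c
017c 067c 1267 a8 db 8abd cb d1 1bcd 168b 178b 16bd 678b 0167 078b 07ad 21
012b 1267 268b 126b 12ab 267a 21 b0 012b 268b 278b 0126 0127 06ad b6 016b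
126b 168b 678b 1267 679a 178b 079c 01bc 068b 078b 0126 0127 268b 12bc 2bcd
27ad 30 0123 23ad 53 0356 358a 058b 5678 0125 0135 0167 2568 139c 128a 43
0345 3489 4568 1346 134a 467a 2356 235d 0156 56bd 15ac 678b 567a 038b 03ab
389a 12ad 289a 128b 01bc 85 258a 589a 125a 15ad 158a d4 4bcd 458b 468b
478b 45bd 46bd 568b 678b 4567 124d 248a 249a 049c 54 245a 05ac 15ad 0145
0245 149c 15bc 568b 156c 2456 026c 458b 32 238a 239a 3458 039c 0234 034b
028b 123d 2348 34bd 68bc 78bc c5 c0 015c 016c 017c c2 012c 52 025c 256c
1567 267c 67cd 026d 1256 567c 56cd 1267 025d 026c 28bc 2abc 289a 08bc 0abc
089a 58bc 5abc 589a 08bd 68bd 089a 0abd 08ab 068b 078b b2 28ab 28bd 2bcd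
68bc 78bc 26cd 67cd 2678 02bd 268b 0126 0267 12bd 678b 6bcd 68bc 16cd 1678
168b 18ab 08ad 68ac 68ad 78ac 67cd 82 0128 289a 12ad 16cd 1678 168a 189a
2678 28ad 26cd 078d 30 60 20 50 74 0147 0247 0347 40 32 0123 0235 0237 65
0156 0456 1245 3567 0167 0467 1246 1234 0125 0126 0127 2345 2346 0456 0467
2567 048d 489a 04ac 24ac 34ac 012c 023c 1234 478d 40 54 0145 0457 45cd
1478 578c 18cd 48cd 148d 76 0167 0267 0367 0567 2456 3456 0124 0234 1236
4567 0156 0256 0356 21 0123 0124 0127 2345 2467 0346 1235 1245 0234 0237
0246 3467 048d 489a 04ad 478a 48ad 058d 589a 05ac 05ad 75 0157 0257 0357
25ac 35ac 012c 023c 1235 578a 578d 58ad 028d 289a 02ac 02ad d2 289d 29ad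
029d 278d 0127 b1 01bc b8 89ab 02ab 018b 038b 068b 63 0136 0367 036c 1378
67bc 037b 1368 3678 0137 013c 067b 37bc 78bc 017c 037c 067c 1237 378d 83
2389 389d 029d 3678 036c 2368 68bc 12ab 89ab abcd 178b 78bc 017c 068d 689a
06ac 06ad d6 689d 69ad 069d 678d 0167 0367 36ac 013c 136a 136d 189a 19ad
1378 43 034c 3467 46ac 1346 1349 4689 038d 389a 03ac 03ad d3 389d 39ad
039d 378d 0137 cb 01bc abcd 13ab 43 32 0237 2389 028d 029d 2348 289d 278d
53 2357 2358 4578 258d 2345 035d 358d 589d 023d 23ac 012c 123a 123d 189a
19ad 1278 1239 027c 3489 78bc 1248 89ab 0247 024c 03ab 47bc 027b 034d 348d
49ad 489d 349d 0acd 089a a8 018a 87 078a 789a 07ad 7acd 78ad 86 068a 689a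
06ad 6acd 68ad 82 028a 289a 02ad 2acd 28ad 84 048a 489a 04ad 4acd 48ad 83
038a 389a 03ad 3acd 38ad 76 21 32 0123 0348 0378 1234 3467 1468 2348 2378
3467 0468 2468 0124 1238 1248 1278 2367 2467 1368 0468 3468 0134 0678 2678
3678 4678 0126 0136 1238 1348 2346 08ad 8acd 89ad 87 80 0178 31 0138 43
0134 90 0139 32 d8 54 1345 2345 65 3456 3689 0568 4568 568d 025d 0268 91
019a 048a 568a 05ad 19ad 68ad 125d 036d 0123 1489 1589 1234 5678 1267 1567
0678 678d 056d 0135 0345 0356 045d 578d 0457 1457 0147 0149 1234 047d 4579
4589 1257 79ad 0258 04ad 02ad 234a 038d 048d 0348 2389 0129 1237 1238 1378
0389 0489 0348 30 0378 53 0135 0358 0589 058d 3458 0139 0359 3489 0148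
4578 057d 65 4568 3468 4678 21 0123 0129 2389 1234 1267 2356 056d 5689
678d 0567 1467 5679 0468 079a 79ad 058a 04ad 468a 21 0123 0128 2389 2348
2358 0129 0289 0258 0278 2345 2357 4578 1237 93 0139 239a c0 013c 039c
389c b1 139b 09bc 09bd 389b 13bc 13bd 23bc 12ac 12ad 12cd 39ad 9acd 389d
12ab 39ab 389b 239b c9 139c 9abc 12bc 09cd 389c 13cd 12ad 12bd 39ad 9abd
389d 3489 3589 0148 0158 54 0458 4578 1257 3579 0258 42 2458 1289 019a
028a 248a 02ad 19ad 78ad 157d 024d 1247 479a 479d 04ad 049d 49ad 1245 1457
3459 0248 0578 74 0478 2478 045d 028d 578d 3479 579a 05ad 345a 59ad 13ad
145d 034d 0389 038d 0139 478d 3489 0347 3479 079a 038a b0 013b 079b 389b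
034b 038b 48ab 48bd 0abd 75 0578 53 3578 1389 019a a8 578a 05ad 19ad 78ad
138d 137d 0378 378d 0389 32 2357 027d 0237 43 0234 3457 045a 0347 034a
478a 123d 2389 0129 038a 058a 0358 51 0158 1578 1358 84 0148 4578 1345
0348 035d 578d 038d 058d 3478 32 0238 2348 028d 0235 1235 76 0678 5678
0356 1467 1567 3468 068d 0126 2689 268d 0129 029a 129a 035a 147a 578a 579a
268a 0379 ba 2abd 37ab 03bd 0abd 68ab 56bd 65 85 5678 1367 40 0458 1345 21
0124 0245 2489 0278 0129 129a 2467 135a 0468 578a 0689 148a 0146 1235 1245
1267 0234 2346 1467 d5 578d 028d 2368 4689 468d 249a 49ad 02ad 025d 035d
2578 0368 0289 4689 0149 048d 578d 035d 045d 135d 3456 1348 3489 1458 039a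
1489 048a 19ad 458a 04ad 058d 1589 578d 019a 135d 058a 19ad 578a 05ad 1356
1567 0168 1678 1568 1357 43 54 85 0158 0358 3458 1389 019a 038a 358a 03ad
19ad 78ad 157d 32 2345 1257 2589 0123 0128 0129 0289 0389 0238 65 3456
1367 3567 1237 0128 2368 0568 3568 0589 2389 0129 50 0145 0345 21 0125
0128 2589 2568 0129 129a 0289 0389 0245 0278 3468 3478 2567 146a 147a 3678
678a 679a 036d 0379 678d 67ad 258d 03ad 349a b3 345b 37ab 58ab 03bd 29bd
249b 479b cb 2bcd 34bc 03cd 03bc 23bc 012c 1237 d3 345d 378d 589d 038d
568d 359d 379d 0168 5679 1236 3678 023d 123d 0245 1247 3478 1389 019a 19ad
038a 03ad 378a 056d 057d 0589 058d 678d 1367 1567 0159 5679 5689 79ad 0368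
05ad 03ad 345a 1457 0148 94 0149 149a 349a 0489 0478 049a 32 0234 1234
0289 1247 249a 02ad 62 2356 2678 4567 0269 026d 69ad 023a 123a 0278 0124
2457 4579 4589 0158 0358 65 5678 60 0146 4689 0568 3568 057d 038d 79ad
358d 03ad 38ad 358a 067d 79ad 03ad 06ad 356a 1567 4569 0678 679a 06ad 456a
69ad 14ad 156d 1347 0478 41 0148 1478 1348 1457 64 84 4678 1367 da 30 0368
0378 60 0356 1567 5689 159a 459a 134a 067d 78ad 79ad 068a 1379 019a 034d
45ad 47ad 49ad 567a 0349 049d 1349 479d 019a 057a 21 0125 0129 2579 1234
1267 2356 04ad 459a 478a 479a 5679 4568 456a 68ad 06ad 456d 0356 034d 048d
1489 478d 019a 134d 048a 19ad 478a 04ad 1346 1467 0168 1678 1468 089d ba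
9abd 08bd b7 78ab 79ab 08ad b9 cb 78bc 9abc 9bcd 089c 07cd 07bc dc 9acd
08ac 85 b4 458b 478b 49ab 4579 578b 45bc 014c 145b 1479 19ab 04bd 21 0124
012c 24bc 41 014c 48ac 148b 124b 248b 12bd 149d 19ad 1289 2458 4579 45bc
578b 14bd 19ad 1289 1479 1489 2478 124b 158b 1245 1579 4578 58ac 015c 1589
019a 019c 19ab 19ad 058a 15bd 59ab 65 056c 567b 679c 156b 5679 678b 0bcd
019b 09ab 76 067b 678b 06bd 0679 20 027b 029b 1279 2679 0126 0279 02bd
278b 089b 09bd 09ab 07bd 078b 089b dc 9bcd 20 30 74 0147 0247 0347 478b
14bd 24bc 24bd 34bc 12cd 23cd 1234 047b 47bc 47bd 75 0157 0257 0457 578b";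
"15bd 25bc 25bd 12cd 24cd 1245 057b 57bc 57bd 45cd 65 0567 56cd 67bc 4567
0167 678b 1456 16bd 14cd 037b 03bd 378b 027b 02bd 278b 08cd 0bcd 078c 9abc
089c a8 a0 019a 078a a6 016a 678a 1689 068a 067d 78ad 07ad 017a 65 056a
568a 05ad 0567 20 026a 027a 1267 2567 0125 0267 02ad 268a 60 068a 62 0126
1289 028a 2678 65 0156 1589 058a 52 2578 258a 057d 02ad 78ad 0257 025d
578a 58ad 05ad 0567 5689 059a 0268 2689 029a 06ab 06ad 78ad 067d 85 058a
5678 0568 056d 68ad 1589 015a 015b 589b dc 9acd 9bcd 06ac 5abc 015c 06cd
08cd 678c 0abd ca 78ac 9acd 07cd 08cd 078c 20 50 76 0167 0267 0567 678a
678c 26ab 56ab 16cd 26cd 12bd 25bd 1256 067c 30 74 0147 0247 0347 478a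
478c 24ab 34ab 14cd 24cd 12bd 23bd 1234 047c 42 0124 0245 0246 4567 0156
0356 1235 0234 0237 3467 247c 278c 2467 0146 0346 147c 2347 178c 0123 1247
037c 03cd 378c 057c 05cd 578c 027c 02cd 278c 0acd cb 9bcd 089b b1 01bc
1bcd 089c 30 b4 014b 034b 4bcd 134d 013b 34ab 478a 147d 347b 7bcd 489b 76
4678 678a 46ab 74 478a 04ac 047b 467b 046b 679b 479d 79cd 067d 0346 134d
34ab 013b 479b 79cd 047d 067d 147d 0146 467b 037b 137d 3467 0134 03ac 378a
037d 78ad 78cd 79cd 038c 0379 379b 3bcd 21 0129 123b 2379 123d 12ad 238a
189b 018b 76 1678 678a 16ab 21 012b 1278 32 1238 138b 389b 013b 2367 23ab
368a 168b 689b 016b 12ab 278a 127b 017b 7bcd 1267 027d 268a 026b 689b 0abc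
75 578a 5abc 015c 578c 15ac 89bc 54 045c 145c 4578 1489 019b 04ab 457a
478a 047a 45ac 014c 21 012c 125c 25ac 1245 024c 025a 2578 028d 1289 578d
19bd 145d 76 678a 6abc 016c 678c 16ac 89bc 20 026c 26ac 012c 126a 178a
1257 025c 256c 56ac 026a 126c 2678 1289 019b 02ab 267a 278a 027a d7 78ad
78bd 78cd 89bc 79bd 61 016c 679c 68bc 019c 168a 1579 1abc 015c 159c 5abc
5679 568a 1679 019c 19bd 579c 015c 15ad c2 012c 12ad 32 235a 239a 3579
1235 123d 35cd 279c 2abc 278a 057d 067d 51 0156 015c 567c 56bc 5abc 017c
40 047c 4567 0145 1467 147d 046b 159d 089b 5689 19bd 468a 21 0124 012c
24ac 1247 1289 2468 047d 478a 04ab 04ad 016b 15ad 167d 157d b9 19bd 1579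
1589 179d 058c 1567 056c 6abc 21 0125 0126 012c 25ac 268c 568a 1257 1289
0256 256a 2568 02ad 1689 16ad 089b 89bc 018c 068c 1568 689b 056b 08ab 08ad
dc 9acd 08ac cb 01bc 9bcd 18ab 018b 86 85 41 014b 1458 1468 1478 45ab 469b
46ab 479b 569a 679a 4567 148b 149b 14ab 49ad 31 013b 1348 1358 1368 359b
35ab 369b 459a 569a 3456 139b 13ab 349a 034d 21 0123 012b 1258 2345 259b
459a 1234 12ab 239a 158b 589b 015b 168b 689b 016b 8abc 78cd 72 278c 28ac
2abc 028c 279a 32 2378 037d 038c 38ab 013b 1379 137d 19ad 0238 023d 38cd
027d 028c 28ab 012b 127d 1289 19ad 08cd 85 c0 058c 05cd 015c 578c 057d
79ad 0579 1579 09ac 019a 0acd 08ac 20 76 5678 678c 056c 06cd 56cd 59ad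
5689 52 0125 025b 258c 56ab 12cd 679a 19ad 1289 2578 2678 579b 1269 069b
256c 268c 29ac 2569 069b 259b 012b 1256 126c 168c 97 79ac 067c 07cd 67cd
079b 69ad 62 0126 026b 689b 268c 12cd 179d 32 0236 023b 369b 1237 378c
03cd 123c 158c 1235 1567 0356 267c 269b 278c 012b 1267 127c 178c b9 019b
029b 1679 016b 68ab c5 568c 59ac 5679 05cd 059b 5679 32 0235 035c 0123
1259 1289 2568 2359 2389 3568 679b 016b 026b 1679 2679 19ad 29ac 16cd 12cd
69ac 012b 269b 02cd 258c 278c 29ac 025c 027c 578c 79ac 2579 58ab 015b 1589
019a 019b 19ad 058a 0acd 15cd 19ac 578c 59ac 157c 79ac 65 056b 567c 679b
156c 5679 678c 76 70 0167 21 0127 2789 0129 129a 80 0128 0289 32 0123 0238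
0389 2378 0137 42 0124 0248 0489 2478 0147 52 0125 0258 0589 2578 0157 43
0347 3457 3467 1456 145a 146a 2468 3567 568a 035d 567d 56ad 78ad 1345 1346
134a 4567 1356 156a 2568 0357 468a 034d 457d 46ad 78ad 0278 089d 029a 129d
c9 029c 129c b9 029b 129b 32 0123 0237 0378 ba 9abc 9abd 0bcd 16bc 29cd
9acd 23bd 27bd 08ac 39ab 367b 68ab 3689 08ab 0abc 0abd 16ab 9bcd 29bd 0acd
16cd 23cd 68ac 36ac 39ac 3689 089b 012b 278b 289b 028b 089c 012c 278c 289c
028c 31 0137 3789 0139 30 0367 039a 1236 239a c3 013c 39ac 02ac 0acd 12ac
0267 13cd 139c 126d 789c 67cd 378c c9 039c 139c 239c 12ac b9 139b 239b
12ab 12bc 9abc 09bc 789b 67bc 126c 0267 02cd 7bcd 9acd 789d 389c 0138 038c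
089c 0378 0389 0138 41 0147 4789 0149 149a 43 349a 123a 2349 2789 2367
136a 679a 0479 2479 0234 249a 029d 02ad 149d 136d 67ad 69ad 0269 ba 26ab
6abd 02bd 02ab 47ab 014b 1346 1347 1467 65 0567 91 019a a7 567a 05ad 19ad
67ad 126d 136d 0267 0367 367a 035a 023a 2356 057a 0157 74 4567 1245 1345
0247 0347 027a 037a 2347 3567 0235 047a 4789 0457 1245 1345 249a 349a d1
19ad 02ad 03ad 0234 0357 1235 145d 147d 567d 1289 1389 1489 1689 1789 3568
4568 1567 1235 1345 2348 1256 1356 1456 75 0257 0357 0457 32 2345 2357
034d 027d 457d 0234 023d 3457 357d 037d 5789 359a 459a 32 2345 2359 1346
134a 2789 0467 159a 2467 04ad 91 19ad 124d 129d 459d 1249 1579 4679 1234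
1236 3459 0367 1239 039d 03ad 359d 19ad 123d 0789 078d 97 0179 0679 679a
1789 06ad 019a 19ad 79ad 789d 679d 21 0129 1279 2789 127d 0279 31 0139
1379 3789 136d 137d 2367 379a 023a 079d b9 b0 019b 09ab 1789 017b 07bd
78ab 74 75 21 0129 012b 1247 1257 1267 24ab 2589 25ab 2689 458a 568a 2456
1279 1289 31 0139 013b 1347 1357 1367 34ab 3589 35ab 3689 458a 568a 3456
53 2357 1239 039b 39bd 023d 123d 028b c7 17cd 357c 03cd 07cd 78bc 9bcd
1359 0159 1235 2347 2367 1345 1369 4567 0169 1356 1579 5789 0159 1479 4789
0149 078b dc 8bcd 9acd a8 c9 91 019a 019c 19cd 078c 07ac 07bc 0abc 19ab
67ab 8abd 06bc 16bd 0169 62 0126 267b 12bd 126b 0129 2689 168c 63 0136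
367a 13ac 036b 2369 0123 1789 75 72 74 ba 8abd 07bd 51 0159 1567 5689 68ab
056b 56bc 015c 15cd 07ac 27ab 12bd 256b 0125 1589 58ab 05bd 15bd 52 2567
257b 258d 1569 02bd 69ab 0269 26bd 25bc 12cd 1259 125b 059c 17ab 07ac 07ab
017a 0abc 0abd c3 013c 43 2347 347a 03ab 23ac 039c 012c 1239 1349 049c
49bd 04ab 134d 457a 045b 1345 15bd 3abc 347a 357a 367a 34ac 35ac 457a 567a
3456 1479 4789 0149 1279 2789 0129 1579 5789 0159 079c 789c 017c 067c 67cd
1789 019a c2 012c 267c 126d 19ad 19bd 07ad 06bd 0abd 67ab 279c 289c 027c
026d ba 28ab 8abd 02bd 02ab 07ab 267a 078a 78ac 019a 1789 017a 017c 07ac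
07cd 0bcd 09bc 079c 9abc 07ab a0 017a 019a 1789 0abd 0acd 67ac 06cd 64
0146 467a 467c 04ab 14cd 18bd 19bd 1789 17ac 21 0124 12bd 24ab 124c 1278
2467 046c 46cd 48bd 49bd 4789 47ac 47ad 54 0456 056c 0145 146c 1489 19ac
456c 0156 567a 05ab 15ad 45ab 0569 19bd 14bd 1469 079b 789b 09ab 017b 067b
1789 179b 019a 078a 0abd 67bd dc 62 267b 279b 027b 32 2367 036d 037b 3789
0139 239a 136d 1378 02ad 18ad 0237 023d 37bd 026d 027b 2789 0129 126d 1278
1bcd 18cd 89bc 06cd 0acd 67bc 09ac 0abc 6789 65 569a da 69ad d9 569d d1
169d 19ad 1679 1789 179d ca 69ac 9acd 06cd 16cd 0156 0169 15cd 09cd 569c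
54 4569 40 0456 067d 79ad 0679 4679 0469 046d 469a 469d 04ac 42 2456 2469
2678 2689 2468 124d 24ac 012c 145d 45ac 014c 05ac 0569 0789 0147 4789 60
0146 0156 4678 15ac 0148 149c 089c 0679 067d 79ad 679d 789d 79ad 05ad 0569
0789 60 0156 069a 54 0456 04ad 456a 469a 046a 45ad 52 0256 02ad 256a 269a
026a 025a 25ad 42 0246 0247 4678 4789 0248 249d 089d 1245 0126 0127 2678
2467 0128 469d 089d 0678 0689 0568 5678 80 0158 1567 61 0168 0169 0689
069a c6 016c 69ac 0acd 16cd 156d b6 69ab 6bcd 0abc 156b 689b 169b 156c
689c 169c 1678 52 0258 a2 259a 5679 5789 279a 2579 2789 02ad 69ad 156d
17ad 19ad 167a 1679 179a 1256 0128 2568 2678 1268 0678 089d 069a c9 069c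
95 cb 9abc 0abd b9 59bd 69bc 9bcd 56cd 089b 789b 017b 1567 0159 015b 0789
0157 0578 578b 058b 0abc 69ab 9abd 56bc 56bd 59ac 59cd 0acd 5679 5789 579c
579d 567c 567d 79ac 79cd 0acd 089c 789c 017c 1567 015c 50 057c 058c 578c
0567 0578 0157 98 90 0189 31 0139 30 0389 53 0135 0359 059a 059d 013a 035a
21 0123 012a 239a 1238 54 96 0169 76 6789 1278 2357 579a 0279 679d 026d
056d 2356 1678 0789 789d 0567 067d 0356 369a 569a 2356 3456 1268 3469 349a
4689 3459 459a 034a 32 0123 87 0789 75 5789 359a 013a 059a 079a 0579 3579
0179 0379 1257 54 2345 76 0679 6789 069a 3469 013a 4679 349a 1267 3567
2456 1247 0479 4789 049a 349a 013a 0457 3457 0134 1278 3578 43 0134 0349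
2347 049a 049d 0478 034a 0348 479a 1248 579d 2457 045d 3478 63 0136 0369
2367 069a 069d 013a 036a 349a 679a 0479 4579 579d 045d 3678 54 2457 4567
1248 3568 3569 0489 0169 1246 4689 049a 349a 013a 3456 3459 0159 5689 1245
3468 2467 1238 239a 0129 012a 2359 029a 0259 0289 2358 43 0134 0349 049a
2345 2349 4589 039a 039d 013a ba 43 0134 32 54 1345 86 0689 689d 036d 3456
0356 056d 0135 1568 3456 0368 368a 0138 08ab 038d 036b 8abd 456b 04bd 045d
589d 0458 1458 0138 014a 1234 038d 458a 459a 1258 8abd 0259 04bd 02bd 234b
239a 012a 1238 1239 1389 034d 349a 489d 0348 348a 08ab 039b c0 013c 08ac
39ac 034c 039c 49bc 49cd 0bcd 03ab 39ab 013b 43 86 0689 96 0169 87 0789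
6789 067d 789d 079d 0179 1367 0369 3689 039d 1378 1678 3467 53 3567 52 21
0125 0129 056d 689d 029d 059d 0259 1246 1278 32 2345 2357 0456 4578 0489
1236 0369 3689 039a 039d 369d 689d 023d 056d 024a 0259 0245 459a 0256 1256
0269 0289 2578 3457 0456 2456 0124 1356 0569 5689 059a 059d 1359 569d 1569
035d 1578 034a 3457 459a 069a 069d 689d dc b6 689b 069b 016b 169a 169b";
"01ab 64 346b 369b 39ab 3689 469a 014a 1469 146d 19cd 1bcd 9abc 06bd 69ab
a1 01ab 1abd 069b 89bd 138d 3468 146d 469a 014a 139a 169a 3689 016a 136a
06cd 69cd 689c 1368 65 3456 41 0149 40 0489 21 0124 0129 249a 012a 029a
0289 2468 0146 0469 069a 1268 95 0159 87 0789 5789 4579 0179 1257 1357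
0259 0359 2356 0237 023d 3789 359d 039d 1278 1378 1578 32 2346 2367 4678
1235 3567 1678 4678 0169 0146 067d 069a 357d 016a 023d 679a 0279 459a 014a
059a 0569 0589 069a 1258 1358 0256 2356 023d 34ad 356d 69ad 045d 049a 049d
014a 569d 589d 459a 469a 1358 458a 0146 0359 068d b6 346b 56bd 03bd 06bd
69ab 8abd 1458 1468 0589 76 3467 5678 1378 96 0369 0469 3469 045d 039d
569d 60 0156 0346 21 0126 0129 269a 2679 012a 0179 039a 059a 1457 3479
5789 1478 1245 1268 0246 2346 0235 023d 1238 3589 389d 039d 067d 069a 069d
589d 789d 045d 1478 046a 0479 679a 1568 0159 85 0158 0589 0568 54 87 0789
50 0345 21 0125 2568 0128 0289 0258 1258 2345 1238 3478 3678 5679 0179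
1237 1247 3789 0245 039d 023d 379d 0567 056d 058d 678d 1378 5678 3457 3467
1468 0145 056d 059a 059d 015a 679d 579a 1458 4568 0148 0489 0458 1348 0489
94 0149 54 4589 1358 74 4789 1378 64 4689 1368 65 3567 4569 1678 30 0356
0379 069a 679a 016a 034d 456d 69ad 46ad 48ad 678a 1568 5678 4679 30 0367
0369 079a 569a 015a 034d 467d 79ad 45ad 48ad 568a 1346 1468 0169 1689 1469
1347 1478 0179 1789 1479 1345 1458 0159 1589 1459 049d 1349 489d 1489 134d
149a dc 19cd 049c b9 19bd 489b 04bd 049b 149b 01ab 01bc 9abc 04cd 49cd
489c 09ad b9 ba cb 89bc abcd 08cd 09cd 089c 20 70 30 60 40 50 87 0178 0278
0378 0478 0578 21 0123 0124 2347 2457 0345 1237 1247 0234 0245 3457 43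
0134 0345 0346 0348 4578 4678 0357 0167 0567 1356 c4 489c 49bc 348c 349a
3abc 478c 0147 0247 21 0123 0125 0128 2345 2578 0457 1234 0235 0238 3578
0157 0457 1245 058c 05cd 589c 048c 04cd 489c 068c 06cd 689c 038c 03cd 389c
078c 07cd 789c 028c 02cd 289c dc c0 db 89bd 85 589b 54 4589 43 3458 038d
034c 49ac 01ac 149a 32 0123 2345 129a 125a 125b 14ab 15ab 124a 159a 2459
238d 29bd 2abd 239a 3459 3589 2359 0349 349a 03ac 3abd 49ac 348d 349d 014c
489b 489d 149a 34bc 1abd 013c 134d 45bc 014c 145b d5 589d 59bd 459a 459d
4abd 045d 145d 19bd 1abd 1459 149a 159b 049b 21 0124 12bd 245b 1245 129a
024c 2589 025b 058d 53 52 0125 c5 015c 025c 035c 35cd 158d 038d 023d 1abd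
2389 129a 58bc 87 789b 57bc 2578 3578 028d 128d 0235 18bd 1238 078d 65
0567 678d 256d 356d 68bd 068d 268d 0256 2356 023d 5678 56bc 0167 679b 689b
168d 568d 18bd 5abd 1568 579a 0157 258d 2abd 258a 259a 28ad 359b 028d 0235
23bc 012c 123b 1258 189b 358d 3abd 358a 359a 38ad 59bd 038d 54 0345 459b
34bc 013c 134b 1358 189b 045d 3458 0134 1358 135d 18ad 30 21 0123 012c
23bc 389b 238c 43 034c 349b 49ac 03ac a2 012a 02ac 023a 238a 239a 249a
8acd 3489 0124 048d 82 0128 028c 0238 2348 048c 489b 04bd b0 01ab 039b
129a 139a 029b 013c 02bd 39ac 289b 028d 128a 8acd 20 c5 015c 025c 035c
1235 023c 35bc 589b 1258 358c 018c b7 789b b6 689b 65 b5 567b 56ab 679a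
579b 578c 018c 038c 1268 1238 3578 2356 05bd 32 0235 023c 35bc 41 0145
014c 45bc 1234 0345 034c 45bc 568c 018c 038c 1278 1238 3568 027c 0235 2357
567c 0579 679b 06bd 56bc 0156 0356 1235 0236 023c 36bc 07bd 57bc 0157 0357
1235 0237 023c 37bc 02bd 289b 028b 028d 87 278b 789b 027b ca 01ac 8acd
128a 42 249b 49ac 014c 034c 1234 349a 23ab 024b 024d 2478 479b 47cd 79ac
03bd 389b 038d 89cd b8 87 378b 789b 037b 07bd 078b 86 368b 689b 036b 06bd
068b 63 369b 36ab ca 01ac 8acd 138a 178a 678a 1367 69ac 016c 169c 136c 64
46cd 034d 346b 346c 16bd 38ac 18ad 1378 1678 3467 1346 469a 34ab 0368 036d
3678 089b 67cd 036b 679b 79ac 01ac 08ac 038a 138a 368a 013a 038b 08bd 089b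
09ac 70 30 b0 01ab 039b 03ab 079b 139a 379a 0137 20 60 50 40 21 0123 0124
0125 0126 0127 43 0345 0346 2456 2467 0567 2345 2346 0456 0467 2567 76
0167 0367 0467 0567 1236 1246 0234 0245 3456 65 0156 0356 0456 1235 1245
0234 0237 0246 3467 32 0235 0237 3567 41 0145 0147 4567 1234 0345 0347
4567 04bc 489b 048d 89cd 8acd 049c 76 0567 86 4689 689b 046b 4568 568a
45ab 87 4789 789b 047b 4678 678a 46ab 05bc 589b 058c 058d 8acd 058a 53
0356 035a 056b 568a 689b 358a 013a 023a 3acd 1358 18cd 123d 135d 012a 5acd
235a 06bc 689b 068c 068d 8acd 068a 63 0367 036a 067b 678a 789b 368a 013a
023a 3acd 1368 18cd 123d 136d 012a 6acd 236a 02bc 289b 028d 89cd 8acd 029c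
42 2489 24ab 43 0347 478a 2789 789b 027b 2348 348a 23ab 0249 024b 489b 32
2349 23ab 348a 023b 2348 349b 03bc 389b 038c 038d 89bd 89cd 8acd 039c 038a
43 349b 34ab 049c 0134 138a 01ab 1acd 51 0157 015a 578a 3789 789b 037b
15bd 345b 589b 458a 034d 48cd 4acd 0348 348a 013a 3acd 1348 134a 18cd 21
0128 123a 2348 123d 12bd 239b 07bc 789b 078c 078d 89bd 89cd 8acd 079c 078a
76 679b 06bc 067b 62 0126 2679 267b 129a 12bd 1acd 026b 26bd 2acd 278a
279b 32 0236 23cd 36bc 236b 239a 3679 678a 016a 6acd 1678 18cd 167d 7acd
167a 21 012a 126a 267a 126d 12bd 26ab 09cd 0bcd 01ab 089b b8 87 078b 789c
07cd 86 068b 689c 06cd 50 059b 05ab 159a 60 0156 069b 569a 0678 068d 06cd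
89bd 679c 179a 579a 017b 0157 07bd 0568 0578 05cd 569c 579c 589c 169a 179a
058d 017b 89bd 05bd 07bd 56ab 0167 679a 08bd 8bcd 89bd 09ab 019b 19ab 189b
b2 012b 289b b3 013b 389b 1238 023b 028d 89bd b4 234b 489b 1348 04bd 49ab
049b 39ab 039b 239b 03bd 39bd 023d 42 024b 249b 49ab 1248 1249 3489 149b
1234 29ab 029b 02bd 89bd 72 2789 078d 079b 79ab 017b 178d 73 037b 37bd
038d 023d 2389 1378 379a 13ad 0279 027d 79bd 09bd cb ba abcd 09cd ca 20 30
c0 01ac 029c 02ac 039c 129a 239a 0123 70 50 60 40 21 0123 0124 0125 0126
0127 43 0345 0346 2456 2467 0567 2345 2346 0456 0467 2567 76 0167 0367
0467 0567 1236 1246 0234 0245 3456 65 0156 0356 0456 1235 1245 0234 0237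
0246 3467 54 0145 0345 1234 0235 0237 3567 4567 0147 0347 1234 3456 0236
04cd 489c 4abc 048c 8abc 048a 54 0145 0245 148a 248a 1abd 012a 2abc 12cd
045c 458a 589c 06cd 689c 6abc 068c 8abc 068a 76 0167 0267 168a 268a 1abd
012a 2abc 12cd 067c 678a 789c 05cd 589c 5abc 058c 8abc 058a 75 0157 0257
158a 258a 1abd 012a 2abc 12cd 057c 578a 789c 07cd 789c 078c 8abc 078a 32
0123 023a 378a 237c 12cd 1abd 129a 178a 2379 2389 138a 137c 43 0134 1347
0479 348a 2489 489c 124c c3 389c 3abc 238a 378a 02ab 379c 079b 23cd 2abd
239a 278a 42 024a 234a 478a 3479 079b 01ab 03ab 178a 123a 1247 248a 3489
489c 234a 04cd 234c 04ab 279c 079b 03cd 389c 3abc 038d 8abd 038a 0abc 038c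
73 378c 43 34ac 478a 347c 07cd 0137 0237 138a 238a 1abd 012a 2abc 12cd
034c 348a 489c 037c 378a 789c 02cd 289c 2abc 028d 8abd 028a 0abc c4 489c
32 234c 23ac 348a 023c 238a 389c 024c 04cd 24ac 0124 128a 01ab 1abd 029b
14cd 54 0145 2459 059b 458a 2589 589c 025c 09ac 0acd 0abc 09ab dc b1 01bc
1bcd 09ac 31 013b 39ab 73 0137 137b 3789 078d 78ab 8acd 379b 37ab 7acd
037d 43 0134 3479 047d 349b 75 3579 4579 57ad 359b 145d 5789 378b 038b
8bcd 3478 078d 0147 057d 3457 0135 0145 4589 147d 358b 4789 038b 3578 43
d3 34bd 3bcd 39ab 3489 48ab 38ad 8acd 138d 21 012b 29ab 52 0125 125b 2589
058d 58ab 8acd 259b 25ab 5acd 025d 135d 2359 239b 3459 3589 045d 258b 0124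
028b 2458 123d d5 5bcd 59ab 59cd 85 589d 129d 2349 149d 49ab 014b 58ab
8acd 058d 138d 358d 2389 0235 029c 125d 135d 2345 045d 145d 0234 014b 459b
45ab 2359 029a 029c 015a 89cd 028d 158d 2358 134d 4acd 4bcd 34ab 49ab 3bcd
54 4589 45bd 58ab 48ad 8acd 348d 345d 45ab 5acd 19ab 97 92 96 93 95 94 21
1239 1249 1259 1269 1279 43 3459 3469 2456 2467 5679 2345 2346 4569 4679
2567 76 1679 3679 4679 5679 1236 1246 2349 2459 3456 52 2569 2589 5678
1789 3789 1237 3567 2359 125b 015b 75 3579 5789 1235 2369 2389 3678 1257
157b 017b 149b 49ab 014b 159b 59ab 015b 139b 39ab 013b 169b 69ab 016b 129b
29ab 012b 179b 79ab 017b 09cd c0 019c 01bc 19ab 20 97 96 50 30 32 0123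
0235 023b 35ab 39ab 239c 12cd 15ad 65 569c 43 0234 0345 045c 349b 34ab
4569 14ad 1345 145c 139c 356b 016b 026b 1256 1356 25ad 26cd 679c 267d 3567
137d 21 0125 012b 239b 23ab 29ab 129c 75 3579 579c 235b 135c 015b 13ad
15cd 257b 027b 2357 3569 2567 067b 679c 06cd 43 0345 034b 459b 49ab 349c
123c 149c 169c 179c 189c 1456 1457 5679 5789 1678 1234 0145 014b 2345 459b
45ab 025b 259c 345b 12cd 013b 15ad 1345 03cd 369c 379c 389c 036c 037c 679c
789c 3678 05cd 569c 579c 589c 056c 057c 679c 789c 5678 69ab 016b 026b 269b
012b 63 036b 36bc 03cd 1236 369b 023b 79ab 017b 027b 279b 012b 73 037b
37bc 03cd 1237 379b 023b 02cd 289c 028c 32 239c 23bc 39ab 023c 43 349c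
34bc 49ab 2348 248c 489c 024c 09bc c9 019c 19bc 189c 21 012c 129c 29bc c4
014c 489c 1248 024c 54 459c 59bc 045c 245c 048d 02cd 89cd 1458 1459 589c
059c 05cd 59cd 025d 2589 259c 29bc 49bc 049c 04cd 49cd 89cd 048d 93 039c
3489 034d 1239 39bc 013c 023c 139a 024d 01ac 2489 249c 29ac 09cd 9abc 92
96 97 95 93 94 32 2349 2359 2369 2379 2389 54 4569 4579 3567 3578 6789
3456 3457 5679 5789 3678 87 2789 4789 5789 6789 2347 2357 3459 3569 4567
76 2679 4679 5679 2346 2356 3459 3489 3579 4578 43 3469 3489 4678 52 2569
2589 5678 2345 4569 4589 5678 49bc 014c 149a 149b 1abd 149d 54 2459 459d";
"249c 124d 012c 145d 569d 579d 589d 5abd 1456 1457 1458 17ab 18ab 567a 578a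
1678 39bc 013c 139a 139b 1abd 139d 53 2359 359d 239c 123d 012c 135d 569d
579d 589d 5abd 1356 1357 1358 17ab 18ab 567a 578a 1678 59bc 015c 159a 159b
01ac 1abd 159d 65 2569 569d 259c 125d 012c 156d 679d 689d 6abd 1567 1568
17ab 18ab 67ac 678a 016c 789d 167d 79bc 017c 179a 01ab 1abd 079b 21 0127
012c 279c d5 57cd 5abd 579a 125d 2569 51 0157 015c 579c 1567 156d 67cd
69bc 016c 169a 169b 01ab 01ac 1abd 069b 169d 65 056c 56cd 059b 31 0136
013c 369c 135d 2359 359d 023d 123d 026c 012c 269c 569a 15ab 1569 156d 689d
6abd 1568 168d 18ab 76 067c 678d 78ac 1567 678a 1789 29bc 012c 129a 129b
01ab 01ac 1abd 029b 129d 42 024c 49ac 74 0247 247c 4789 078d 78ac 8abd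
479c 47ac 17ab 7abd 047d 127d 027c 32 0234 023c 347c 1237 123d 379d 124d
489d 1248 018c 18ab 48ac 014c 32 023c 234c 348c 1234 123d 34cd 87 80 0178
21 0128 289a 012a 90 0129 029a 32 0123 0239 039a 2389 0138 42 0124 0249
049a 2489 0148 62 0126 0269 069a 2689 0168 52 0125 0259 059a 2589 0158 43
3458 3468 1456 1467 5678 1345 1346 4568 4678 1567 0289 09ad 0278 12ad ba
02ab ca 02ac 12ac 32 0123 0238 0389 84 0148 85 0258 53 0358 0389 3578 1457
3458 034a 034c 034d 4abc 4acd 0bcd 2357 4578 145c 145d 2345 0348 035a 5abc
5acd 0bcd 0589 2358 589a 0135 35ab 35ac 13bc 13cd abcd 0489 2348 489a 0134
34ab 34ac 13bc 13cd abcd 09ac 012c 289c 29ac 029c 09ab 012b 289b 29ab 029b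
32 31 0138 389a 013a 30 43 0134 0348 049a 0489 0349 c0 013c 03ac 389c 39ac
039c ca 13ac 23ac ba 13ab 23ab 12bc da 13ad abcd 12cd 09ad 0139 3489 39ad
3abd 02bd 0248 0278 1247 124c 127b 47bc 0abc 0abd 89ab 78bc 78bd 127c 0278
02cd 3acd 8bcd 347d 028d 348d 2478 48bc 024c 09ac 0acd 89ac 0139 78cd 3489
39ac 0148 48cd 13cd 124d 147d 0248 2478 02ac 028a 248a 0389 039a 0139 75
0578 85 0158 76 0678 5678 056d 678d 068d 0168 1256 0258 2578 028d 1267
1367 1567 2356 d5 578d 89ad 56ad 689a 0268 2368 028d 035d 0368 689a 036a
236a 289a 2578 025d 0236 0689 069a 0269 058d 589a 578d 578a 058a 015a 1589
158a b8 578b 05bd 589b 78bd 19bd 127d 135d 2357 058b 89ab 01ab 1257 1357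
43 2345 1457 0148 489a 014a 234a 289a 2358 4589 0149 2349 0489 029a 0234
1347 0478 d4 478d 048d 89ad 0148 1457 45ad 589a 0258 2358 028d 034d 0358
589a 035a 235a 289a 2478 024d 0235 0589 059a 0259 1237 0378 83 0138 43
3478 1247 63 3678 1267 d3 378d 89ad 34ad 36ad 37ad 689a 467a 3468 023d
123d 0248 0268 489a 024a 039a 64 0246 3469 069a 1467 4689 14ad 0149 09ad
1236 1367 0168 1678 1368 1234 1347 0148 1478 1348 038d 1238 389a 378d 1378
378a 123d 138a b8 18bd 378b 03bd 038b 89ab 01ab 089a 089d 21 012a 289a a1
128a b0 01ab 89ab 018b 128b 18ab 089b 08ab c0 01ac 89ac 018c 128c 18ac
089c 08ac 62 0126 126a 2678 067c 067d 679a 79bc 79cd 0bcd 268a 269a 32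
0123 2368 036c 036d 69bc 69cd 0bcd 238a 52 0125 2568 056c 056d 69bc 69cd
0bcd 258a 76 5678 2356 3578 257a 067a 67ab 67ac 06bc 06cd 9bcd 267a 127a
2367 2567 369c 369d 3568 569b 569c 35bc 35cd 9bcd 189a 018a 1278 83 1238
86 1268 84 1248 85 1258 43 3458 3468 2456 2467 5678 2345 2346 4568 4678
2567 158a 589a 015a 148a 489a 014a 168a 689a 016a 138a 389a 013a a8 018a
189a 178a a4 014a 478a 1247 024a 54 458a 589a 045a 245a 047d 02ad 78ad
1457 1458 578a 058a 05ad 58ad 025d 2578 258a 289a 489a 048a 04ad 48ad 78ad
047d 83 038a 3478 034d 1238 389a 023a 024d 2478 248a 289a ca ba a1 01ab
01ac 089b 089c dc 1acd 9bcd 08bc a3 3acd 123d 023a 23ab 02bc 389a d7 78bd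
79cd 12bd 379a 238b 378b 123b 13bd 138b 127d 278b 02bc 12bc 12bd 027a 38bd
123d 60 0236 367a 368a 678b 68bd 036b 126d 136d 026a 139c 43 0134 0346
046b 346a 3489 4678 067d 06bc 678b 08cd 0bcd 1abc c2 278c 2abc 127c 279a
79bc 02cd 12cd 1abd 08bd 78bc 07cd 127c 027a 73 0237 378c 123c 137c 013a
389a 138b 74 0247 478b 124b 047c 347a 0134 128a 189a 86 85 83 84 76 1678
3678 4678 5678 1236 1246 2348 2458 3456 32 2348 2358 2378 3467 3567 2468
1568 4568 1245 123a 013a 43 3458 3478 4567 1568 3568 1235 1234 134a 014a
148a 489a 014a 138a 389a 013a 158a 589a 015a 168a 689a 016a 08ab 89ab 018b
078b 189a 18ab 01ac 178b b6 016b 678b 1267 026b dc 1acd 167d 78bd 78cd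
07bd 8abc 7bcd 02cd 08cd 26ac 268c 689a 68ab 068b 06bc 06bd 68bc 78bc 68bd
06cd 067c 1acd 8bcd 126d 128d 2678 08ac 89ac 018c 078c 18ac 178c 31 013a
138c 389a c4 478c 1247 1347 024c 034c 32 234c 02cd 28ac 78cd 2378 037d
0237 023d 378c 34cd 03cd 48ac 048c 04cd 48cd 78cd 047d 83 038c 3478 034d
1238 1389 389a 019c 023a 024d 2478 248c 289c 789a 76 90 71 0179 017a 079a
21 0127 0129 2789 ba 17ab 67ab 126b 0267 267a 279a 31 0137 0139 3789 136b
2367 367a 023a 0abd 79ab 017b 17bd 67bd 126d 0267 267a 02ab 1789 21 0129
2789 1279 127a 179a 61 1679 167a 179a 31 0139 3789 1379 137a 179a 75 53
357a 97 0579 3579 3789 0379 3567 039d 056d 679d 379a 3567 1256 257a 279a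
2357 20 0257 027a 079a 023d 02ad 37ad 1356 567a 135a 157a 1235 74 4567
1245 1345 247a 2347 2789 279a 2479 1347 4789 0349 035a 035d 057a 57ad 05ad
1257 1357 5789 0259 0359 32 2359 029d 2789 259d 2367 29ad 036d 67ad 023d
1236 359d 367d 789d 0789 09ad 0167 67ad c0 07ac 89ac 018c c7 017c 1789
019c 189c 31 013c 138c 389c 1378 037c 37ad 036d 367c 39ac 3679 72 027c
2367 023d 1278 279c 012c 789c 79ac 079c 09ac 67ac ba 07ab 67ab 60 067a
089a 65 0567 059a 5679 0579 57ab 57ac 05bc 05cd abcd 51 0158 589a 15ac
15ad 16bc 16cd abcd 156b 156c 156d 17ab a1 1abc 1acd 0bcd 178a 189a 18ab
06bc 06cd abcd 09ab 89ab 018b 189a b7 017b 067b 1789 06cd 019b 1acd 09bc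
178d 8bcd 789b 79ab 079b 6789 61 0169 09ad a6 016a 16ad 089a 0168 0689 b0
016b 069b 689b 09ab c0 016c 069c 689c 09ac 16ac 62 0126 26ab 26ac 12bc
12cd abcd 2678 0128 126c 126d 6abc 6acd 0bcd 678a 689a 0168 0678 089a 068a
1678 a0 017a 018a 178a 678a 21 012a 127a 278a 1267 026a ba 26ab 02bd 1abd
7abd 167d 78ab 89ab 018b 02ab 08ab 63 236a 023d 1237 369d 37bd 9abd 1367
3678 0138 089a 21 0128 2678 1268 1269 1689 65 51 1568 1569 1689 31 0138
3678 1368 1369 1689 43 93 3469 3569 1246 4678 1235 0248 2348 028a 289a
248a 039a 0348 4678 0346 40 0468 0469 0689 0489 049a 0349 1345 1346 4569
049a 0456 0468 0469 0689 1256 5678 0158 0258 029a 32 2369 3678 0138 1356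
2358 028a 289a 238a 023a 023d 1235 357a 358a 358d 578a 89ad 35ad"];
[:: "50 40 a8 a9 10 96 689a 97 789a 61 0146 0156 4678 5678 0457 1678 0147 0157
4678 5678 0456 98 64 0146 4689 1468 62 1246 2689 1268 2468 0124 63 1346
3689 1368 0236 3468 0134 54 0145 65 0156 5689 1568 1456 52 1245 1256 2569
2689 1579 1258 0147 0157 4678 1257 2578 2456 0124 30 0134 0345 3456 0235
1345 2345 1356 3689 0238 2368 2689 4568 5689 589a 4579 0147 0457 1579 4567
5678 0467 0578 20 0125 0247 2579 0268 0279 289a 71 0147 0157 4789 5789
0458 1789 0148 0158 4789 5789 0457 61 0146 0156 97 789a 86 54 0145 1456
1468 4689 52 1245 1256 2568 1258 2589 289a 1259 2456 0124 53 1345 1356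
3568 1358 3589 389a 1359 0235 3456 0134 4569 589a 4578 5689 0457 6789 4567
4678 5678 0457 4679 5679 0457 97 789a 86 98 6789 75 0157 0457 5789 1578
4578 0145 1567 0145 4567 0456 41 62 1246 1267 1269 269a 279a 567a 2567
0125 63 1346 1367 1369 369a 379a 567a 0236 3567 0135 1467 0147 4789 1478
1689 0148 0158 4689 5689 0456 1678 0147 0157 4678 5678 0456 1679 0147 0157
4679 5679 0456 30 20 73 0237 0347 0357 42 0234 3457 0235 62 0236 0256 3467
2356 2367 86 689a 2569 2679 3579 2568 2678 3578 2457 0245 87 789a 2479
4579 0459 2478 4578 0458 97 789a 85 0358 0458 589a 3478 0234 2478 0247
0257 2457 0235 3589 62 0236 2568 3678 2467 2468 6789 3578 0235 0345 2578
4578 0247 95 0459 589a 3479 0234 2479 0247 0257 2457 0235 0245 3578 86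
2678 689a 2469 3568 4568 0346 3579 0235 0345 2579 4579 0247 82 289a 0129
a7 179a 278a 0127 a6 169a 268a 0126 63 0346 0356 467a 567a 0457 367a 0347
0357 467a 567a 0456 0128 189a 0129 a7 178a 279a 0127 a6 168a 269a 0126 63
0346 0356 467a 567a 0457 367a 0347 0357 467a 567a 0456 83 389a 0139 189a
20 a7 179a 378a 0137 a6 169a 368a 0136 62 0246 0256 467a 567a 0457 267a
0247 0257 467a 567a 0456 0128 0239 289a 0138 189a 0139 20 a7 178a 379a
0137 a6 168a 369a 0136 62 0246 0256 467a 567a 0457 267a 0247 0257 467a
567a 0456 0129 0238 289a a6 a7 a5 045a 056a 62 256a 267a 268a 20 0246 0256
2456 63 0236 367a 368a 0367 0368 678a 2356 43 0234 10 0123 0124 1346 0136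
156a 167a 0135 0137 357a 349a 2349 2369 3469 0267 0268 678a 63 356a 367a
368a 30 0346 0356 3456 84 0458 3468 458a 4568 74 0457 3467 457a 4567 42
0234 10 0134 1246 1347 1234 0126 156a 167a 0125 0127 257a 2467 2468 678a
0367 0368 678a 84 0458 458a 468a 478a 4568 4578 678a 2467 3467 2478 3478
0267 0367 0234 86 678a 75 0457 567a 2467 3467 51 156a 157a 1467 0167 0124
0134 0236 1256 1356 1234 2567 3567 257a 357a 0267 0367 0235 2468 3468 10
41 0124 0134 0236 1468 0146 0156 156a 1456 0168 168a 0126 0136 0234 94 20
0249 259a 30 0235 0349 359a 10 0125 0149 159a 61 167a 168a 0137 0138 378a
0136 367a 368a 0137 0138 178a 10 0149 159a 30 0135 0349 359a 62 267a 268a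
0237 0238 378a 0236 367a 368a 0237 0238 278a 61 167a 168a 0127 0128 278a
0126 267a 268a 0127 0128 178a 459a 30 0345 359a 0359 3459 20 0234 0245
2459 10 0134 0145 1459 61 167a 168a 0127 0128 278a 0126 267a 268a 0127
0128 178a 20 0245 259a 0259 2459 10 0124 0145 1459 61 167a 168a 0137 0138
378a 0136 367a 368a 0137 0138 178a 62 267a 268a 0237 0238 378a 0236 367a
368a 0237 0238 278a 74 0457 579a 20 0247 0259 279a 10 0147 0159 179a 30
0347 0359 379a 61 168a 0128 0138 268a 368a 0236 0126 0136 268a 368a 0238
479a 0459 579a 20 0249 0257 279a 10 0149 0157 179a 30 0349 0357 379a 61
168a 0128 0138 268a 368a 0236 0126 0136 268a 368a 0238 65 0456 469a 0459
a7 20 0249 0256 269a 10 0149 0156 169a 30 0349 0356 369a 71 178a 0128 0138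
278a 378a 0237 0127 0137 278a 378a 0238 467a 579a 0457 569a 0459 469a a7
20 0246 0259 269a 10 0146 0159 169a 30 0346 0359 369a 71 178a 0128 0138
278a 378a 0237 0127 0137 278a 378a 0238 479a 567a 0457 a7 20 82 0248 0258
94 0459 589a 479a 64 0456 469a 568a 54 0245 2458 2489 4689 4789 0469 2469
679a 2568 41 0124 1479 0167 1246 1467 1268 4569 4589 679a 2489 2689 2467
489a a6 42 30 0234 0238 3458 348a 0345 045a 458a 10 0124 0128 1458 148a
0145 045a 458a 61 167a 169a 0137 0139 379a 0136 367a 369a 0137 0139 179a
2458 0245 458a 256a 257a 2468 2469 2478 679a 2467 0457 4678 4567 468a 568a
0456 a9 a6 a5 025a 045a 056a 248a 30 0234 035a 348a 238a 0348 0358 3458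
0235 356a 3468 2368 76 679a 2569 2689 3589 2567 3467 0457 53 357a 359a
0367 0369 679a 10 0124 124a 148a 0148 0158 1458 3458 0145 1234 1345 0135
156a 157a 0136 0137 367a 258a 0245 458a 30 0235 0348 358a 10 0125 0148
158a 61 167a 169a 0137 0139 379a 0136 367a 369a 0137 0139 179a 268a 0246
0256 468a 568a 0458 289a 0249 0259 489a 589a 0458 a6 30 10 a5 045a 056a
057a 85 0158 0358 148a 348a 0134 a9 76 679a 0269 0679 259a 269a 2568 2569
6789 569a 5689 0267 257a 267a 279a 2567 0279 0457 579a 2467 2479 41 0134
3459 3467 356a 1249 1459 1257 589a 0159 0359 149a 349a 0134 51 0135 0145
358a 458a 0348 158a 0138 0148 358a 458a 0345 72 267a 0126 a9 169a 279a
0129 83 0348 0358 489a 589a 0459 389a 0349 0359 489a 589a 0458 0127 167a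
0126 a9 179a 269a 0129 83 0348 0358 489a 589a 0459 389a 0349 0359 489a
589a 0458 72 267a 0236 367a 10 a9 279a 369a 0239 81 0148 0158 489a 589a
0459 189a 0149 0159 489a 589a 0458 0126 0137 167a 0237 367a 0236 10 a9
269a 379a 0239 81 0148 0158 489a 589a 0459 189a 0149 0159 489a 589a 0458
0127 0136 167a 85 0458 468a 0456 10 0146 0158 168a 30 0346 0358 368a a9 71
179a 0129 0139 279a 379a 0237 0127 0137 279a 379a 0239 489a 569a 0459 568a
0456 468a 10 0148 0156 168a 30 0348 0356 368a a9 71 179a 0129 0139 279a
379a 0237 0127 0137 279a 379a 0239 469a 589a 0459 85 0458 478a 0457 20
0247 0258 278a 10 0147 0158 178a 30 0347 0358 378a a9 a6 61 169a 0129 0139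
269a 369a 0236 0126 0136 269a 369a 0239 468a 567a 0456 489a 579a 0459 578a
0457 478a 20 0248 0257 278a 10 0148 0157 178a 30 0348 0357 378a a9 a6 61
169a 0129 0139 269a 369a 0236 0126 0136 269a 369a 0239 467a 568a 0456 479a
589a 0459 a7 30 a6 a9 64 467a 469a 60 036a 056a 067a 0479 20 10 a8 468a
789a 0478 51 0125 0135 258a 358a 0238 135a 158a 0123 0128 238a 0147 0149
179a 0247 0249 279a 0467 0469 679a 20 10 51 0125 0135 65 0256 567a 569a
2567 2569 679a 2456 3456 0234 65 0156 567a 569a 1567 1569 679a 1456 0124
0134 2456 3456 0235 0146 167a 169a 0147 0149 479a 0246 267a 269a 0247 0249
479a a8 a5 035a 056a 54 457a 458a 0467 0468 678a 20 32 10 0123 139a 0129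
0139 0159 1359 0135 1345 0124 145a 249a 0145 156a 157a 0146 0147 467a 239a
0239 0259 2359 0235 2345 0234 245a 349a 0245 256a 257a 0246 0247 467a 84
468a 478a 20 10 51 0125 0135 259a 359a 0239 159a 0129 0139 259a 359a 0235
0146 0147 167a 0246 0247 267a 20 10 51 0125 0135 259a 359a 0239 159a 0129
0139 259a 359a 0235 0148 168a 178a 0146 0147 467a 0248 268a 278a 0246 0247
467a 85 0358 389a 20 0239 0258 289a 10 0139 0158 189a 61 167a 0127 0147
267a 467a 0246 0126 0146 267a 467a 0247 589a 0359 389a 20 0238 0259 289a
10 0138 0159 189a 61 167a 0127 0147 267a 467a 0246 0126 0146 267a 467a
0247 a8 20 10 61 0126 0136 0156 a5 035a 236a 0123 1356 0135 41 0124 145a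
246a 1345 457a 458a 1347 1348 378a 256a 356a 0235 a5 025a 035a 126a 136a
0123 236a 0236 0256 2356 0125 0235 42 0124 245a 146a 2345 1245 457a 1457
1467 2567 156a 0125 0135 256a 356a 0236 a9 71 178a 179a 0148 0149 489a
0147 478a 479a 0148 0149 189a 62 0236 0256 369a 569a 0359 269a 0239 0259
369a 569a 0356 84 478a 0247 278a 10 a9 279a 489a 0249 61 0136 0156 369a
569a 0359 169a 0139 0159 369a 569a 0356 0128 0147 178a 0248 278a 0247 10
a9 289a 479a 0249 61 0136 0156 369a 569a 0359 169a 0139 0159 369a 569a
0356 0127 0148 178a 83 0358 568a 0356 20 0238 0256 268a 10 0138 0156 168a
a9 71 179a 0129 0149 279a 479a 0247 0127 0147 279a 479a 0249 369a 589a
0359 368a 0356 568a 20 0236 0258 268a 10 0136 0158 168a a9 71 179a 0129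
0149 279a 479a 0247 0127 0147 279a 479a 0249 389a 569a 0359 73 a9 379a
0349 479a 20 10 a8 378a 489a 0348 a6 367a 469a 0346 61 0126 0156 268a 568a
0258 168a 0128 0158 268a 568a 0256 0139 0147 179a 0239 0247 279a a8 378a
0348 478a 20 10 a6 367a 468a 0346 61 0126 0156 269a 569a 0259 169a 0129
0159 269a 569a 0256 0138 0147 178a 0238 0247 278a a6 367a 0346 467a 20 10
81 0128 0158 289a 589a 0259 189a 0129 0159 289a 589a 0258 0136 0147 167a
0236 0247 267a 95 20 0259 269a 289a 0256 0258 568a 97 3579 0235 0345 2579
4579 0247 789a 63 3678 689a 3569 0235 0345 2569 4569 0246 0236 0346 86
2678 4678 0247 689a 2569 4569 0245 569a 589a 20 0256 0258 268a 87 3578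
0235 0345 2578 4578 0247 789a 96 3679 0236 0346 2679 4679 0247 689a 0568
0469 3479 0234 2479 0247 0267 2467 0246 2569 2456 0347 a8 478a 0348 20 10
a9 389a 479a 0349 a6 368a 467a 0346 61 0126 0156 269a 569a 0259 169a 0129
0159 269a 569a 0256 0137 0148 178a 0237 0248 278a a9 479a 0349 20 10 a6
369a 467a 0346 61 0126 0156 268a 568a 0258 168a 0128 0158 268a 568a 0256
0137 0149 179a 0237 0249 279a a6 467a 20 10 81 0128 0158 289a 589a 0259
189a 0129 0159 289a 589a 0258 0137 0146 167a 0237 0246 267a 95 20 0259
269a 289a 0256 0258 568a 0237 97 2579 4579 0245 789a 62 2678 689a 2569
0235 0245 3569 4569 0346 0236 0246 4678 689a 3569 4569 0345 569a 589a 20";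
"0256 0258 268a 0237 10 0156 0158 168a 0137 a3 137a 237a 0123 034a 147a
247a 0124 a6 20 a8 30 a5 035a 32 10 0123 137a 0127 0137 0157 1357 0135 41
0124 145a 247a 1345 456a 458a 1346 1348 368a 51 156a 158a 0146 0148 468a
0145 456a 458a 0146 0148 168a 237a 0237 0257 2357 0235 42 0234 245a 347a
2345 456a 458a 2346 2348 368a 72 0237 0257 357a 0235 2357 a9 10 0123 0135
1357 61 168a 169a 0148 0149 489a 0146 468a 469a 0148 0149 189a 259a 379a
0239 257a 0235 357a a9 10 0125 0137 157a 61 168a 169a 0148 0149 489a 0146
468a 469a 0148 0149 189a 279a 359a 0239 83 368a 0346 468a 10 a9 389a 469a
0349 71 0127 0157 279a 579a 0259 179a 0129 0159 279a 579a 0257 0136 0148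
168a 0348 468a 0346 10 a9 369a 489a 0349 71 0127 0157 279a 579a 0259 179a
0129 0159 279a 579a 0257 0138 0146 168a 72 0257 578a 0258 30 0237 0358
378a 10 0127 0158 178a a9 61 169a 0139 0149 369a 469a 0346 0136 0146 369a
469a 0349 289a 579a 0259 278a 0258 578a 30 0238 0357 378a 10 0128 0157
178a a9 61 169a 0139 0149 369a 469a 0346 0136 0146 369a 469a 0349 279a
589a 0259 10 a8 84 468a 0246 268a 30 a9 269a 489a 0249 71 0137 0157 379a
579a 0359 179a 0139 0159 379a 579a 0357 0238 0346 368a 0248 268a 0246 30
a9 289a 469a 0249 71 0137 0157 379a 579a 0359 179a 0139 0159 379a 579a
0357 0236 0348 368a 75 0157 178a 0158 30 0138 0357 378a a9 62 269a 0239
0249 369a 469a 0346 0236 0246 369a 469a 0349 179a 589a 0159 578a 0158 178a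
30 0137 0358 378a a9 62 269a 0239 0249 369a 469a 0346 0236 0246 369a 469a
0349 189a 579a 0159 a9 61 169a 0129 0149 269a 469a 0246 0126 0146 269a
469a 0249 51 61 a8 168a 0128 0148 268a 468a 0246 75 1567 678a 679a 1568
1569 589a 578a 579a 1568 1569 689a 0126 0146 84 468a 41 1458 578a 589a
1457 1459 479a 0124 2468 678a 689a 2467 2469 479a 0248 268a 478a 489a 41
1457 1459 579a 0124 2467 2469 679a 0125 0145 a5 256a 456a 0246 53 31 1235
1345 0124 145a 246a 0246 1256 2456 0123 135a 2345 236a 0124 1245 1236 1256
2356 0135 357a 359a 0357 0359 579a a9 30 65 0356 367a 0357 a8 20 0237 0256
267a 10 0137 0156 167a 81 189a 0129 0149 289a 489a 0248 0128 0148 289a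
489a 0249 368a 578a 0358 567a 0357 367a a8 20 0236 0257 267a 10 0136 0157
167a 81 189a 0129 0149 289a 489a 0248 0128 0148 289a 489a 0249 378a 568a
0358 a8 84 489a 0349 389a 20 10 61 0126 0156 267a 567a 0257 167a 0127 0157
267a 567a 0256 0138 0149 189a 0238 0249 289a 0348 389a 20 10 61 0126 0156
267a 567a 0257 167a 0127 0157 267a 567a 0256 0139 0148 189a 0239 0248 289a
75 20 0257 267a 278a 0256 0258 568a 10 0157 167a 178a 0156 0158 568a 41 51
1457 467a 478a 1456 1458 568a 0125 0135 0145 1345 0123 2345 2357 0234 0347
3457 0124 0134 53 3457 467a 478a 3456 3458 568a 0135 0235 2457 0347 1357
2357 0123 567a 578a 20 0256 0258 268a 61 0156 41 51 1456 1458 468a 0125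
0135 0145 1345 0123 2356 2358 368a 0124 0134 52 2456 2458 468a 0235 3456
3458 468a 168a 0158 0136 0146 41 1346 1456 0123 0125 2356 0124 0134 2456
3456 0235 95 20 0259 269a 279a 0256 0257 567a 10 0159 169a 179a 0156 0157
567a 93 0359 31 1359 0125 0135 0145 1345 0124 2459 469a 479a 2456 2457
567a 0123 2359 0125 0235 0245 2345 0124 1459 469a 479a 1456 1457 567a 369a
379a 30 0356 0357 567a 0349 41 1459 0125 0135 2459 3459 0234 0124 0134
2459 3459 0235 569a 579a 20 0256 0257 267a 63 0356 10 0156 0157 167a 31
1356 0135 0145 3567 1345 679a 0134 1459 3469 0123 2356 0235 0245 3567 2345
679a 0234 2459 3469 367a 369a 0357 0236 0346 76 2567 4567 0245 679a 2369
10 0156 0157 167a 0123 0136 1369"]]%cert.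

(** * Evaluation of the certificates and conclusion *)

Lemma table_well_formed :
  all (fun x => well_formed (nverts x) (edgeset x)) table.
Proof. by vm_compute. Qed.

Lemma table_shapes :
  all (fun x => isomorphic_below (nverts x) (adjacent (edgeset x))
                  (adjacent (Defs.shape x))) table.
Proof. by vm_compute. Qed.

Lemma table_lower_certified : all2 lower_certified table critical_colourings.
Proof. by vm_compute. Qed.

(** The last row, K_4, is left to [ramsey_K4]. The values of the other rows are at most 14, so one
    hexadecimal digit is enough to name a vertex. *)
Lemma table_upper_certified : all2 upper_certified (take 26 table) refutations.
Proof. by vm_compute. Qed.

Lemma all2_exists (S : eqType) (T : Type) (r : S -> T -> bool) s t x :
  all2 r s t -> x \in s -> exists y, r x y.
Proof.
elim: s t => //= y s IHs [|z t] //= /andP[ryz /IHs{}IHs].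
by rewrite inE => /predU1P[->|//]; exists z.
Qed.

Lemma table_ramsey x : x \in table -> ramsey_for (row_graph x) (value x).
Proof.
rewrite -(cat_take_drop 26 table) mem_cat => /orP[x_in | ]; last first.
  (* [drop 26 table] consists of the K_4 row alone. *)
  by rewrite inE => /eqP->; exact: ramsey_K4.
have [cs /refutation_ramsey] := all2_exists table_upper_certified x_in.
by apply; apply: (allP table_well_formed); apply: mem_take x_in.
Qed.

Lemma table_minimal x n :
  x \in table -> ramsey_for (row_graph x) n -> value x <= n.
Proof.
(* With [value x] rewritten as the successor of its predecessor, the goal is the strict inequality
   that [avoids_ramsey] gives for a colouring on [(value x).-1] vertices. *)
move=> x_in; have [rows /andP[/prednK{2}<- /avoidsP av]] :=
  all2_exists table_lower_certified x_in.
by apply: avoids_ramsey av _; apply: (allP table_well_formed).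
Qed.

Theorem mainTheorem4 :
  (forall x : row, x \in table ->
     ordering_of (row_graph x) (row_shape x) /\
     ordered_ramsey_number (row_graph x) (value x))
  /\
  (forall (m : nat) (G : ordGraph m), 0 < m <= 4 ->
     (no_isolated G /\ ~ ordering_of G K4minus) <->
     exists! x : row, x \in table /\ same_up_to_reflection G (row_graph x)).
Proof.
split=> [x x_in | m G]; last exact: table_complete.
split; last by split=> [|n]; [exact: table_ramsey | exact: table_minimal].
apply/(ordering_ofP (@represents_graph_of _ _) (@represents_graph_of _ _)).
exact: (allP table_shapes).
Qed.
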